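(* Let $\beta=\sigma_{i_1}\cdots\sigma_{i_\ell}$ be a positive braid word on $n$ strands, let $\overline{\beta}:=\sigma_{i_\ell}\cdots\sigma_{i_1}$ be its opposite word, $\delta(\beta)$ the Demazure product of $\beta$, and for $j\in[1,\ell]$ let $\beta_j:=\sigma_{i_1}\cdots\sigma_{i_j}$ and $\overline{\beta}_j:=\sigma_{i_j}\cdots\sigma_{i_1}$. Then: (i) The algebraic map $\Theta:\mathbb C^\ell\to \mathcal{F}\ell_n^{\,\ell+1}$, $(z_1,\dots,z_\ell)\mapsto(\mathcal F^{\mathrm{st}},\mathcal F^1,\dots,\mathcal F^\ell)$, where $\mathcal F^j$ is the flag associated to the matrix $B_{\overline{\beta}_j}^{-1}(z_{\ell-j+1},\dots,z_\ell)$, restricts to an algebraic isomorphism $$\Theta: X(\overline{\beta};\delta(\beta))\xrightarrow{\ \cong\ }\mathrm{brick}^\circ(\beta).$$ (ii) The complement to $X(\overline{\beta};\delta(\beta))$ in $\mathrm{brick}(\beta)$ is a normal crossing divisor. Its components correspond to all possible ways to remove a letter from $\overline{\beta}$ while preserving its Demazure product. In particular, $\mathrm{brick}(\beta)$ is a smooth projective good compactification of the affine variety $X(\overline{\beta};\delta(\beta))$, i.e. one whose boundary is a normal crossing divisor.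
   Context: $\mathcal{F}\ell_n=\mathrm{GL}(n,\mathbb C)/B$ ($B$ upper triangular matrices) is the variety of complete flags in $\mathbb C^n$. For an invertible matrix $A$, the flag $\mathcal F^A$ associated to $A$ has $i$-th subspace spanned by the first $i$ columns of $A$; $\mathcal F^{\mathrm{st}}$ is the standard flag (that of the identity matrix). Permutations are identified with permutation matrices. Braid matrices: $B_i(z)\in\mathrm{GL}(n,\mathbb C[z])$ is the identity except for the block $\begin{pmatrix}0&1\\1&z\end{pmatrix}$ in rows and columns $i,i+1$; for a word $\gamma=\sigma_{a_1}\cdots\sigma_{a_m}$, $B_\gamma(z_1,\dots,z_m)=B_{a_1}(z_1)\cdots B_{a_m}(z_m)$. The braid variety is $X(\gamma;\pi)=\{z\in\mathbb C^m: B_\gamma(z)\pi\text{ is upper triangular}\}$ for $\pi\in S_n$. The Demazure product $\delta(\beta)\in S_n$ is the unique maximal permutation in Bruhat order whose positive reduced braid lift is contained in $\beta$ as a subword. The Bott--Samelson variety $\mathrm{BS}(\beta)$ is the set of tuples of flags $(\mathcal F^0,\dots,\mathcal F^\ell)$ with $\mathcal F^0=\mathcal F^{\mathrm{st}}$ and such that for each $j\in[0,\ell-1]$ either $\mathcal F^j=\mathcal F^{j+1}$ or $\mathcal F^j,\mathcal F^{j+1}$ differ precisely in the $i_{j+1}$-dimensional subspace. $\mathrm{OBS}(\beta)\subset\mathrm{BS}(\beta)$ is the open subset where $\mathcal F^j\ne\mathcal F^{j+1}$ for all $j\in[0,\ell-1]$. Let $m_\beta:\mathrm{BS}(\beta)\to\mathcal{F}\ell_n$,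 $(\mathcal F^0,\dots,\mathcal F^\ell)\mapsto\mathcal F^\ell$. The brick variety is $\mathrm{brick}(\beta):=m_\beta^{-1}(\delta(\beta)\mathcal F^{\mathrm{st}})$, and the open brick variety is $\mathrm{brick}^\circ(\beta):=\mathrm{brick}(\beta)\cap\mathrm{OBS}(\beta)$. In (ii), $X(\overline\beta;\delta(\beta))$ is identified with $\mathrm{brick}^\circ(\beta)\subset\mathrm{brick}(\beta)$ via $\Theta$. *)

(* Defs.v *)
From HB Require Import structures.
From mathcomp Require Import all_boot all_order all_algebra all_fingroup.
From mathcomp Require Import classical_sets reals complex mpoly.

Set Implicit Arguments.
Unset Strict Implicit.
Unset Printing Implicit Defensive.

Import GRing.Theory.

Local Open Scope classical_set_scope.
Local Open Scope ring_scope.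

(* -------------------------------------------------------------------------- *)
(* Braid words, Bruhat order, Demazure product                                *)
(* -------------------------------------------------------------------------- *)

(* The letter i : 'I_n.-1 stands for the generator sigma_(i+1).               *)

Fact strand_hi_subproof n (i : 'I_n.-1) : (i.+1 < n)%N.
Proof. by rewrite -ltn_predRL. Qed.

Definition strand_lo n (i : 'I_n.-1) : 'I_n := widen_ord (leq_pred n) i.
Definition strand_hi n (i : 'I_n.-1) : 'I_n := Ordinal (strand_hi_subproof i).

Definition simple_refl n (i : 'I_n.-1) : 'S_n :=
  tperm (strand_lo i) (strand_hi i).

(* Permutations are turned into matrices by perm_mx, which is multiplicative  *)
(* for the product of 'S_n, so a word has the same meaning in 'S_n and as a   *)
(* product of permutation matrices.                                           *)
Definition word_perm n (w : seq 'I_n.-1) : 'S_n :=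
  (\prod_(i <- w) simple_refl i)%g.

Definition perm_length n (s : 'S_n) : nat :=
  #|[set p : 'I_n * 'I_n | (p.1 < p.2)%N && (s p.2 < s p.1)%N]%SET|.

Definition reduced_word n (w : seq 'I_n.-1) (s : 'S_n) : bool :=
  (word_perm w == s) && (size w == perm_length s).

Definition bruhat_le n : rel 'S_n :=
  connect [rel u v : 'S_n | [exists i, exists j,
    (v == (u * tperm i j)%g) && (perm_length u < perm_length v)%N]].

Definition subword_perm n (w : seq 'I_n.-1) (s : 'S_n) : bool :=
  [exists m : (size w).-tuple bool, reduced_word (mask m w) s].

(* The default value 1 of odflt is never reached: the maximum exists.         *)
Definition demazure n (w : seq 'I_n.-1) : 'S_n :=
  odflt 1%g [pick s : 'S_n | subword_perm w s &&
                [forall u : 'S_n, subword_perm w u ==> bruhat_le u s]].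

Definition remove_letter (T : Type) (k : nat) (w : seq T) : seq T :=
  take k w ++ drop k.+1 w.

(* -------------------------------------------------------------------------- *)
(* Varieties                                                                  *)
(* -------------------------------------------------------------------------- *)

(* A set of points together with, for each point, its admissible coordinate   *)
(* vectors: the vector itself for affine space, all systems of homogeneous    *)
(* coordinates for projective space, all tuples of invertible matrices        *)
(* representing the cosets for a product of copies of GL_n / B.  The Zariski  *)
(* topology and the regular functions are those of the quotient of the space  *)
(* of coordinate vectors.  Varieties are subsets of such a space, consisting  *)
(* of points that do have coordinates.                                        *)
Record cspace (K : fieldType) := CSpace {
  point :> Type;
  ncoord : nat;
  coord : point -> 'rV[K]_ncoord -> Prop }.

Section Varieties.
Variable K : fieldType.
Implicit Types A B : cspace K.

Definition peval m (p : {mpoly K[m]}) (v : 'rV[K]_m) : K :=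
  p.@[fun i => v 0 i].

Definition zclosed A (Y Z : set A) : Prop :=
  Z `<=` Y /\
  exists F : set {mpoly K[ncoord A]},
    forall y v, Y y -> coord y v ->
      (Z y <-> forall p, F p -> peval p v = 0).

Definition zopen A (Y U : set A) : Prop := U `<=` Y /\ zclosed Y (Y `\` U).

Definition zdense A (Y U : set A) : Prop :=
  forall Z, zclosed Y Z -> U `<=` Z -> Z = Y.

(* Irreducibility for the induced topology.                                   *)
Definition irreducible_set A (Z : set A) : Prop :=
  Z !=set0 /\
  forall Z1 Z2, zclosed Z Z1 -> zclosed Z Z2 ->
    Z `<=` Z1 `|` Z2 -> Z `<=` Z1 \/ Z `<=` Z2.

Definition irreducible_component A (D Z : set A) : Prop :=
  [/\ Z `<=` D, irreducible_set Z &
      forall Z', Z' `<=` D -> irreducible_set Z' -> Z `<=` Z' -> Z' = Z].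

Definition regular_at A (Y : set A) (f : A -> K) (x : A) : Prop :=
  exists p q : {mpoly K[ncoord A]},
    (exists2 v, coord x v & peval q v != 0) /\
    (forall y v, Y y -> coord y v -> peval q v != 0 ->
       f y = peval p v / peval q v).

Definition regular A (U : set A) (f : A -> K) : Prop :=
  forall x, U x -> regular_at U f x.

Definition regular_map A B (X : set A) (Y : set B) (phi : A -> B) : Prop :=
  [/\ forall x, X x -> Y (phi x),
      forall Z, zclosed Y Z -> zclosed X (X `&` phi @^-1` Z) &
      forall U f, zopen Y U -> regular U f ->
        regular (X `&` phi @^-1` U) (f \o phi)].

Definition isomorphism A B (X : set A) (Y : set B) (phi : A -> B) : Prop :=
  regular_map X Y phi /\
  exists psi : B -> A,
    [/\ regular_map Y X psi, forall x, X x -> psi (phi x) = x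
      & forall y, Y y -> phi (psi y) = y].

Definition affine_space N : cspace K :=
  @CSpace K 'rV[K]_N N (fun x v => v = x).

(* Points are the lines through the origin.                                   *)
Definition proj_cspace N : cspace K :=
  @CSpace K {vspace 'rV[K]_N.+1} N.+1 (fun L v => v != 0 /\ L = <[v]>%VS).

Definition proj_space N : set (proj_cspace N) := [set L | \dim L = 1%N].

Definition affine_variety N (X : set (affine_space N)) : Prop :=
  zclosed setT X.

Definition projective A (Y : set A) : Prop :=
  exists N (Z : set (proj_cspace N)) (phi : A -> proj_cspace N),
    zclosed (@proj_space N) Z /\ isomorphism Y Z phi.

Definition jacobian m N (f : 'I_m -> {mpoly K[N]}) (v : 'rV[K]_N) :
    'M[K]_(m, N) :=
  \matrix_(i, j) peval (mderiv j (f i)) v.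

(* The open neighbourhood U of x in Y is identified by phi with the locus     *)
(* f = 0, h <> 0 in affine N-space, where the Jacobian of the k equations f   *)
(* has rank k everywhere, i.e. with a standard smooth affine scheme of        *)
(* dimension N - k (such a scheme is reduced, so its points suffice).         *)
Definition smooth_chart A (Y : set A) (x : A) N k
    (f : 'I_k -> {mpoly K[N]}) (h : {mpoly K[N]})
    (U : set A) (phi : A -> affine_space N) : Prop :=
  let V : set (affine_space N) :=
    [set v | peval h v != 0 /\ forall i, peval (f i) v = 0] in
  [/\ zopen Y U, U x, isomorphism U V phi
    & forall v, V v -> row_free (jacobian f v)].

Definition smooth A (Y : set A) : Prop :=
  forall x, Y x -> exists N k (f : 'I_k -> {mpoly K[N]}) h U phi,
    @smooth_chart A Y x N k f h U phi.

(* Near each point x of Y, D is the zero locus of t_1 ... t_r, where the t_i  *)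
(* are part of a system of local parameters of Y at x.  The neighbourhoods    *)
(* are Zariski open, so the irreducible components of D are smooth.           *)
Definition normal_crossing_divisor A (Y D : set A) : Prop :=
  zclosed Y D /\
  forall x, Y x -> exists N k (f : 'I_k -> {mpoly K[N]}) h U phi,
    @smooth_chart A Y x N k f h U phi /\
    exists r (t : 'I_r -> {mpoly K[N]}),
      [/\ forall i, peval (t i) (phi x) = 0,
          row_free (col_mx (jacobian f (phi x)) (jacobian t (phi x)))
        & forall y, U y -> (D y <-> exists i, peval (t i) (phi y) = 0)].

(* phi embeds X as an open dense subset of the projective variety Y, with     *)
(* boundary a normal crossing divisor.                                        *)
Definition good_compactification A B (X : set A) (Y : set B) (phi : A -> B) :
    Prop :=
  [/\ projective Y, zopen Y (phi @` X), isomorphism X (phi @` X) phi,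
      zdense Y (phi @` X) & normal_crossing_divisor Y (Y `\` phi @` X)].

(* ------------------------------------------------------------------------ *)
(* Flags, braid varieties, brick varieties                                  *)
(* ------------------------------------------------------------------------ *)

Definition subspaces n := {ffun 'I_n.+1 -> {vspace 'cV[K]_n}}.

Definition is_flag n (F : subspaces n) : Prop :=
  (forall d, \dim (F d) = d) /\
  (forall d e : 'I_n.+1, (d <= e)%N -> (F d <= F e)%VS).

Definition flag_of n (A : 'M[K]_n) : subspaces n :=
  [ffun d : 'I_n.+1 =>
     <<[seq col k A | k : 'I_n <- enum 'I_n & (k < d)%N]>>%VS].

(* The coordinate vectors of a tuple of flags are the tuples of invertible    *)
(* matrices representing it in (GL_n / B)^m, written as one row vector.       *)
Definition flags_cspace n m : cspace K :=
  @CSpace K {ffun 'I_m -> subspaces n} (m * (n * n))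
    (fun F v => exists M : 'I_m -> 'M[K]_n,
       [/\ forall j, M j \in unitmx, forall j, F j = flag_of (M j)
         & v = mxvec (\matrix_(j < m) mxvec (M j))]).

Definition flags n m : set (flags_cspace n m) :=
  [set F | forall j, is_flag (F j)].

(* B_i(z): the matrix of the transposition, with an additional diagonal entry *)
(* z in the lower right corner of its 2 x 2 block.                            *)
Definition braid_gen n (i : 'I_n.-1) (z : K) : 'M[K]_n :=
  perm_mx (simple_refl i) + z *: delta_mx (strand_hi i) (strand_hi i).

Definition braid_mx n (w : seq 'I_n.-1) (z : seq K) : 'M[K]_n :=
  \big[mulmx/1%:M]_(p <- zip w z) braid_gen p.1 p.2.

Definition coords m (z : affine_space m) : seq K :=
  [seq (z : 'rV[K]_m) 0 k | k <- enum 'I_m].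

Definition upper_triangular n (A : 'M[K]_n) : bool := is_trig_mx A^T.

Definition braid_variety n m (w : m.-tuple 'I_n.-1) (s : 'S_n) :
    set (affine_space m) :=
  [set z | upper_triangular (braid_mx w (coords z) *m perm_mx s)].

Section Brick.
Variables (n l : nat) (beta : l.-tuple 'I_n.-1).
Implicit Type F : flags_cspace n l.+1.

(* For F = (F^0, ..., F^l) and j = 0, ..., l-1 these are F^j and F^(j+1).     *)
Definition flag_before F (j : 'I_l) : subspaces n := F (widen_ord (leqnSn l) j).
Definition flag_after F (j : 'I_l) : subspaces n := F (lift ord0 j).

(* The letter i : 'I_n.-1 is sigma_(i+1), hence the dimension i + 1.          *)
Definition bott_samelson : set (flags_cspace n l.+1) :=
  [set F | [/\ flags F, F ord0 = flag_of 1%:M &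
    forall j : 'I_l, flag_before F j = flag_after F j \/
      forall d : 'I_n.+1, flag_before F j d <> flag_after F j d <->
                          d = (tnth beta j).+1 :> nat]].

Definition open_bott_samelson : set (flags_cspace n l.+1) :=
  [set F | bott_samelson F /\
           forall j : 'I_l, flag_before F j <> flag_after F j].

Definition brick : set (flags_cspace n l.+1) :=
  [set F | bott_samelson F /\ F ord_max = flag_of (perm_mx (demazure beta))].

Definition open_brick : set (flags_cspace n l.+1) :=
  brick `&` open_bott_samelson.

(* For j = 0 the empty product yields the standard flag.                      *)
Definition Theta (z : affine_space l) : flags_cspace n l.+1 :=
  [ffun j : 'I_l.+1 =>
     flag_of (invmx (braid_mx (rev (take j beta)) (drop (l - j) (coords z))))].

(* The letter at position k of the opposite word rev beta is the letter at    *)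
(* position rev_ord k = l - 1 - k of beta.                                    *)
Definition brick_wall (k : 'I_l) : set (flags_cspace n l.+1) :=
  [set F | brick F /\ flag_before F (rev_ord k) = flag_after F (rev_ord k)].

End Brick.
End Varieties.

Arguments affine_space : clear implicits.
Arguments proj_cspace : clear implicits.
Arguments proj_space : clear implicits.
Arguments flags_cspace : clear implicits.
Arguments flags : clear implicits.
Arguments braid_variety K {n m} w s.
Arguments bott_samelson K {n l} beta.
Arguments open_bott_samelson K {n l} beta.
Arguments brick K {n l} beta.
Arguments open_brick K {n l} beta.
Arguments Theta K {n l} beta z.
Arguments brick_wall K {n l} beta k.

(* Main.v *)
Require Import Defs.
From HB Require Import structures.
From mathcomp Require Import all_boot all_order all_algebra all_fingroup.
From mathcomp Require Import boolp classical_sets reals complex mpoly.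
From mathcomp Require Import zify.

Set Implicit Arguments.
Unset Strict Implicit.
Unset Printing Implicit Defensive.

Import GRing.Theory Defs.

Local Open Scope classical_set_scope.
Local Open Scope ring_scope.
(** Write [delta] for the Demazure product of [beta].

    Charts. A path of flags in the Bott-Samelson variety is determined by one
    point on a projective line at each letter. Choosing one of two affine
    charts of each line gives, for every [eps], matrices [chart_mx] that are
    products of elementary and simple permutation matrices, and an open
    embedding of affine [l]-space. The chart in which every letter uses the
    second kind of step is exactly the open Bott-Samelson variety, and its
    matrices are inverses of braid matrices; this gives the isomorphism
    ([ThetaE], [Theta_iso]). In a chart adapted to a point the path is constant
    at a letter exactly when one coordinate vanishes.

    Smoothness. The end of a path satisfies the Schubert conditions of [delta]
    ([bott_samelson_cell_dim]): the dimensions of the intersections of the last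
    flag with the standard flag are bounded below along the word by the
    recursion that those of the coordinate flag of the Demazure product obey. In view of these conditions
    the brick variety is cut out of a chart by the entries of
    [perm_mx delta^-1 *m chart_mx u l] at the inversions of [delta] only
    ([upper_of_inversions]). These equations are independent because upper
    triangular matrices act on paths: differentiating the action of the
    elementary matrices yields tangent vectors on which the equations form a
    triangular system ([brick_eq_deriv]). The action preserves the locus where a
    path is constant at a letter, so the tangent vectors are tangent to all
    walls through a point and the coordinates that define these walls are
    independent of the equations ([jacobian_wall_row_free]). This proves that
    the brick variety is smooth and that the boundary has normal crossings.

    Density and irreducibility. A path that ends in the Bruhat cell of [delta]
    is moved into the brick variety by an upper triangular matrix which can be
    found by row operations, hence depends rationally on the path. This defines
    a rational retraction of each affine chart onto the brick variety that
    preserves the set of letters at which the path is constant ([retract]). Two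
    nonempty open subsets of affine space meet, so the open brick variety is
    dense and the brick variety is irreducible. The wall of a letter is empty
    unless the letter can be removed without changing [delta], and otherwise
    it is a copy of the brick variety of the shorter word and has a point that
    lies on no other wall. So these walls are the components of the boundary.

    Projectivity. Products of minors embed tuples of flags into a projective
    space. From any nonzero coordinate the normalized bases of all subspaces can
    be read off as rational functions; the conditions that these bases are
    nested and give back all coordinates are equations of the image. *)

(** * Bruhat order and Demazure products *)

Lemma strand_loE n (i : 'I_n.-1) : strand_lo i = i :> nat.
Proof. by []. Qed.

Lemma strand_hiE n (i : 'I_n.-1) : strand_hi i = i.+1 :> nat.
Proof. by []. Qed.

Lemma strand_neq n (i : 'I_n.-1) : (strand_hi i == strand_lo i) = false.
Proof. by apply/negbTE/eqP => /(congr1 val) /= ; lia. Qed.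

Lemma simple_reflK n (i : 'I_n.-1) : (simple_refl i * simple_refl i = 1)%g.
Proof. exact: tperm2. Qed.

Lemma simple_reflV n (i : 'I_n.-1) : ((simple_refl i)^-1 = simple_refl i)%g.
Proof. exact: tpermV. Qed.

Lemma tperm_cases n (x y z : 'I_n) :
  [\/ z = x /\ tperm x y z = y, z = y /\ tperm x y z = x
    | [/\ (z : nat) <> x, (z : nat) <> y & tperm x y z = z]].
Proof.
case: tpermP => [->|->|zx zy]; [exact: Or31|exact: Or32|apply: Or33].
by split=> // /val_inj.
Qed.

Lemma simple_refl_lt n (i : 'I_n.-1) (x y : 'I_n) :
  (x < y)%N -> ~~ ((x == strand_lo i) && (y == strand_hi i)) ->
  (simple_refl i x < simple_refl i y)%N.
Proof.
rewrite -!val_eqE /= /simple_refl.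
case: (tperm_cases (strand_lo i) (strand_hi i) x) => [[-> ->]|[-> ->]|[? ? ->]];
  case: (tperm_cases (strand_lo i) (strand_hi i) y) => [[-> ->]|[-> ->]|[? ? ->]] /=; lia.
Qed.

(** The transposition of the positions [a] and [b] of [i] and [j] turns an
    inversion of [u] into one of [u * tperm i j], unless it puts its two positions
    in the wrong order; then the inversion itself persists. The inversion
    [(a, b)] is new. *)
Lemma perm_length_tperm n (u : 'S_n) (i j : 'I_n) :
  (i < j)%N -> (u^-1%g i < u^-1%g j)%N ->
  (perm_length u < perm_length (u * tperm i j)%g)%N.
Proof.
set a := u^-1%g i; set b := u^-1%g j => ij ab.
have ua : u a = i by rewrite permKV.
have ub : u b = j by rewrite permKV.
set v := (u * tperm i j)%g.
have vE x : v x = u (tperm a b x).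
  rewrite permM; case: (tpermP a b) => [->|->|/eqP xa /eqP xb];
    rewrite ?ua ?ub ?tpermL ?tpermR //.
  by rewrite tpermD // -?ua -?ub (inj_eq perm_inj) eq_sym.
have vtE x : v (tperm a b x) = u x by rewrite vE tpermK.
pose f (p : 'I_n * 'I_n) :=
  if (tperm a b p.1 < tperm a b p.2)%N then (tperm a b p.1, tperm a b p.2) else p.
set Iu := finset (fun p : 'I_n * 'I_n => (p.1 < p.2)%N && (u p.2 < u p.1)%N).
set Iv := finset (fun p : 'I_n * 'I_n => (p.1 < p.2)%N && (v p.2 < v p.1)%N).
have f_inj : {in Iu &, injective f}.
  move=> [p1 p2] [q1 q2]; rewrite !inE /f /= => /andP[p12 _] /andP[q12 _].
  case: ifP => hp; case: ifP => hq // [e1 e2].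
  - by rewrite (perm_inj e1) (perm_inj e2).
  - by move: hq; rewrite -e1 -e2 !tpermK p12.
  - by move: hp; rewrite e1 e2 !tpermK q12.
rewrite /perm_length -/Iu -/Iv -(card_in_imset f_inj); apply: proper_card.
apply/properP; split.
  apply/fintype.subsetP => q /imsetP[[p1 p2]]; rewrite inE /f /= => /andP[p12 up] ->.
  case: ifP => /= hp; rewrite inE /= ?hp ?vtE //= p12 /= !vE.
  move: hp p12 up.
  case: (tperm_cases a b p1) => [[-> ->]|[-> ->]|[? ? ->]];
    case: (tperm_cases a b p2) => [[-> ->]|[-> ->]|[? ? ->]]; rewrite ?ua ?ub; lia.
exists (a, b); first by rewrite inE /= ab !vE tpermL tpermR ua ub.
apply/negP => /imsetP[[p1 p2]]; rewrite inE /f /= => /andP[p12 up].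
case: ifP => hp [ea eb].
  have := p12; rewrite -(tpermK a b p1) -(tpermK a b p2) -ea -eb tpermL tpermR; lia.
by move: up; rewrite -ea -eb ua ub; lia.
Qed.

Lemma perm_length_tperm_iff n (u : 'S_n) (i j : 'I_n) :
  (i < j)%N ->
  (perm_length u < perm_length (u * tperm i j)%g)%N = (u^-1%g i < u^-1%g j)%N.
Proof.
move=> ij; apply/idP/idP => [lt|]; last exact: perm_length_tperm.
rewrite ltnNge leq_eqVlt negb_or; apply/andP; split.
  by rewrite eq_sym val_eqE (inj_eq perm_inj) -val_eqE /=; lia.
apply/negP => gt.
have := @perm_length_tperm _ (u * tperm i j)%g i j ij.
rewrite invMg tpermV !permM tpermL tpermR => /(_ gt).
by rewrite -mulgA tperm2 mulg1; lia.
Qed.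

Lemma perm_length_simple_le n (u : 'S_n) (i : 'I_n.-1) :
  (perm_length (u * simple_refl i)%g <= (perm_length u).+1)%N.
Proof.
rewrite /perm_length; set Iu := [set p | _ & (u _ < _)%N]%SET.
pose p0 := (u^-1%g (strand_lo i), u^-1%g (strand_hi i)).
apply: (@leq_trans #|p0 |: Iu|); last by rewrite cardsU1 -add1n leq_add2r leq_b1.
apply/subset_leq_card/fintype.subsetP => -[p q]; rewrite !inE /= !permM => /andP[pq lt].
rewrite pq /=; case: (ltngtP (u q) (u p)) => [//||/val_inj/perm_inj e]; rewrite ?orbF ?orbT //.
  move=> gt; apply/negPn/negP => ne.
  have := @simple_refl_lt _ i _ _ gt; rewrite ltnNge ltnW // => h.
  suff: false by []; apply: h; apply/negP => /andP[/eqP e1 /eqP e2].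
  by move: ne; rewrite /p0 -e1 -e2 !permK eqxx.
by move: pq; rewrite e ltnn.
Qed.

Lemma bruhat_le_trans n (u v w : 'S_n) : bruhat_le u v -> bruhat_le v w -> bruhat_le u w.
Proof. exact: connect_trans. Qed.

Lemma bruhat_le_tperm n (u : 'S_n) (i j : 'I_n) :
  (perm_length u < perm_length (u * tperm i j)%g)%N -> bruhat_le u (u * tperm i j)%g.
Proof.
by move=> lt; apply: connect1 => /=; apply/existsP; exists i; apply/existsP; exists j; rewrite eqxx.
Qed.

Lemma bruhat_le_length n (u v : 'S_n) :
  bruhat_le u v -> u = v \/ (perm_length u < perm_length v)%N.
Proof.
move=> /connectP[p]; elim: p u => [|x p IH] u /= => [_ ->|/andP[]]; first by left.
move=> /existsP[i /existsP[j /andP[_ lt]]] hp hv; right.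
by case: (IH x hp hv) => [<-|/(ltn_trans lt)].
Qed.

Lemma bruhat_le_antisym n (u v : 'S_n) : bruhat_le u v -> bruhat_le v u -> u = v.
Proof. by move=> /bruhat_le_length[//|a] /bruhat_le_length[//|]; lia. Qed.

(** Right multiplication by [s] preserves every covering [u < u t] with [t <> s],
    because the conjugate [s t s] exchanges two values that [s] leaves in the
    same order. *)
Lemma bruhat_le_simple n (u v : 'S_n) (i : 'I_n.-1) :
  let s := simple_refl i in
  bruhat_le u v -> bruhat_le (u * s)%g v \/ bruhat_le (u * s)%g (v * s)%g.
Proof.
move=> s /connectP[p]; elim: p u => [|x p IH] u /= => [_ ->|/andP[]].
  by right; exact: connect0.
move=> /existsP[a /existsP[b /andP[/eqP-> lt]]] hp hv.
wlog ab : a b lt hp hv / (a < b)%N.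
  move=> wl; case: (ltngtP a b) => [ab|ba|/val_inj e].
  - exact: (wl a b).
  - by apply: (wl b a) => //; rewrite tpermC.
  - by move: lt; rewrite e tperm1 mulg1 ltnn.
have IH' := IH _ hp hv.
have xv : bruhat_le (u * tperm a b)%g v by apply/connectP; exists p.
case hs : ((a == strand_lo i) && (b == strand_hi i)).
  by case/andP: hs xv => /eqP-> /eqP-> xv; left.
have le1 : bruhat_le (u * s)%g (u * tperm a b * s)%g.
  have -> : (u * tperm a b * s = (u * s) * tperm (s a) (s b))%g.
    by rewrite -tpermJ conjgE /s simple_reflV -!mulgA (mulgA (simple_refl i)) simple_reflK mul1g.
  apply: bruhat_le_tperm; rewrite perm_length_tperm_iff.
    by rewrite invMg !permM !permK -perm_length_tperm_iff.
  by apply: simple_refl_lt; rewrite ?hs.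
by case: IH' => h; [left|right]; apply: bruhat_le_trans le1 h.
Qed.

(** The Demazure product computed letter by letter: a letter is multiplied in
    exactly when it increases the length. *)
Definition demazure_step n (m : 'S_n) (i : 'I_n.-1) : 'S_n :=
  if (m^-1%g (strand_lo i) < m^-1%g (strand_hi i))%N then (m * simple_refl i)%g else m.

Definition demazure_fold n (w : seq 'I_n.-1) : 'S_n := foldl (@demazure_step n) 1%g w.

Lemma demazure_fold_rcons n w (i : 'I_n.-1) :
  demazure_fold (rcons w i) = demazure_step (demazure_fold w) i.
Proof. by rewrite /demazure_fold foldl_rcons. Qed.

Lemma word_perm_cat n (w v : seq 'I_n.-1) :
  word_perm (w ++ v) = (word_perm w * word_perm v)%g.
Proof. exact: big_cat. Qed.

Lemma word_perm1 n (i : 'I_n.-1) : word_perm [:: i] = simple_refl i.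
Proof. exact: big_seq1. Qed.

Lemma simple_descent n (m : 'S_n) (i : 'I_n.-1) :
  (m^-1%g (strand_lo i) < m^-1%g (strand_hi i))%N = false ->
  bruhat_le (m * simple_refl i)%g m.
Proof.
move=> h; have {2}-> : m = (m * simple_refl i * simple_refl i)%g.
  by rewrite -mulgA simple_reflK mulg1.
apply: bruhat_le_tperm; rewrite perm_length_tperm_iff //=.
rewrite invMg simple_reflV !permM tpermL tpermR ltn_neqAle leqNgt h andbT.
by rewrite val_eqE (inj_eq perm_inj) strand_neq.
Qed.

Lemma bruhat_le_demazure_step n (m : 'S_n) (i : 'I_n.-1) :
  bruhat_le m (demazure_step m i) /\ bruhat_le (m * simple_refl i)%g (demazure_step m i).
Proof.
rewrite /demazure_step; case: ifP => h; split; try exact: connect0.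
  by apply: bruhat_le_tperm; rewrite perm_length_tperm_iff.
exact: simple_descent.
Qed.

(** By the lifting property the comparison survives the next letter, whether or not
    the subword takes it. *)
Lemma mask_le_demazure_fold n (w : seq 'I_n.-1) (b : bitseq) :
  size b = size w -> bruhat_le (word_perm (mask b w)) (demazure_fold w).
Proof.
elim/last_ind: w b => [|w i IH] b.
  by move=> _; rewrite mask0 /word_perm big_nil; exact: connect0.
case/lastP: b => [|b c]; rewrite ?size_rcons // => -[sz].
rewrite mask_rcons // demazure_fold_rcons word_perm_cat.
have [le1 le2] := bruhat_le_demazure_step (demazure_fold w) i.
case: c => /=; last first.
  by rewrite /word_perm big_nil mulg1; apply: bruhat_le_trans le1; exact: IH.
by rewrite word_perm1; case: (bruhat_le_simple i (IH b sz)) => h; apply: bruhat_le_trans h _.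
Qed.

Lemma demazure_fold_reduced n (w : seq 'I_n.-1) :
  exists2 b : bitseq, size b = size w & reduced_word (mask b w) (demazure_fold w).
Proof.
elim/last_ind: w => [|w i [b sz /andP[/eqP e /eqP l]]].
  exists [::] => //=; rewrite /reduced_word /word_perm big_nil eqxx /=.
  rewrite eq_sym cards_eq0; apply/eqP/setP => -[p q]; rewrite !inE /= !perm1; lia.
rewrite demazure_fold_rcons /demazure_step; case: ifP => h.
  exists (rcons b true); first by rewrite !size_rcons sz.
  rewrite /reduced_word mask_rcons // word_perm_cat e word_perm1 eqxx /= size_cat l /=.
  have := perm_length_simple_le (demazure_fold w) i.
  by rewrite addn1 eqn_leq andbC => ->; rewrite /= perm_length_tperm.
exists (rcons b false); first by rewrite !size_rcons sz.
by rewrite /reduced_word mask_rcons // cats0 e l !eqxx.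
Qed.

Definition demazure_max n (w : seq 'I_n.-1) (s : 'S_n) :=
  subword_perm w s /\ forall u : 'S_n, subword_perm w u -> bruhat_le u s.

Lemma demazure_fold_max n (w : seq 'I_n.-1) : demazure_max w (demazure_fold w).
Proof.
split=> [|u /existsP[b /andP[/eqP<- _]]].
  have [b sz red] := demazure_fold_reduced w.
  by apply/existsP; exists (tcast sz (in_tuple b)); rewrite val_tcast.
by apply: mask_le_demazure_fold; rewrite size_tuple.
Qed.

Lemma demazure_max_uniq n (w : seq 'I_n.-1) (s t : 'S_n) :
  demazure_max w s -> demazure_max w t -> s = t.
Proof. by move=> [a b] [c d]; apply: bruhat_le_antisym; [apply: d|apply: b]. Qed.

Lemma demazure_eq n (w : seq 'I_n.-1) (s : 'S_n) : demazure_max w s -> demazure w = s.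
Proof.
move=> ms; rewrite /demazure; case: pickP => [t /andP[h /forallP k]|none] /=.
  by apply: (@demazure_max_uniq _ w) => //; split => // u; exact/implyP.
have := none s; case: ms => -> k /=; move/negbT/negP; case.
by apply/forallP => u; apply/implyP; exact: k.
Qed.

Lemma demazureE n (w : seq 'I_n.-1) : demazure w = demazure_fold w.
Proof. exact/demazure_eq/demazure_fold_max. Qed.

Lemma perm_lengthV n (s : 'S_n) : perm_length s^-1%g = perm_length s.
Proof.
have le (t : 'S_n) : (perm_length t <= perm_length t^-1%g)%N.
  rewrite /perm_length; set It := finset _.
  pose f (p : 'I_n * 'I_n) := (t p.2, t p.1).
  have fi : injective f by move=> [a b] [c d] [/perm_inj-> /perm_inj->].
  rewrite -(card_imset _ fi); apply/subset_leq_card/fintype.subsetP => q /imsetP[[a b]].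
  by rewrite !inE /= => /andP[h1 h2] -> /=; rewrite !permK h1 h2.
by apply/eqP; rewrite eqn_leq le andbT; have := le s^-1%g; rewrite invgK.
Qed.

Lemma bruhat_leV n (u v : 'S_n) : bruhat_le u v -> bruhat_le u^-1%g v^-1%g.
Proof.
move=> /connectP[p]; elim: p u => [|x p IH] u /= => [_ ->|/andP[]]; first exact: connect0.
move=> /existsP[a /existsP[b /andP[/eqP-> lt]]] hp hv.
apply: bruhat_le_trans (IH _ hp hv).
have e : ((u * tperm a b)^-1 = u^-1 * tperm (u^-1 a) (u^-1 b))%g.
  by rewrite -tpermJ conjgE invgK invMg tpermV !mulgA mulVg mul1g.
by rewrite e; apply: bruhat_le_tperm; rewrite -e !perm_lengthV.
Qed.

Lemma word_perm_rev n (w : seq 'I_n.-1) : word_perm (rev w) = (word_perm w)^-1%g.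
Proof.
elim: w => [|i w IH]; first by rewrite /word_perm big_nil invg1.
by rewrite rev_cons -cats1 word_perm_cat IH word_perm1 -cat1s word_perm_cat word_perm1
  invMg simple_reflV.
Qed.

Lemma subword_perm_rev n (w : seq 'I_n.-1) (s : 'S_n) :
  subword_perm w s -> subword_perm (rev w) s^-1%g.
Proof.
move=> /existsP[b /andP[/eqP e /eqP l]]; apply/existsP.
have sz : size (rev b) = size (rev w) by rewrite !size_rev size_tuple.
exists (tcast sz (in_tuple (rev b))); rewrite val_tcast /= -rev_mask ?size_tuple //.
by rewrite /reduced_word word_perm_rev e size_rev l perm_lengthV !eqxx.
Qed.

(** Inversion of permutations reverses words and preserves the Bruhat order. *)
Lemma demazure_rev n (w : seq 'I_n.-1) : demazure (rev w) = (demazure w)^-1%g.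
Proof.
apply: demazure_eq; rewrite demazureE.
have [sub max] := demazure_fold_max w; split; first exact: subword_perm_rev.
move=> u /subword_perm_rev; rewrite revK => /max /bruhat_leV.
by rewrite invgK.
Qed.

(** Dimension of the intersection of [F_b] with the [a]-th standard coordinate
    subspace, where [F] is the coordinate flag of [m]. *)
Definition cell_dim n (m : 'S_n) (a b : nat) : nat :=
  #|[set c : 'I_n | (c < b)%N && (m^-1%g c < a)%N]%SET|.

Lemma cell_dimS n (m : 'S_n) a (b : 'I_n) :
  cell_dim m a b.+1 = (cell_dim m a b + (m^-1%g b < a)%N)%N.
Proof.
rewrite /cell_dim; case: (boolP (m^-1%g b < a)%N) => h; last first.
  rewrite addn0; apply: eq_card => c; rewrite !inE ltnS leq_eqVlt.
  by case: (altP (c =P b)) => [->|]; rewrite ?eqxx ?(negbTE h) ?andbF //= -val_eqE => /negbTE->.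
rewrite addn1; set S := [set c : 'I_n | (c < b)%N && _]%SET.
have <- : #|b |: S| = #|S|.+1 by rewrite cardsU1 !inE ltnn.
apply: eq_card => c; rewrite !inE ltnS leq_eqVlt.
by case: (altP (c =P b)) => [->|]; rewrite ?eqxx ?h //= -val_eqE => /negbTE->.
Qed.

Lemma cell_dim_simple n (m : 'S_n) (i : 'I_n.-1) a b :
  b != i.+1 -> cell_dim (m * simple_refl i)%g a b = cell_dim m a b.
Proof.
move=> bi; rewrite /cell_dim -(card_imset _ (@perm_inj _ (simple_refl i))).
apply: eq_card => c; apply/imsetP/idP => [[d]|].
  rewrite !inE invMg simple_reflV permM => /andP[h1 h2] ->; rewrite h2 andbT.
  by move: h1 bi; rewrite /simple_refl; case: tpermP => [->|->|]; rewrite ?strand_hiE ?strand_loE; lia.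
rewrite inE => /andP[h1 h2]; exists (simple_refl i c); last by rewrite tpermK.
rewrite !inE invMg simple_reflV permM tpermK h2 andbT.
by move: h1 bi; rewrite /simple_refl; case: tpermP => [->|->|]; rewrite ?strand_hiE ?strand_loE; lia.
Qed.

(** Only the [(i + 1)]-st subspace of the coordinate flag changes. It takes
    the vector of larger index of the two that lie between [F_i] and
    [F_(i+2)]. *)
Lemma cell_dim_demazure_step n (m : 'S_n) (i : 'I_n.-1) a b :
  let m' := demazure_step m i in
  (b != i.+1 -> cell_dim m' a b = cell_dim m a b) /\
  ((cell_dim m' a i.+1 <= cell_dim m a i)%N \/
   (cell_dim m' a i.+1 < cell_dim m a i.+2)%N).
Proof.
rewrite /demazure_step /=; split; first by case: ifP => // _; exact: cell_dim_simple.
have e1 m' := @cell_dimS _ m' a (strand_lo i).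
have e2 := @cell_dimS _ m a (strand_hi i).
move: e1 e2; rewrite !strand_loE !strand_hiE => e1 ->.
rewrite !e1; case: ifP => h; last by lia.
rewrite cell_dim_simple; last by lia.
rewrite invMg simple_reflV permM tpermL.
by move: (m^-1%g _) (m^-1%g _) h => x y h; lia.
Qed.
(** * Germs of rational functions and regular maps *)

Section Germs.
Variables (K : fieldType) (N : nat).
Implicit Types (p q : {mpoly K[N]}) (v : 'rV[K]_N) (S : set 'rV[K]_N)
  (P Q : 'rV[K]_N -> Prop) (f g : 'rV[K]_N -> K).

Lemma pevalM p q v : peval (p * q) v = peval p v * peval q v.
Proof. exact: mevalM. Qed.

Lemma pevalD p q v : peval (p + q) v = peval p v + peval q v.
Proof. exact: mevalD. Qed.

Lemma peval1 v : peval 1 v = 1.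
Proof. exact: meval1. Qed.

Lemma pevalC c v : peval c%:MP v = c.
Proof. exact: mevalC. Qed.

Lemma pevalX i v : peval 'X_i v = v 0 i.
Proof. exact: mevalXU. Qed.

(** The set [S] will consist of the coordinate vectors of the points of a variety;
    the open condition is imposed on the ambient space. *)
Definition znear S v0 P :=
  exists2 q : {mpoly K[N]}, peval q v0 != 0 & forall v, S v -> peval q v != 0 -> P v.

Lemma znearT S v0 P : (forall v, S v -> P v) -> znear S v0 P.
Proof. by move=> h; exists 1 => [|v /h]; rewrite ?peval1 ?oner_eq0. Qed.

Lemma znear_self S v0 P : S v0 -> znear S v0 P -> P v0.
Proof. by move=> Sv [q qv]; exact. Qed.

Lemma znear_imp S v0 P Q : (forall v, S v -> P v -> Q v) -> znear S v0 P -> znear S v0 Q.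
Proof. by move=> PQ [q qv h]; exists q => // v Sv qn; apply: PQ => //; exact: h. Qed.

Lemma znear_and S v0 P Q : znear S v0 P -> znear S v0 Q -> znear S v0 (fun v => P v /\ Q v).
Proof.
move=> [q qv h] [q' qv' h']; exists (q * q') => [|v Sv]; rewrite pevalM mulf_eq0.
  by rewrite negb_or qv.
by rewrite negb_or => /andP[? ?]; split; [exact: h|exact: h'].
Qed.

Lemma znear_subset S S' v0 P : S `<=` S' -> znear S' v0 P -> znear S v0 P.
Proof. by move=> sub [q qv h]; exists q => // v /sub; exact: h. Qed.

Lemma znear_all (I : finType) S v0 (P : I -> 'rV[K]_N -> Prop) :
  (forall i, znear S v0 (P i)) -> znear S v0 (fun v => forall i, P i v).
Proof.
move=> near; have /choice[q h] : forall i, exists q : {mpoly K[N]}, peval q v0 != 0 /\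
    (forall v, S v -> peval q v != 0 -> P i v).
  by move=> i; have [q] := near i; exists q.
have qv i : peval (q i) v0 != 0 by case: (h i).
exists (\prod_i q i) => [|v Sv].
  by rewrite /peval rmorph_prod prodf_seq_neq0; apply/allP => i _; exact: qv.
rewrite /peval rmorph_prod prodf_seq_neq0 => /allP qn i.
by have [_] := h i; apply => //; apply: qn; rewrite mem_index_enum.
Qed.

(** The function is arbitrary outside of [S], and also on [S] where the denominator
    vanishes. Hence a function built with total inverses is rational wherever no
    division by zero takes place. *)
Definition rat_at S v0 f := exists p q, peval q v0 != 0 /\
  forall v, S v -> peval q v != 0 -> f v = peval p v / peval q v.

Lemma rat_at_subset S S' v0 f : S `<=` S' -> rat_at S' v0 f -> rat_at S v0 f.
Proof. by move=> sub [p [q [qv h]]]; exists p, q; split=> // v /sub; exact: h. Qed.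

Lemma rat_at_poly S v0 p : rat_at S v0 (peval p).
Proof. by exists p, 1; split=> [|v _]; rewrite peval1 ?oner_eq0 ?divr1. Qed.

Lemma rat_at_near S v0 f g : znear S v0 (fun v => f v = g v) -> rat_at S v0 f -> rat_at S v0 g.
Proof.
move=> [q qv h] [a [b [bv k]]]; exists (a * q), (b * q).
rewrite !pevalM mulf_neq0 //; split=> // v Sv; rewrite !pevalM mulf_eq0 negb_or.
by move=> /andP[bn qn]; rewrite -h // k // -mulf_div divff // mulr1.
Qed.

Lemma rat_at_eq S v0 f g : (forall v, S v -> f v = g v) -> rat_at S v0 f -> rat_at S v0 g.
Proof. by move=> h; apply: rat_at_near; exact: znearT. Qed.

Lemma rat_at_ext S v0 f g : f =1 g -> rat_at S v0 f -> rat_at S v0 g.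
Proof. by move=> h; apply: rat_at_eq => v _; exact: h. Qed.

Lemma rat_at_cst S v0 c : rat_at S v0 (fun=> c).
Proof. by apply: rat_at_ext (rat_at_poly S v0 c%:MP) => v; rewrite pevalC. Qed.

Lemma rat_at_coord S v0 i : rat_at S v0 (fun v => v 0 i).
Proof. by apply: rat_at_ext (rat_at_poly S v0 'X_i) => v; rewrite pevalX. Qed.

Lemma rat_atM S v0 f g : rat_at S v0 f -> rat_at S v0 g -> rat_at S v0 (fun v => f v * g v).
Proof.
move=> [a [b [bv h]]] [c [d [dv k]]]; exists (a * c), (b * d).
rewrite pevalM mulf_neq0 //; split=> // v Sv; rewrite !pevalM mulf_eq0 negb_or.
by move=> /andP[bn dn]; rewrite h // k // mulf_div.
Qed.

Lemma rat_atD S v0 f g : rat_at S v0 f -> rat_at S v0 g -> rat_at S v0 (fun v => f v + g v).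
Proof.
move=> [a [b [bv h]]] [c [d [dv k]]]; exists (a * d + c * b), (b * d).
rewrite pevalM mulf_neq0 //; split=> // v Sv; rewrite pevalD !pevalM mulf_eq0 negb_or.
by move=> /andP[bn dn]; rewrite h // k // addf_div.
Qed.

Lemma rat_atN S v0 f : rat_at S v0 f -> rat_at S v0 (fun v => - f v).
Proof.
by move=> h; apply: rat_at_ext (rat_atM (rat_at_cst S v0 (-1)) h) => v; rewrite mulN1r.
Qed.

Lemma rat_atB S v0 f g : rat_at S v0 f -> rat_at S v0 g -> rat_at S v0 (fun v => f v - g v).
Proof. by move=> h k; apply: rat_atD h (rat_atN k). Qed.

Lemma rat_at_neq0 S v0 f : S v0 -> rat_at S v0 f -> f v0 != 0 -> znear S v0 (fun v => f v != 0).
Proof.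
move=> Sv0 [a [b [bv h]]]; rewrite h // mulf_eq0 negb_or => /andP[an _].
exists (a * b) => [|v Sv]; rewrite pevalM mulf_eq0 negb_or ?an // => /andP[an' bn'].
by rewrite h // mulf_neq0 ?invr_eq0.
Qed.

Lemma rat_atV S v0 f : S v0 -> rat_at S v0 f -> f v0 != 0 -> rat_at S v0 (fun v => (f v)^-1).
Proof.
move=> Sv0 rf fn; have [a [b [bv h]]] := rf.
have an : peval a v0 != 0 by move: fn; rewrite h // mulf_eq0 negb_or => /andP[].
exists (b * b), (a * b); rewrite pevalM mulf_neq0 //; split=> // v Sv; rewrite !pevalM mulf_eq0 negb_or.
by move=> /andP[an' bn]; rewrite h // invf_div -mulf_div divff // mulr1.
Qed.

Lemma rat_at_sum (I : Type) (r : seq I) (Q : pred I) S v0 (F : I -> 'rV[K]_N -> K) :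
  (forall i, rat_at S v0 (F i)) -> rat_at S v0 (fun v => \sum_(i <- r | Q i) F i v).
Proof.
move=> h; elim: r => [|i r IH].
  by apply: rat_at_ext (rat_at_cst S v0 0) => v; rewrite big_nil.
case Qi : (Q i); last by apply: rat_at_ext IH => v; rewrite big_cons Qi.
by apply: rat_at_ext (rat_atD (h i) IH) => v; rewrite big_cons Qi.
Qed.

Lemma rat_at_prod (I : Type) (r : seq I) (Q : pred I) S v0 (F : I -> 'rV[K]_N -> K) :
  (forall i, rat_at S v0 (F i)) -> rat_at S v0 (fun v => \prod_(i <- r | Q i) F i v).
Proof.
move=> h; elim: r => [|i r IH].
  by apply: rat_at_ext (rat_at_cst S v0 1) => v; rewrite big_nil.
case Qi : (Q i); last by apply: rat_at_ext IH => v; rewrite big_cons Qi.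
by apply: rat_at_ext (rat_atM (h i) IH) => v; rewrite big_cons Qi.
Qed.

Lemma rat_at_exp S v0 f k : rat_at S v0 f -> rat_at S v0 (fun v => f v ^+ k).
Proof.
move=> h; elim: k => [|k IH]; first exact: rat_at_cst.
by apply: rat_at_ext (rat_atM h IH) => v; rewrite exprS.
Qed.

Definition rat_mx S v0 m n (A : 'rV[K]_N -> 'M[K]_(m, n)) :=
  forall i j, rat_at S v0 (fun v => A v i j).

Lemma rat_mx_cst S v0 m n (A : 'M[K]_(m, n)) : rat_mx S v0 (fun=> A).
Proof. by move=> i j; exact: rat_at_cst. Qed.

Lemma rat_mx_subset S S' v0 m n (A : 'rV[K]_N -> 'M[K]_(m, n)) :
  S `<=` S' -> rat_mx S' v0 A -> rat_mx S v0 A.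
Proof. by move=> sub h i j; exact: rat_at_subset sub (h i j). Qed.

Lemma rat_mx_ext S v0 m n (A B : 'rV[K]_N -> 'M[K]_(m, n)) :
  A =1 B -> rat_mx S v0 A -> rat_mx S v0 B.
Proof. by move=> h k i j; apply: rat_at_ext (k i j) => v; rewrite h. Qed.

Lemma rat_mxM S v0 m n r (A : 'rV[K]_N -> 'M[K]_(m, n)) (B : 'rV[K]_N -> 'M[K]_(n, r)) :
  rat_mx S v0 A -> rat_mx S v0 B -> rat_mx S v0 (fun v => A v *m B v).
Proof.
move=> h k i j; apply: (@rat_at_ext _ _ (fun v => \sum_a A v i a * B v a j)).
  by move=> v; rewrite mxE.
by apply: rat_at_sum => a; exact: rat_atM.
Qed.

Lemma rat_mxD S v0 m n (A B : 'rV[K]_N -> 'M[K]_(m, n)) :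
  rat_mx S v0 A -> rat_mx S v0 B -> rat_mx S v0 (fun v => A v + B v).
Proof.
by move=> h k i j; apply: rat_at_ext (rat_atD (h i j) (k i j)) => v; rewrite mxE.
Qed.

Lemma rat_mxZ S v0 m n f (A : 'rV[K]_N -> 'M[K]_(m, n)) :
  rat_at S v0 f -> rat_mx S v0 A -> rat_mx S v0 (fun v => f v *: A v).
Proof.
by move=> h k i j; apply: rat_at_ext (rat_atM h (k i j)) => v; rewrite mxE.
Qed.

Lemma rat_at_det S v0 n (A : 'rV[K]_N -> 'M[K]_n) :
  rat_mx S v0 A -> rat_at S v0 (fun v => \det (A v)).
Proof.
move=> h; apply: rat_at_sum => s; apply: rat_atM; first exact: rat_at_cst.
by apply: rat_at_prod => i; exact: h.
Qed.

Lemma rat_mx_adj S v0 n (A : 'rV[K]_N -> 'M[K]_n) :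
  rat_mx S v0 A -> rat_mx S v0 (fun v => \adj (A v)).
Proof.
move=> h i j.
apply: (@rat_at_ext _ _ (fun v => (-1) ^+ (j + i) * \det (row' j (col' i (A v))))).
  by move=> v; rewrite mxE.
apply: rat_atM; first exact: rat_at_cst.
apply: rat_at_det => a b; apply: rat_at_ext (h (lift j a) (lift i b)) => v.
by rewrite !mxE.
Qed.

Lemma rat_mxV S v0 n (A : 'rV[K]_N -> 'M[K]_n) : S v0 ->
  rat_mx S v0 A -> A v0 \in unitmx -> rat_mx S v0 (fun v => invmx (A v)).
Proof.
move=> Sv0 h Au i j.
have d0 : \det (A v0) != 0 by rewrite -unitfE -unitmxE.
have rd := rat_at_det h.
have := rat_atM (rat_atV Sv0 rd d0) (rat_mx_adj h i j).
apply: rat_at_near; apply: znear_imp (rat_at_neq0 Sv0 rd d0) => v _ dv.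
by rewrite /invmx unitmxE unitfE dv [RHS]mxE.
Qed.

End Germs.

Lemma rat_at_comp (K : fieldType) N M (S : set 'rV[K]_N) v0 (G : 'rV[K]_N -> 'rV[K]_M)
    (p : {mpoly K[M]}) :
  rat_mx S v0 G -> rat_at S v0 (fun v => peval p (G v)).
Proof.
move=> h; apply: (@rat_at_ext _ _ _ _ (fun v => \sum_(m <- msupp p) p@_m * \prod_i (G v) 0 i ^+ m i)).
  by move=> v; rewrite /peval mevalE.
apply: rat_at_sum => m; apply: rat_atM; first exact: rat_at_cst.
by apply: rat_at_prod => i; apply: rat_at_exp; exact: h.
Qed.

Section RegularMaps.
Variable K : fieldType.
Implicit Types A B : cspace K.

Definition coord_set A (Y : set A) : set 'rV[K]_(ncoord A) :=
  [set v | exists2 y, Y y & coord y v].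

Definition has_coord A (Y : set A) := forall y, Y y -> exists v, coord y v.

Lemma coord_set_subset A (Y Z : set A) : Y `<=` Z -> coord_set Y `<=` coord_set Z.
Proof. by move=> sub v [y /sub]; exists y. Qed.

(** The equations of a closed set may be taken to be all polynomials that vanish
    on its coordinate vectors. *)
Lemma zclosedP A (Y Z : set A) : zclosed Y Z <-> (Z `<=` Y /\
  forall y v, Y y -> ~ Z y -> coord y v -> znear (coord_set Z) v (fun=> False)).
Proof.
split=> [[sub [F h]]|[sub h]]; split=> //.
  move=> y v Yy nZ yv; have hy := h y v Yy yv.
  have /existsNP[p /not_implyP[Fp /eqP pv]] : ~ forall p, F p -> peval p v = 0.
    by move=> /hy.
  by exists p => // u [z Zz zu] /eqP; apply; exact: (h z u (sub _ Zz) zu).1.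
exists [set p | forall u, coord_set Z u -> peval p u = 0] => y v Yy yv; split=> [Zy p|].
  by apply; exists y.
move=> hp; apply: contrapT => nZ; have [q qv] := h y v Yy nZ yv.
move=> hq; move/eqP: qv; apply; apply: hp => u Su.
by apply/eqP/negPn/negP => /(hq u Su).
Qed.

Lemma zclosed_rat A (Y Z : set A) : Z `<=` Y ->
  (forall y v, Y y -> ~ Z y -> coord y v -> exists f, [/\ rat_at (coord_set Y) v f, f v != 0
     & forall u, coord_set Z u -> f u = 0]) -> zclosed Y Z.
Proof.
move=> sub h; apply/zclosedP; split=> // y v Yy nZ yv.
have [f [rf fn f0]] := h y v Yy nZ yv.
apply: znear_imp (znear_subset (coord_set_subset sub) (rat_at_neq0 _ rf fn)); last by exists y.
by move=> u Zu; rewrite f0 ?eqxx.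
Qed.

Lemma zclosed0 A (Y : set A) : zclosed Y set0.
Proof.
by apply/zclosedP; split=> // y v _ _ _; apply: znearT => u [].
Qed.

Lemma zclosedU A (Y Z1 Z2 : set A) : zclosed Y Z1 -> zclosed Y Z2 -> zclosed Y (Z1 `|` Z2).
Proof.
move=> /zclosedP[s1 h1] /zclosedP[s2 h2]; apply/zclosedP; split=> [y [/s1|/s2]//|y v Yy nZ yv].
have [q1 n1 q1P] : znear (coord_set Z1) v (fun=> False) by apply: h1 yv => // ?; apply: nZ; left.
have [q2 n2 q2P] : znear (coord_set Z2) v (fun=> False) by apply: h2 yv => // ?; apply: nZ; right.
exists (q1 * q2); first by rewrite pevalM mulf_neq0.
move=> u [z [Zz|Zz] zu]; rewrite pevalM mulf_eq0 negb_or => /andP[a b].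
  by apply: q1P a; exists z.
by apply: q2P b; exists z.
Qed.

Lemma zclosed_sub A (Y Y' Z : set A) : Y' `<=` Y -> zclosed Y Z -> zclosed Y' (Y' `&` Z).
Proof.
move=> sub [sZ [F h]]; split=> [y []//|]; exists F => y v Yy yv.
by rewrite -(h y v (sub _ Yy) yv); split=> [[]|].
Qed.

Lemma zclosed_trans A (Y Y' Z : set A) : zclosed Y Y' -> zclosed Y' Z -> zclosed Y Z.
Proof.
move=> [s [F h]] [s' [F' h']]; split=> [y /s' /s //|]; exists (F `|` F') => y v Yy yv; split.
  by move=> Zy p [/((h y v Yy yv).1 (s' _ Zy))|/((h' y v (s' _ Zy) yv).1 Zy)].
move=> hp; have Y'y : Y' y by apply/(h y v Yy yv) => p Fp; apply: hp; left.
by apply/(h' y v Y'y yv) => p Fp; apply: hp; right.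
Qed.

Lemma zopen_near A (Y U : set A) : U `<=` Y ->
  (forall y v, U y -> coord y v ->
     znear (coord_set Y) v (fun u => forall z, Y z -> coord z u -> U z)) -> zopen Y U.
Proof.
move=> sub h; split=> //; apply/zclosedP; split=> [y []//|y v Yy nU yv].
have Uy : U y by apply: contrapT => nUy; apply: nU.
have sub' : coord_set (Y `\` U) `<=` coord_set Y by apply: coord_set_subset => z [].
apply: znear_imp (znear_subset sub' (h y v Uy yv)) => u [z [Yz nUz] zu] /(_ z Yz zu).
exact: nUz.
Qed.

(** The value [w] of the representing functions is prescribed because a regular
    function on the target may be represented at some coordinate vectors of the
    image point only. *)
Definition rat_map A B (X : set A) (phi : A -> B) :=
  forall x v w, X x -> coord x v -> coord (phi x) w ->
    exists G : 'rV[K]_(ncoord A) -> 'rV[K]_(ncoord B),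
      [/\ rat_mx (coord_set X) v G, G v = w
        & znear (coord_set X) v (fun u => forall z, X z -> coord z u -> coord (phi z) (G u))].

Lemma rat_map_subset A B (X X' : set A) (phi : A -> B) :
  X' `<=` X -> rat_map X phi -> rat_map X' phi.
Proof.
move=> sub h x v w /sub Xx xv xw; have [G [G1 G2 G3]] := h x v w Xx xv xw.
have sub' := coord_set_subset sub; exists G; split=> //; first exact: rat_mx_subset sub' G1.
by apply: znear_imp (znear_subset sub' G3) => u Su hz z /sub; exact: hz.
Qed.

(** A closed condition or a quotient of polynomials on the target is pulled back
    by substituting the rational functions that represent the map. *)
Lemma rat_map_regular A B (X : set A) (Y : set B) (phi : A -> B) :
  has_coord X -> has_coord Y -> (forall x, X x -> Y (phi x)) -> rat_map X phi ->
  regular_map X Y phi.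
Proof.
move=> cX cY XY h; split=> // [Z /zclosedP[sub cZ]|U f [UY _] rf x [Xx Ux]].
  apply/zclosedP; split=> [x []//|x v Xx nZ xv].
  have [w xw] := cY _ (XY _ Xx).
  have [G [rG Gv nG]] := h x v w Xx xv xw.
  have [q qw qZ] : znear (coord_set Z) w (fun=> False).
    by apply: (cZ (phi x)) => // [|Zx]; [exact: XY|apply: nZ].
  have Sv : coord_set X v by exists x.
  have sub' : coord_set (X `&` phi @^-1` Z) `<=` coord_set X by apply: coord_set_subset => z [].
  have nq : znear (coord_set X) v (fun u => peval q (G u) != 0).
    by apply: rat_at_neq0 => //; [exact: rat_at_comp|rewrite Gv].
  have := znear_subset sub' (znear_and nq nG).
  apply: znear_imp => u [z [Xz Zz] zu] [qn /(_ z Xz zu) zG].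
  by apply: qZ qn; exists (phi z).
have [v xv] := cX _ Xx.
have [p [q [[w xw qw] hpq]]] := rf _ Ux.
have [G [rG Gv nG]] := h x v w Xx xv xw.
have Sv : coord_set X v by exists x.
have rq : rat_at (coord_set X) v (fun u => peval q (G u)) by exact: rat_at_comp.
have rp : rat_at (coord_set X) v (fun u => peval p (G u)) by exact: rat_at_comp.
have qn : peval q (G v) != 0 by rewrite Gv.
have [a [b [bv hab]]] := rat_atM rp (rat_atV Sv rq qn).
have [c cv hc] := znear_and nG (rat_at_neq0 Sv rq qn).
exists (a * c), (b * c); split.
  by exists v => //; rewrite pevalM mulf_neq0.
move=> y u [Xy Uy] yu; rewrite !pevalM mulf_eq0 negb_or => /andP[bn cn].
have Su : coord_set X u by exists y.
have [/(_ y Xy yu) yG qn'] := hc u Su cn.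
by rewrite /= (hpq _ _ Uy yG qn') hab // -mulf_div divff // mulr1.
Qed.

Lemma rat_map_iso A B (X : set A) (Y : set B) (phi : A -> B) (psi : B -> A) :
  has_coord X -> has_coord Y ->
  (forall x, X x -> Y (phi x)) -> (forall y, Y y -> X (psi y)) ->
  (forall x, X x -> psi (phi x) = x) -> (forall y, Y y -> phi (psi y) = y) ->
  rat_map X phi -> rat_map Y psi -> isomorphism X Y phi.
Proof.
move=> cX cY XY YX k1 k2 r1 r2; split; first exact: rat_map_regular.
by exists psi; split=> //; exact: rat_map_regular.
Qed.

(** For a map into such a space it is enough to find some rational representation:
    it can be corrected to take the prescribed value. *)
Definition movable B := forall (y : B) w w', coord y w -> coord y w' ->
  exists T : 'rV[K]_(ncoord B) -> 'rV[K]_(ncoord B),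
    [/\ T w = w', forall z u, coord z u -> coord z (T u)
      & forall i, exists p, forall u, T u 0 i = peval p u].

Lemma rat_map_movable A B (X : set A) (phi : A -> B) : movable B ->
  (forall x v, X x -> coord x v ->
    exists2 G : 'rV[K]_(ncoord A) -> 'rV[K]_(ncoord B), rat_mx (coord_set X) v G &
      znear (coord_set X) v (fun u => forall z, X z -> coord z u -> coord (phi z) (G u))) ->
  rat_map X phi.
Proof.
move=> mB h x v w Xx xv xw; have [G rG nG] := h x v Xx xv.
have xG : coord (phi x) (G v) by apply: (znear_self _ nG) => //; exists x.
have [T [Tw Tc Tp]] := mB _ _ _ xG xw.
exists (fun u => T (G u)); split=> // [i j|].
  have [p hp] := Tp j; rewrite (ord1 i).
  by apply: rat_at_ext (rat_at_comp p rG) => u; rewrite hp.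
by apply: znear_imp nG => u Su hz z Xz zu; apply: Tc; exact: hz.
Qed.

Lemma affine_movable N : movable (affine_space K N).
Proof.
move=> y w w' /= -> ->; exists id; split=> // i.
by exists 'X_i => u; rewrite pevalX.
Qed.

Lemma affine_has_coord N (X : set (affine_space K N)) : has_coord X.
Proof. by move=> x _; exists x. Qed.

(** Closed subsets that cover the image have closed preimages that cover the source. *)
Lemma irreducible_image A B (X : set A) (Y : set B) (phi : A -> B) :
  irreducible_set X -> regular_map X Y phi -> (forall y, Y y -> exists2 x, X x & phi x = y) ->
  irreducible_set Y.
Proof.
move=> [[x0 Xx0] irr] [XY clo _] sur; split; first by exists (phi x0); exact: XY.
move=> Z1 Z2 c1 c2 cov.
case: (irr _ _ (clo _ c1) (clo _ c2)) => [x Xx|h|h].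
- by case: (cov _ (XY _ Xx)) => Zx; [left|right].
- by left => y /sur[x Xx <-]; case: (h x Xx).
- by right => y /sur[x Xx <-]; case: (h x Xx).
Qed.

End RegularMaps.

(** Two nonempty principal open sets of affine space over an infinite field
    meet: on the line through a point of each, the product of their equations
    is a nonzero polynomial in one variable. *)
Lemma peval_mul_neq0 (K : fieldType) N (p q : {mpoly K[N]}) (v w : 'rV[K]_N) :
  [pchar K] =i pred0 -> peval p v != 0 -> peval q w != 0 ->
  exists u, peval p u != 0 /\ peval q u != 0.
Proof.
move=> charK pv qw.
pose line i : {poly K} := (v 0 i)%:P + (w 0 i - v 0 i) *: 'X.
pose restr (r : {mpoly K[N]}) : {poly K} := mmap polyC line r.
have restrE r t : (restr r).[t] = peval r (v + t *: (w - v)).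
  rewrite /restr /mmap /peval mevalE horner_sum; apply: eq_bigr => m _.
  rewrite hornerM hornerC; congr (_ * _); rewrite /mmap1 horner_prod.
  apply: eq_bigr => i _; rewrite horner_exp; congr (_ ^+ _).
  by rewrite /line !hornerE !mxE [t * _]mulrC.
have pn : restr p != 0.
  by apply: contraNneq pv => p0; have := restrE p 0; rewrite p0 horner0 scale0r addr0 => <-.
have qn : restr q != 0.
  apply: contraNneq qw => q0; have := restrE q 1.
  by rewrite q0 horner0 scale1r addrC subrK => <-.
have [t tn] : exists t, (restr p * restr q).[t] != 0.
  apply: contrapT => /forallNP h; have rn : restr p * restr q != 0 by rewrite mulf_neq0.
  (* More roots than the degree allows: the images of the natural numbers. *)
  pose rs := [seq k%:R : K | k <- iota 0 (size (restr p * restr q)%R)].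
  have : (size rs < size (restr p * restr q)%R)%N.
    apply: max_poly_roots => //.
      apply/allP => t _; apply/eqP; have := h t.
      by move/negP/negPn/eqP.
    rewrite map_inj_uniq ?iota_uniq // => a b.
    wlog ab : a b / (a <= b)%N.
      by move=> wl; case: (leqP a b) => [/wl//|/ltnW/wl h' /esym/h' ->].
    move=> e; have : (b - a)%:R == 0 :> K by rewrite natrB // e subrr.
    by rewrite ((pcharf0P _).1 charK); lia.
  by rewrite size_map size_iota ltnn.
exists (v + t *: (w - v)); rewrite -!restrE.
by move: tn; rewrite hornerM mulf_eq0 negb_or => /andP[].
Qed.
(** * Flags and matrices *)

Section Flags.
Variables (K : fieldType) (n : nat).
Implicit Types (A B T : 'M[K]_n) (F : subspaces K n) (d : 'I_n.+1).

Definition upper A := forall a b : 'I_n, (b < a)%N -> A a b = 0.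

Lemma upper_triangularP A : reflect (upper A) (upper_triangular A).
Proof.
apply: (iffP is_trig_mxP) => [h a b ba|h a b ab]; first by have := h b a ba; rewrite mxE.
by rewrite mxE h.
Qed.

Lemma upper1 : upper 1%:M.
Proof. by move=> a b ba; rewrite mxE; case: eqP => // e; move: ba; rewrite e ltnn. Qed.

Lemma upperM A B : upper A -> upper B -> upper (A *m B).
Proof.
move=> uA uB a b ba; rewrite mxE big1 // => c _.
case: (ltnP c a) => [/uA->|ac]; first by rewrite mul0r.
by rewrite uB ?mulr0 //; apply: leq_trans ba ac.
Qed.

Lemma upper_det A : upper A -> \det A = \prod_i A i i.
Proof.
move=> uA; rewrite -det_tr det_trig; last exact/upper_triangularP.
by apply: eq_bigr => i _; rewrite mxE.
Qed.

Lemma upper_diag_neq0 A : upper A -> A \in unitmx -> forall i, A i i != 0.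
Proof.
move=> uA; rewrite unitmxE unitfE upper_det // prodf_seq_neq0 => /allP h i.
by apply: h; rewrite mem_index_enum.
Qed.

Lemma upper_unit A : upper A -> (forall i, A i i != 0) -> A \in unitmx.
Proof.
move=> uA h; rewrite unitmxE unitfE upper_det // prodf_seq_neq0.
by apply/allP => i _; exact: h.
Qed.

(** Entries of the inverse are found from the bottom row upwards, by comparing
    the product with the identity. *)
Lemma upperV A : upper A -> A \in unitmx -> upper (invmx A).
Proof.
move=> uA Au a b; have [k] := ubnP (n - a); elim: k a => // k IH a ka ba.
have := congr1 (fun M : 'M_n => M a b) (mulmxV Au).
rewrite !mxE (bigD1 a) //= big1 => [|c ca].
  rewrite addr0 (negbTE _ : a == b = false); last by apply: contraTneq ba => ->; rewrite ltnn.
  by move=> /eqP; rewrite mulf_eq0 (negbTE (upper_diag_neq0 uA Au a)) => /eqP.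
case: (ltnP c a) => [/uA->|ac]; first by rewrite mul0r.
have ac' : (a < c)%N by rewrite ltn_neqAle ac andbT; apply: contraNneq ca => /val_inj->.
by rewrite IH ?mulr0 //; have := ltn_ord c; lia.
Qed.

Lemma mulmx_sum_cols m (A : 'M[K]_(m, n)) (x : 'cV[K]_n) : A *m x = \sum_k x k 0 *: col k A.
Proof.
apply/colP => i; rewrite mxE summxE; apply: eq_bigr => k _.
by rewrite !mxE mulrC.
Qed.

Lemma span_colsP m (A : 'M[K]_(m, n)) (P : pred 'I_n) (v : 'cV[K]_m) :
  v \in <<[seq col k A | k <- enum 'I_n & P k]>>%VS <->
  exists2 x : 'cV[K]_n, (forall k, ~~ P k -> x k 0 = 0) & v = A *m x.
Proof.
rewrite span_def big_map big_filter big_enum_cond /=; split=> [|[x x0 ->]].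
  move=> /memv_sumP[vs vsP ->].
  have /choice[c cP] : forall k, exists c, P k -> vs k = c *: col k A.
    move=> k; case: (boolP (P k)) => Pk; last by exists 0.
    by have /vlineP[c] := vsP k Pk; exists c.
  exists (\col_k (if P k then c k else 0)) => [k /negbTE nP|]; first by rewrite mxE nP.
  rewrite mulmx_sum_cols big_mkcond; apply: eq_bigr => k _ /=; rewrite mxE.
  by case: ifP => [/cP//|]; rewrite scale0r.
rewrite mulmx_sum_cols (bigID P) /= [X in _ + X]big1 ?addr0.
  by apply: memv_suml => k Pk; apply/memvZ/(subvP (sumv_sup k Pk (subvv _)))/memv_line.
by move=> k /x0->; rewrite scale0r.
Qed.

Lemma dim_span_cols m (A : 'M[K]_(m, n)) (P : pred 'I_n) :
  (\dim <<[seq col k A | k <- enum 'I_n & P k]>> <= #|P|)%N.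
Proof.
apply: leq_trans (dim_span _) _; rewrite size_map cardE.
by rewrite {2}/enum_mem size_filter count_filter -size_filter; apply: eq_leq; congr (size _);
  rewrite /enum_mem; apply: eq_filter => k; rewrite /= !inE andbT.
Qed.

Lemma dim_le_card (U : {vspace 'cV[K]_n}) B (P : pred 'I_n) :
  (forall v, v \in U -> exists2 y : 'cV[K]_n, (forall k, ~~ P k -> y k 0 = 0) & v = B *m y) ->
  (\dim U <= #|P|)%N.
Proof.
move=> h; apply: leq_trans (dim_span_cols B P); apply/dimvS/subvP => v /h.
by move=> ?; apply/span_colsP.
Qed.

Lemma flag_ofP A d v : v \in flag_of A d <->
  exists2 x : 'cV[K]_n, (forall k : 'I_n, (d <= k)%N -> x k 0 = 0) & v = A *m x.
Proof.
rewrite ffunE; split=> [/span_colsP[x h ->]|[x h ->]]; first by exists x => // k; rewrite leqNgt; exact: h.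
by apply/span_colsP; exists x => // k; rewrite -leqNgt; exact: h.
Qed.

Lemma flag_of_unitP A d v : A \in unitmx ->
  v \in flag_of A d <-> forall k : 'I_n, (d <= k)%N -> (invmx A *m v) k 0 = 0.
Proof.
move=> Au; split=> [/flag_ofP[x h ->]|h]; first by rewrite mulKmx.
by apply/flag_ofP; exists (invmx A *m v) => //; rewrite mulKVmx.
Qed.

Lemma card_lt_ord d : #|[pred k : 'I_n | (k < d)%N]| = d.
Proof.
by rewrite -sum1_card -(big_ord_widen _ (fun=> 1%N)) ?sum1_card ?card_ord // -ltnS ltn_ord.
Qed.

(** The span of the other columns has at most the complementary dimension. *)
Lemma dim_flag_of A d : A \in unitmx -> \dim (flag_of A d) = d.
Proof.
move=> Au; apply/eqP; rewrite eqn_leq; apply/andP; split.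
  by rewrite ffunE; apply: leq_trans (dim_span_cols _ _) _; rewrite card_lt_ord.
set W := <<[seq col k A | k <- enum 'I_n & predC (fun k : 'I_n => (k < d)%N) k]>>%VS.
have hW : (\dim W <= n - d)%N.
  apply: leq_trans (dim_span_cols _ _) _; rewrite leq_subRL; last by rewrite -ltnS.
  by rewrite -{1}(card_lt_ord d) cardC card_ord.
have : (\dim {:'cV[K]_n} <= \dim (flag_of A d + W))%N.
  apply/dimvS/subvP => v _; rewrite -(mulKVmx Au v) mulmx_sum_cols (bigID (fun k : 'I_n => (k < d)%N)) /=.
  rewrite memv_add //; apply: memv_suml => k hk; apply/memvZ.
    by rewrite ffunE; apply: memv_span; apply/mapP; exists k; rewrite // mem_filter hk mem_enum.
  by apply: memv_span; apply/mapP; exists k; rewrite // mem_filter /= hk mem_enum.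
rewrite dimvf /dim /= muln1 => h.
have := leq_trans (leq_trans h (dimv_add_leqif _ _)) (leq_add (leqnn _) hW).
by move: (\dim (flag_of A d)) => x; have := ltn_ord d; lia.
Qed.

Lemma flag_of_flag A : A \in unitmx -> is_flag (flag_of A).
Proof.
move=> Au; split=> [d|d e de]; first exact: dim_flag_of.
by apply/subvP => v /flag_ofP[x h ->]; apply/flag_ofP; exists x => // k /(leq_trans de)/h.
Qed.

Lemma flag_of_eq_at A B d : A \in unitmx -> B \in unitmx ->
  flag_of A d = flag_of B d <->
  forall a b : 'I_n, (b < d)%N -> (d <= a)%N -> (invmx A *m B) a b = 0.
Proof.
move=> Au Bu; split=> [e a b bd da|h].
  have : col b B \in flag_of A d.
    by rewrite e ffunE; apply: memv_span; apply/mapP; exists b; rewrite // mem_filter bd mem_enum.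
  move=> /flag_of_unitP-/(_ Au a da); rewrite !mxE => z; rewrite -[RHS]z.
  by apply: eq_bigr => c _; rewrite !mxE.
apply/esym/eqP; rewrite eqEdim !dim_flag_of // leqnn andbT.
apply/subvP => v /flag_ofP[x x0 ->]; apply/flag_of_unitP => // k dk.
rewrite mulmxA mxE big1 // => c _; case: (ltnP c d) => cd; first by rewrite h ?mul0r.
by rewrite x0 ?mulr0.
Qed.

Lemma flag_of_eq A B : A \in unitmx -> B \in unitmx ->
  flag_of A = flag_of B <-> upper (invmx A *m B).
Proof.
move=> Au Bu; split=> [e a b ba|h].
  by apply: (proj1 (@flag_of_eq_at A B (widen_ord (leqnSn n) a) Au Bu)); rewrite ?e.
by apply/ffunP => d; apply/flag_of_eq_at => // a b bd da; apply: h; apply: leq_trans bd da.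
Qed.

Lemma flag_ofM A T : A \in unitmx -> T \in unitmx -> upper T -> flag_of (A *m T) = flag_of A.
Proof.
by move=> Au Tu uT; apply/esym/flag_of_eq; rewrite ?unitmx_mul ?Au // mulKmx.
Qed.

(** The columns are vectors that lie in one subspace and not in the previous
    one. *)
Lemma flag_matrix F : is_flag F -> exists2 A, A \in unitmx & F = flag_of A.
Proof.
move=> [dimF subF].
pose lo (k : 'I_n) : 'I_n.+1 := widen_ord (leqnSn n) k.
pose hi (k : 'I_n) : 'I_n.+1 := lift ord0 k.
have hiE k : hi k = k.+1 :> nat by [].
have /choice[c cP] : forall k : 'I_n, exists c, c \in F (hi k) /\ c \notin F (lo k).
  move=> k; have : ~~ (F (hi k) <= F (lo k))%VS.
    by apply/negP => /dimvS; rewrite !dimF hiE /= ltnn.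
  by move=> /subvPn[c c1 c2]; exists c.
pose A := \matrix_(i, j) c j i 0 : 'M[K]_n.
have colA k : col k A = c k by apply/colP => i; rewrite !mxE.
have sub d : (flag_of A d <= F d)%VS.
  rewrite ffunE; apply/span_subvP => v /mapP[k]; rewrite mem_filter => /andP[kd _] ->.
  rewrite colA; have [+ _] := cP k; apply/subvP; exact: subF.
have dimA d : (d <= \dim (flag_of A d))%N.
  case: d => d hd /=; elim: d hd => // d IH hd.
  have hd' : (d < n)%N by [].
  pose k := Ordinal hd'.
  have e1 : Ordinal hd = hi k by apply: val_inj.
  have e2 : Ordinal (ltnW hd) = lo k by apply: val_inj.
  apply: leq_ltn_trans (IH (ltnW hd)) _; rewrite e1 e2 ltn_neqAle.
  have s12 : (flag_of A (lo k) <= flag_of A (hi k))%VS.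
    by apply/subvP => v /flag_ofP[x h ->]; apply/flag_ofP; exists x => // j hj; apply: h; rewrite ltnW.
  rewrite dimvS // andbT; apply/negP => /eqP ed.
  have /eqP ef : flag_of A (lo k) == flag_of A (hi k) by rewrite eqEdim s12 ed leqnn.
  have [_ /negP[]] := cP k; apply: (subvP (sub _)); rewrite ef -colA ffunE.
  by apply: memv_span; apply/mapP; exists k; rewrite // mem_filter mem_enum hiE ltnSn.
have FA : F = flag_of A.
  by apply/ffunP => d; apply/esym/eqP; rewrite eqEdim sub dimF dimA.
exists A => //; rewrite -unitmx_tr -row_free_unit.
apply: inj_row_free.
pose lA : 'End('rV[K]_n) := linfun (mulmxr A^T).
suff /lker0P inj : lker lA == 0%VS.
  by move=> v v0; apply: inj; rewrite linear0 lfunE.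
have full : (fullv <= limg lA)%VS.
  apply/subvP => v _.
  have : v^T \in flag_of A ord_max.
    suff -> : flag_of A ord_max = fullv by rewrite memvf.
    by apply/eqP; rewrite eqEdim subvf dimvf /dim /= muln1 (dimA ord_max).
  move=> /flag_ofP[x _ /(congr1 trmx)]; rewrite trmxK trmx_mul => ->.
  by apply/memv_imgP; exists x^T; rewrite ?memvf // lfunE.
have := limg_ker_dim lA fullv; have := dimvS full; rewrite capfv -dimv_eq0 dimvf; lia.
Qed.

Definition mats m (v : 'rV[K]_(m * (n * n))) (j : 'I_m) : 'M[K]_n := vec_mx (row j (vec_mx v)).

Definition of_mats m (M : 'I_m -> 'M[K]_n) : 'rV[K]_(m * (n * n)) :=
  mxvec (\matrix_(j < m) mxvec (M j)).

Lemma of_matsK m (M : 'I_m -> 'M[K]_n) j : mats (of_mats M) j = M j.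
Proof. by rewrite /mats /of_mats mxvecK rowK mxvecK. Qed.

Lemma matsK m (v : 'rV[K]_(m * (n * n))) : of_mats (mats v) = v.
Proof.
rewrite /of_mats -[RHS]vec_mxK; congr mxvec; apply/row_matrixP => j.
by rewrite rowK /mats vec_mxK.
Qed.

Lemma flags_coordP m (F : flags_cspace K n m) v : coord F v <->
  (forall j, mats v j \in unitmx) /\ (forall j, F j = flag_of (mats v j)).
Proof.
split=> [[M [Mu FM ->]]|[Mu FM]]; first by split=> j; rewrite of_matsK.
by exists (mats v); split=> //; rewrite -[LHS]matsK.
Qed.

Lemma coord_of_mats m (M : 'I_m -> 'M[K]_n) (F : flags_cspace K n m) :
  (forall j, M j \in unitmx) -> (forall j, F j = flag_of (M j)) -> coord F (of_mats M).
Proof. by move=> Mu FM; exists M. Qed.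

Lemma rat_mats N (S : set 'rV[K]_N) v0 m (G : 'rV[K]_N -> 'rV[K]_(m * (n * n))) j :
  rat_mx S v0 G -> rat_mx S v0 (fun v => mats (G v) j).
Proof.
move=> rG a b; apply: rat_at_ext (rG 0 (mxvec_index j (mxvec_index a b))) => v.
by rewrite !mxE.
Qed.

Lemma rat_id N (S : set 'rV[K]_N) v0 : rat_mx S v0 id.
Proof. by move=> a b; rewrite (ord1 a); exact: rat_at_coord. Qed.

Lemma rat_of_mats N (S : set 'rV[K]_N) v0 m (M : 'rV[K]_N -> 'I_m -> 'M[K]_n) :
  (forall j, rat_mx S v0 (fun v => M v j)) -> rat_mx S v0 (fun v => of_mats (M v)).
Proof.
move=> rM z i; rewrite (ord1 z).
case/mxvec_indexP: i => j i; case/mxvec_indexP: i => a b.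
by apply: rat_at_ext (rM j a b) => v; rewrite !mxvecE mxE mxvecE.
Qed.

Lemma flags_has_coord m (Y : set (flags_cspace K n m)) : Y `<=` flags K n m -> has_coord Y.
Proof.
move=> sub F /sub fF.
have /choice[M MP] : forall j, exists A, A \in unitmx /\ F j = flag_of A.
  by move=> j; have [A Au FA] := flag_matrix (fF j); exists A.
by exists (of_mats M); apply: coord_of_mats => j; case: (MP j).
Qed.

Lemma coord_flags m (F : flags_cspace K n m) v : coord F v -> flags K n m F.
Proof. by move=> /flags_coordP[Mu FM] j; rewrite FM; exact: flag_of_flag. Qed.

End Flags.

(** Two matrices of the same flag differ by an upper triangular factor on the
    right, and multiplication by a fixed one is linear. *)
Lemma flags_movable (K : fieldType) n m : movable (flags_cspace K n m).
Proof.
move=> F w w' /flags_coordP[wu wF] /flags_coordP[wu' wF'].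
pose T j := invmx (mats w j) *m mats w' j.
have Tu j : T j \in unitmx by rewrite unitmx_mul unitmx_inv wu wu'.
have uT j : upper (T j) by apply/flag_of_eq; rewrite // -wF -wF'.
exists (fun u => of_mats (fun j => mats u j *m T j)); split.
- rewrite -[RHS]matsK; congr of_mats; apply: boolp.funext => j.
  by rewrite /T mulKVmx.
- move=> z u /flags_coordP[zu zF]; apply: coord_of_mats => j.
    by rewrite unitmx_mul zu Tu.
  by rewrite zF flag_ofM.
- move=> i; case/mxvec_indexP: i => j i; case/mxvec_indexP: i => a b.
  exists (\sum_c 'X_(mxvec_index j (mxvec_index a c)) * (T j c b)%:MP) => u.
  rewrite !mxvecE mxE mxvecE mxE /peval raddf_sum; apply: eq_bigr => c _ /=.
  by rewrite mevalM mevalXU mevalC !mxE.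
Qed.
(** * Bott-Samelson varieties: matrices and charts *)

(** The matrices that relate two flags which are equal outside of dimension
    [i + 1]: the elements of a minimal parabolic algebra. *)
Definition in_parabolic (R : nzRingType) n (i : 'I_n.-1) (A : 'M[R]_n) :=
  forall a b : 'I_n, (b < a)%N -> ~~ ((a == strand_hi i) && (b == strand_lo i)) -> A a b = 0.

(** Column [i] of [A] is replaced by [c_i + x c_(i+1)] if [e] is false, and by
    [c_(i+1) + x c_i] if [e] is true: the two affine charts of the line of
    flags that differ from a given one at most in dimension [i + 1]. *)
Definition chart_step (R : comNzRingType) n (i : 'I_n.-1) (e : bool) (x : R) : 'M[R]_n :=
  (if e then perm_mx (simple_refl i) else 1%:M) *m
  (1%:M + x *: delta_mx (strand_hi i) (strand_lo i)).

Definition chart_step_inv (R : comNzRingType) n (i : 'I_n.-1) (e : bool) (x : R) : 'M[R]_n :=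
  (1%:M + - x *: delta_mx (strand_hi i) (strand_lo i)) *m
  (if e then perm_mx (simple_refl i) else 1%:M).

Section Steps.
Variables (R : comNzRingType) (n : nat) (i : 'I_n.-1).
Implicit Types (A B : 'M[R]_n) (x : R) (e : bool).

Lemma mul_elementaryE x A a b :
  ((1%:M + x *: delta_mx (strand_hi i) (strand_lo i)) *m A) a b =
  A a b + (a == strand_hi i)%:R * (x * A (strand_lo i) b).
Proof.
rewrite mulmxDl mul1mx -scalemxAl mxE [X in _ + X]mxE; congr (_ + _).
rewrite mxE (bigD1 (strand_lo i)) //= big1 ?addr0 => [|c /negbTE cl].
  by rewrite mxE eqxx andbT; case: eqP => _; rewrite ?mul1r ?mul0r ?mulr0.
by rewrite mxE cl andbF mul0r.
Qed.

Lemma mul_perm_mxE (s : 'S_n) m (A : 'M[R]_(n, m)) a b : (perm_mx s *m A) a b = A (s a) b.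
Proof. by rewrite -row_permE mxE. Qed.

Lemma elementaryK x :
  (1%:M + - x *: delta_mx (strand_hi i) (strand_lo i)) *m
  (1%:M + x *: delta_mx (strand_hi i) (strand_lo i)) = 1%:M :> 'M[R]_n.
Proof.
apply/matrixP => a b; rewrite mul_elementaryE !mxE.
rewrite [strand_lo i == strand_hi i]eq_sym strand_neq /= mulr0 addr0.
rewrite (eq_sym (strand_lo i)); case: (a == strand_hi i); case: (b == strand_lo i) => /=;
  by rewrite ?mul1r ?mul0r ?mulr1 ?mulr0 ?addr0 ?mulN1r ?mulrN1 ?addrK ?addrNK.
Qed.

Lemma perm_simpleK : perm_mx (simple_refl i) *m perm_mx (simple_refl i) = 1%:M :> 'M[R]_n.
Proof. by rewrite -perm_mxM simple_reflK perm_mx1. Qed.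

Lemma chart_stepK e x : chart_step_inv i e x *m chart_step i e x = 1%:M.
Proof.
rewrite /chart_step_inv /chart_step mulmxA -[_ *m _ *m (if e then _ else _)]mulmxA.
by case: e; rewrite ?perm_simpleK ?mulmx1 elementaryK.
Qed.

Lemma upper_parabolic A : (forall a b : 'I_n, (b < a)%N -> A a b = 0) -> in_parabolic i A.
Proof. by move=> uA a b ba _; exact: uA. Qed.

Lemma in_parabolicM A B : in_parabolic i A -> in_parabolic i B -> in_parabolic i (A *m B).
Proof.
move=> pA pB a b ba nab; rewrite mxE big1 // => c _.
case: (ltnP c a) => ca; last first.
  case: (ltnP b c) => bc; last by have := leq_trans ca bc; rewrite leqNgt ba.
  case: (boolP ((c == strand_hi i) && (b == strand_lo i))) => [/andP[/eqP ch /eqP bl]|h].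
    have ea : a = strand_hi i by apply: val_inj; move: ca ba; rewrite ch bl /=; lia.
    by move: nab; rewrite ea bl !eqxx.
  by rewrite (pB c b) ?mulr0.
case: (boolP ((a == strand_hi i) && (c == strand_lo i))) => [/andP[/eqP ah /eqP cl]|h]; last first.
  by rewrite (pA a c) ?mul0r.
rewrite [B c b]pB ?mulr0 //.
  move: nab ba; rewrite ah cl eqxx /= => nb.
  have : (b : nat) <> strand_lo i by move=> /val_inj e; rewrite e eqxx in nb.
  by rewrite /=; lia.
by rewrite cl eq_sym strand_neq.
Qed.

Lemma in_parabolic_step e x : in_parabolic i (chart_step i e x).
Proof.
apply: in_parabolicM => a b ba nab; last first.
  rewrite !mxE (negbTE nab) mulr0 addr0; case: eqP => // e'.
  by move: ba; rewrite e' ltnn.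
have ab : (a == b) = false by apply/negbTE; apply: contraTneq ba => ->; rewrite ltnn.
case: e; rewrite !mxE ?ab //; case: eqP => // e'; move: ba nab; rewrite -e' /simple_refl.
rewrite -!val_eqE /=.
by case: (tperm_cases (strand_lo i) (strand_hi i) a) => [[-> ->]|[-> ->]|[? ? ->]] /=; lia.
Qed.

Lemma in_parabolic_step_inv e x : in_parabolic i (chart_step_inv i e x).
Proof.
apply: in_parabolicM => a b ba nab.
  rewrite !mxE (negbTE nab) mulr0 addr0; case: eqP => // e'.
  by move: ba; rewrite e' ltnn.
have ab : (a == b) = false by apply/negbTE; apply: contraTneq ba => ->; rewrite ltnn.
case: e; rewrite !mxE ?ab //; case: eqP => // e'; move: ba nab; rewrite -e' /simple_refl.
rewrite -!val_eqE /=.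
by case: (tperm_cases (strand_lo i) (strand_hi i) a) => [[-> ->]|[-> ->]|[? ? ->]] /=; lia.
Qed.

Lemma parabolic_upper A : in_parabolic i A -> A (strand_hi i) (strand_lo i) = 0 ->
  forall a b : 'I_n, (b < a)%N -> A a b = 0.
Proof.
move=> pA A0 a b ba; case: (boolP ((a == strand_hi i) && (b == strand_lo i))).
  by move=> /andP[/eqP-> /eqP->].
exact: pA.
Qed.

Lemma mul_step_invE e x A : (chart_step_inv i e x *m A) (strand_hi i) (strand_lo i) =
  if e then A (strand_lo i) (strand_lo i) - x * A (strand_hi i) (strand_lo i)
  else A (strand_hi i) (strand_lo i) - x * A (strand_lo i) (strand_lo i).
Proof.
rewrite /chart_step_inv -mulmxA mul_elementaryE eqxx mul1r mulNr.
by case: e; rewrite ?mul1mx // !mul_perm_mxE /simple_refl tpermL tpermR.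
Qed.

Lemma mul_stepE e x A : A (strand_hi i) (strand_lo i) = 0 ->
  let B := chart_step i e x *m A in
  (B (strand_lo i) (strand_lo i) = (if e then x else 1) * A (strand_lo i) (strand_lo i)) /\
  (B (strand_hi i) (strand_lo i) = (if e then 1 else x) * A (strand_lo i) (strand_lo i)).
Proof.
move=> A0; rewrite /= /chart_step -mulmxA; case: e.
  rewrite !mul_perm_mxE /simple_refl tpermL tpermR !mul_elementaryE eqxx.
  by rewrite [strand_lo i == _]eq_sym strand_neq A0 add0r !mul1r mul0r addr0.
rewrite !mul1mx !mul_elementaryE eqxx.
by rewrite [strand_lo i == _]eq_sym strand_neq A0 add0r !mul1r mul0r addr0.
Qed.

End Steps.

Lemma invmxM (R : comUnitRingType) n (A B : 'M[R]_n) : A \in unitmx -> B \in unitmx ->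
  invmx (A *m B) = invmx B *m invmx A.
Proof.
move=> Au Bu; have ABu : A *m B \in unitmx by rewrite unitmx_mul Au.
by rewrite -[RHS](mulmxK ABu) !mulmxA -(mulmxA _ (invmx A)) mulVmx // mulmx1 mulVmx // mul1mx.
Qed.

(** The recursion is on natural numbers, so that the number of factors can vary;
    an index beyond [l] contributes the identity. *)
Fixpoint path_mx (R : nzRingType) n l (C : 'I_l -> 'M[R]_n) (j : nat) : 'M[R]_n :=
  if j is j'.+1 then path_mx C j' *m (if insub j' is Some t then C t else 1%:M) else 1%:M.

Lemma path_mxS (R : nzRingType) n l (C : 'I_l -> 'M[R]_n) (t : 'I_l) :
  path_mx C t.+1 = path_mx C t *m C t.
Proof. by rewrite /= valK. Qed.

(** The flags of a path carry the indices [0, ..., l], the letters [0, ..., l - 1]. *)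
Lemma position_ind l (P : nat -> Prop) : P 0%N -> (forall t : 'I_l, P t -> P t.+1) ->
  forall j : 'I_l.+1, P j.
Proof.
move=> P0 PS [j hj] /=; elim: j hj => // j IH hj.
have hj' : (j < l)%N by [].
by apply: (PS (Ordinal hj')); exact: IH (ltnW hj).
Qed.

Section BottSamelson.
Variables (K : fieldType) (n l : nat) (beta : l.-tuple 'I_n.-1).
Implicit Types (F : flags_cspace K n l.+1) (M : 'I_l.+1 -> 'M[K]_n).

Let before (t : 'I_l) : 'I_l.+1 := widen_ord (leqnSn l) t.
Let after (t : 'I_l) : 'I_l.+1 := lift ord0 t.

Definition rel_mx M (t : 'I_l) := invmx (M (before t)) *m M (after t).

(** Two flags that agree in every dimension but [i + 1] are related by an element of
    the parabolic: an entry [(a, b)] below the diagonal is seen by a subspace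
    of dimension [d] with [b < d <= a], and [d] can avoid [i + 1] unless
    [(a, b)] is the exceptional entry. *)
Lemma bott_samelsonP F M : (forall j, M j \in unitmx) -> (forall j, F j = flag_of (M j)) ->
  bott_samelson K beta F <->
  upper (M ord0) /\ forall t, in_parabolic (tnth beta t) (rel_mx M t).
Proof.
move=> Mu FM.
have stdP : F ord0 = flag_of 1%:M <-> upper (M ord0).
  rewrite FM; split=> [/esym/flag_of_eq|u0].
    by rewrite unitmx1 invmx1 mul1mx; exact.
  by apply/esym/flag_of_eq; rewrite ?unitmx1 // invmx1 mul1mx.
have parP t : (forall d : 'I_n.+1, (d : nat) != (tnth beta t).+1 ->
    flag_before F t d = flag_after F t d) <-> in_parabolic (tnth beta t) (rel_mx M t).
  rewrite /flag_before /flag_after !FM; split=> [h a b ba nab|h d nd]; last first.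
    apply/flag_of_eq_at => // a b bd da; apply: h; first exact: leq_trans bd da.
    apply/negP => /andP[/eqP ea /eqP eb]; move: nd bd da; rewrite ea eb /=; lia.
  pose d0 : 'I_n.+1 := if (a : nat) == (tnth beta t).+1 then lift ord0 b else widen_ord (leqnSn n) a.
  have : flag_of (M (before t)) d0 = flag_of (M (after t)) d0.
    apply: h; rewrite /d0; case: (eqVneq (a : nat)) => [e|//]; apply/negP => /eqP; rewrite lift0 => -[eb].
     move/negP: nab; apply; apply/andP; split; apply/eqP/val_inj => //=.
  move=> /flag_of_eq_at; rewrite !Mu => /(_ isT isT); apply.
    by rewrite /d0; case: eqP; rewrite ?lift0 //= ltnW.
  by rewrite /d0; case: eqP; rewrite ?lift0 //= ltnW.
split=> [[_ /stdP u0 h]|[u0 h]].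
  split=> // t; apply/parP => d nd.
  case: (h t) => [->//|hd]; apply: contrapT => /hd /eqP.
  by rewrite (negbTE nd).
split; [by move=> j; rewrite FM; exact: flag_of_flag|exact/stdP|].
move=> t; have hd := (parP t).2 (h t).
case: (pselect (flag_before F t = flag_after F t)) => [|ne]; [by left|right] => d.
split=> [nd|ed ed']; first by apply/eqP/negPn/negP => /hd.
apply: ne; apply/ffunP => d'; case: (eqVneq (d' : nat) (tnth beta t).+1) => [e|/hd//].
by have -> : d' = d by apply: val_inj; rewrite /= e ed.
Qed.

Lemma flag_stationaryP F M t : (forall j, M j \in unitmx) -> (forall j, F j = flag_of (M j)) ->
  in_parabolic (tnth beta t) (rel_mx M t) ->
  flag_before F t = flag_after F t <->
  rel_mx M t (strand_hi (tnth beta t)) (strand_lo (tnth beta t)) = 0.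
Proof.
move=> Mu FM pM; rewrite /flag_before /flag_after !FM.
split=> [/flag_of_eq|r0]; last by apply/flag_of_eq => //; exact: parabolic_upper pM r0.
by rewrite !Mu => /(_ isT isT); apply; rewrite /=.
Qed.

(** ** Charts *)

Variable eps : 'I_l -> bool.

Definition chart_mx (u : 'rV[K]_l) : nat -> 'M[K]_n :=
  path_mx (fun t => chart_step (tnth beta t) (eps t) (u 0 t)).

Definition chart (u : 'rV[K]_l) : flags_cspace K n l.+1 :=
  [ffun j : 'I_l.+1 => flag_of (chart_mx u j)].

Lemma chart_step_unit i e (x : K) : chart_step (n := n) i e x \in unitmx.
Proof. by have /mulmx1_unit[] := chart_stepK i e x. Qed.

Lemma invmx_step i e (x : K) : invmx (chart_step (n := n) i e x) = chart_step_inv i e x.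
Proof.
by rewrite -[LHS]mul1mx -(chart_stepK i e x) mulmxK // chart_step_unit.
Qed.

Lemma path_mx_unit (C : 'I_l -> 'M[K]_n) j : (forall t, C t \in unitmx) -> path_mx C j \in unitmx.
Proof.
move=> Cu; elim: j => [|j IH] /=; first exact: unitmx1.
by rewrite unitmx_mul IH; case: insub => // ; rewrite unitmx1.
Qed.

Lemma chart_mx_unit u j : chart_mx u j \in unitmx.
Proof. by apply: path_mx_unit => t; exact: chart_step_unit. Qed.

Lemma chart_mxS u (t : 'I_l) :
  chart_mx u t.+1 = chart_mx u t *m chart_step (tnth beta t) (eps t) (u 0 t).
Proof. exact: path_mxS. Qed.

Lemma chart_rel_mx u t :
  rel_mx (fun j => chart_mx u j) t = chart_step (tnth beta t) (eps t) (u 0 t).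
Proof. by rewrite /rel_mx lift0 chart_mxS mulKmx // chart_mx_unit. Qed.

Lemma chartE u j : chart u j = flag_of (chart_mx u j).
Proof. by rewrite ffunE. Qed.

Lemma chart_bott_samelson u : bott_samelson K beta (chart u).
Proof.
apply/(@bott_samelsonP _ (fun j => chart_mx u j)) => [j|j|]; rewrite ?chartE ?chart_mx_unit //.
split=> [|t]; first exact: upper1.
by rewrite chart_rel_mx; exact: in_parabolic_step.
Qed.

(** In the plane of columns [i] and [i + 1] the new subspace is the line spanned by
    [G lo lo] and [G hi lo]; the chart consists of the lines on which the pivot
    is nonzero, and the slope is its coordinate. *)
Definition pivot (i : 'I_n.-1) (e : bool) (G : 'M[K]_n) :=
  if e then G (strand_hi i) (strand_lo i) else G (strand_lo i) (strand_lo i).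

Definition slope (i : 'I_n.-1) (e : bool) (G : 'M[K]_n) :=
  (if e then G (strand_lo i) (strand_lo i) else G (strand_hi i) (strand_lo i)) / pivot i e G.

Lemma slope_upper i e G : in_parabolic i G -> pivot i e G != 0 ->
  upper (chart_step_inv i e (slope i e G) *m G).
Proof.
move=> pG piv; apply: (@parabolic_upper _ _ i).
  by apply: in_parabolicM => //; exact: in_parabolic_step_inv.
by rewrite mul_step_invE; case: e piv => /= piv; rewrite /slope /= divfK // subrr.
Qed.

Lemma step_slope i e x (T : 'M[K]_n) : upper T -> T \in unitmx ->
  pivot i e (chart_step i e x *m T) != 0 /\ slope i e (chart_step i e x *m T) = x.
Proof.
move=> uT Tu; have T0 := upper_diag_neq0 uT Tu (strand_lo i).
have [el eh] := @mul_stepE _ _ i e x T (uT (strand_hi i) (strand_lo i) (ltnSn _)).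
have piv : pivot i e (chart_step i e x *m T) = T (strand_lo i) (strand_lo i).
  by rewrite /pivot; case: e el eh => el eh; rewrite ?eh ?el mul1r.
split; first by rewrite piv.
by rewrite /slope piv; case: e el eh {piv} => el eh; rewrite ?el ?eh mulfK.
Qed.

(** The chart coordinates of the tuple of flags of [M], found one position at
    a time: [chart_rec M j] is the chart matrix of the first [j] flags. *)
Fixpoint chart_rec M (j : nat) : 'M[K]_n :=
  if j is j'.+1 then
    chart_rec M j' *m
      (if insub j' is Some t then
         chart_step (tnth beta t) (eps t)
           (slope (tnth beta t) (eps t) (invmx (chart_rec M j') *m M (lift ord0 t)))
       else 1%:M)
  else 1%:M.

Definition chart_rel M (t : 'I_l) := invmx (chart_rec M t) *m M (after t).

Definition chart_coord M (t : 'I_l) : K := slope (tnth beta t) (eps t) (chart_rel M t).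

Definition chart_pivot M (t : 'I_l) : K := pivot (tnth beta t) (eps t) (chart_rel M t).

Lemma chart_recE M j : chart_rec M j = chart_mx (\row_t chart_coord M t) j.
Proof.
elim: j => //= j IH; rewrite /chart_mx /= -/(chart_mx _ j) -IH.
by case: insubP => [t _ e|//]; rewrite mxE /chart_coord /chart_rel -e.
Qed.

Lemma chart_rec_unit M j : chart_rec M j \in unitmx.
Proof. by rewrite chart_recE chart_mx_unit. Qed.

Lemma chart_recS M (t : 'I_l) :
  chart_rec M t.+1 = chart_rec M t *m chart_step (tnth beta t) (eps t) (chart_coord M t).
Proof. by rewrite /= valK. Qed.

Lemma chart_rel_parabolic M (t : 'I_l) : (forall j, M j \in unitmx) ->
  in_parabolic (tnth beta t) (rel_mx M t) -> flag_of (chart_rec M t) = flag_of (M (before t)) ->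
  in_parabolic (tnth beta t) (chart_rel M t) /\
  (rel_mx M t (strand_hi (tnth beta t)) (strand_lo (tnth beta t)) = 0 <->
   chart_rel M t (strand_hi (tnth beta t)) (strand_lo (tnth beta t)) = 0).
Proof.
move=> Mu pM /flag_of_eq; rewrite chart_rec_unit Mu => /(_ isT isT) uT.
set T := _ *m _ in uT; set i := tnth beta t in pM *.
have e : chart_rel M t = T *m rel_mx M t.
  by rewrite /chart_rel /T /rel_mx -mulmxA mulKVmx.
have Tu : T \in unitmx by rewrite unitmx_mul unitmx_inv chart_rec_unit Mu.
have Ti : upper (invmx T) by exact: upperV.
have e' : rel_mx M t = invmx T *m chart_rel M t by rewrite e mulKmx.
have pC : in_parabolic i (chart_rel M t).
  by rewrite e; apply: in_parabolicM => //; exact: upper_parabolic.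
split=> //; split=> [r0|c0].
  by rewrite e; apply: (upperM uT (parabolic_upper pM r0)); rewrite /=.
by rewrite e'; apply: (upperM Ti (parabolic_upper pC c0)); rewrite /=.
Qed.

(** As long as the pivots are nonzero, the matrices of the chart and the given ones
    differ by upper triangular factors. *)
Lemma chart_rec_flag M : (forall j, M j \in unitmx) -> upper (M ord0) ->
  (forall t, in_parabolic (tnth beta t) (rel_mx M t)) ->
  forall j : 'I_l.+1, (forall t : 'I_l, (t < j)%N -> chart_pivot M t != 0) ->
  flag_of (chart_rec M j) = flag_of (M j).
Proof.
move=> Mu u0 pM.
pose P j := (forall t : 'I_l, (t < j)%N -> chart_pivot M t != 0) ->
    forall j' : 'I_l.+1, j' = j :> nat -> flag_of (chart_rec M j) = flag_of (M j').
suff h : forall j : 'I_l.+1, P j by move=> j hj; exact: (h j).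
apply: (@position_ind l P) => [_ j' e|t IH piv j' e].
  have -> : j' = ord0 by apply: val_inj.
  by apply/flag_of_eq; rewrite ?unitmx1 //= invmx1 mul1mx.
have -> : j' = after t by apply: val_inj; rewrite /= e.
have IH' : flag_of (chart_rec M t) = flag_of (M (before t)).
  by apply: IH => // s st; apply: piv; rewrite ltnW.
have [pC _] := chart_rel_parabolic Mu (pM t) IH'.
apply/flag_of_eq => //; first exact: chart_rec_unit.
rewrite chart_recS invmxM ?chart_rec_unit ?chart_step_unit //.
rewrite invmx_step -mulmxA; apply: slope_upper => //.
exact: piv.
Qed.

Lemma chart_of_pivots F M : (forall j, M j \in unitmx) -> (forall j, F j = flag_of (M j)) ->
  bott_samelson K beta F -> (forall t, chart_pivot M t != 0) ->
  F = chart (\row_t chart_coord M t).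
Proof.
move=> Mu FM BF piv; have [u0 pM] := (bott_samelsonP Mu FM).1 BF.
apply/ffunP => j; rewrite chartE FM -chart_recE.
by rewrite (chart_rec_flag Mu u0 pM).
Qed.

Lemma chart_coordK u M : (forall j, M j \in unitmx) -> (forall j, chart u j = flag_of (M j)) ->
  (forall t, chart_pivot M t != 0) /\ (forall t, chart_coord M t = u 0 t).
Proof.
move=> Mu FM.
have step (t : 'I_l) : chart_rec M t = chart_mx u t ->
    chart_pivot M t != 0 /\ chart_coord M t = u 0 t.
  move=> e; rewrite /chart_pivot /chart_coord /chart_rel e.
  have : flag_of (chart_mx u (after t)) = flag_of (M (after t)) by rewrite -chartE.
  move=> /flag_of_eq; rewrite chart_mx_unit Mu => /(_ isT isT).
  set T := _ *m _ => uT; have Tu : T \in unitmx by rewrite unitmx_mul unitmx_inv chart_mx_unit Mu.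
  have -> : invmx (chart_mx u t) *m M (after t) =
            chart_step (tnth beta t) (eps t) (u 0 t) *m T.
    rewrite /T lift0 chart_mxS invmxM ?chart_mx_unit ?chart_step_unit //.
    by rewrite -mulmxA mulKVmx // chart_step_unit.
  exact: step_slope.
have rec : forall j : 'I_l.+1, chart_rec M j = chart_mx u j.
  apply: (@position_ind l (fun j => chart_rec M j = chart_mx u j)) => // t e; have [_ ec] := step t e.
  by rewrite chart_recS chart_mxS e ec.
by split=> t; case: (step t (rec (before t))).
Qed.

End BottSamelson.

(** A nonzero exceptional entry of the relative position, which means that the flag
    moves, is the pivot of the second kind of step. If the entry is zero, the
    relative position is upper triangular, so the pivot of the first kind is a
    diagonal entry of an invertible matrix, and the slope is zero. *)
Lemma moving_chart (K : fieldType) n l (beta : l.-tuple 'I_n.-1) (F : flags_cspace K n l.+1) M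
    (eps : 'I_l -> bool) :
  (forall j, M j \in unitmx) -> (forall j, F j = flag_of (M j)) ->
  bott_samelson K beta F -> (forall t, eps t <-> flag_before F t <> flag_after F t) ->
  (forall t, chart_pivot beta eps M t != 0) /\
  (forall t, eps t = false -> chart_coord beta eps M t = 0).
Proof.
move=> Mu FM BF epsP; have [u0 pM] := (bott_samelsonP beta Mu FM).1 BF.
have step (t : 'I_l) : (forall s : 'I_l, (s < t)%N -> chart_pivot beta eps M s != 0) ->
    chart_pivot beta eps M t != 0 /\ (eps t = false -> chart_coord beta eps M t = 0).
  move=> piv; have fl := chart_rec_flag (eps := eps) Mu u0 pM (j := widen_ord (leqnSn l) t) piv.
  have [pC st] := chart_rel_parabolic Mu (pM t) fl.
  have stat := flag_stationaryP Mu FM (pM t).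
  rewrite /chart_pivot /chart_coord /pivot /slope; case et : (eps t).
    split=> //; apply/eqP => /st/stat; exact: (epsP t).1 et.
  have /st c0 : rel_mx M t (strand_hi (tnth beta t)) (strand_lo (tnth beta t)) = 0.
    by apply: stat.1; apply: contrapT => ne; move: et; rewrite ((epsP t).2 ne).
  rewrite c0 mul0r; split=> //; apply: upper_diag_neq0; first exact: parabolic_upper pC c0.
  by rewrite unitmx_mul unitmx_inv chart_rec_unit Mu.
have piv t : chart_pivot beta eps M t != 0.
  have [k] := ubnP (t : nat); elim: k t => // k IH t tk.
  by case: (step t) => // s st; apply: IH; apply: leq_trans st _.
by split=> // t; case: (step t).
Qed.
(** * Schubert conditions on the last flag *)

(** Each step of a Bott-Samelson path changes one subspace [F_(i+1)] between
    [F_i] and [F_(i+2)], so its intersection with a coordinate subspace loses at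
    most one dimension against [F_(i+2)] and none against [F_i]; the Demazure
    product obeys the same recursion. *)
Lemma bott_samelson_cell_dim (K : fieldType) n l (beta : l.-tuple 'I_n.-1)
    (F : flags_cspace K n l.+1) : bott_samelson K beta F -> forall a b : 'I_n.+1,
  (cell_dim (demazure beta) a b <= \dim (F ord_max b :&: flag_of 1%:M a))%N.
Proof.
move=> [fF std step]; rewrite demazureE.
pose P j := forall j' : 'I_l.+1, j' = j :> nat -> forall a b : 'I_n.+1,
  (cell_dim (demazure_fold (take j beta)) a b <= \dim (F j' b :&: flag_of 1%:M a))%N.
have h : forall j : 'I_l.+1, P j.
  apply: (@position_ind l P) => [j' e a b|t IH j' e a b].
    have -> : j' = ord0 by apply: val_inj.
    rewrite take0 std; have [_ mono] := flag_of_flag (unitmx1 K n).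
    case: (leqP a b) => ab.
      rewrite (capv_idPr (mono _ _ ab)) dim_flag_of ?unitmx1 // -[leqRHS](card_lt_ord a).
      apply/subset_leq_card/fintype.subsetP => c; rewrite !inE invg1 perm1.
      by case/andP.
    rewrite (capv_idPl (mono _ _ (ltnW ab))) dim_flag_of ?unitmx1 // -[leqRHS](card_lt_ord b).
    by apply/subset_leq_card/fintype.subsetP => c; rewrite !inE; case/andP.
  have -> : j' = lift ord0 t by apply: val_inj; rewrite /= e.
  have lt : (t < size beta)%N by rewrite size_tuple.
  rewrite (take_nth (tnth beta t) lt) -tnth_nth demazure_fold_rcons.
  set m := demazure_fold _ in IH *; set i := tnth beta t.
  have IH' := IH (widen_ord (leqnSn l) t) erefl.
  have same (d : 'I_n.+1) : (d : nat) != i.+1 -> F (widen_ord (leqnSn l) t) d = F (lift ord0 t) d.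
    case: (step t) => [e0 _|hd /eqP nd]; [|by apply: contrapT => /hd].
    by have := congr1 (fun G : subspaces K n => G d) e0.
  have [c1 _] := @cell_dim_demazure_step _ m i a b.
  case: (eqVneq (b : nat) i.+1) => [bi|nb]; last first.
    by rewrite c1 // -same.
  have [hi_lt lo_lt] : (i.+2 < n.+1)%N /\ (i < n.+1)%N.
    by have := ltn_ord (strand_hi i); rewrite strand_hiE; lia.
  pose bl : 'I_n.+1 := Ordinal lo_lt; pose bh : 'I_n.+1 := Ordinal hi_lt.
  have [dimF monoF] := fF (lift ord0 t).
  set Fb := F (lift ord0 t) b; set E := flag_of _ a.
  rewrite [X in cell_dim _ _ X]bi; have [_] := @cell_dim_demazure_step _ m i a b; case=> c.
    apply: leq_trans c _; apply: leq_trans (IH' a bl) _.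
    rewrite same /=; last by lia.
    by apply: dimvS; apply: capvS; last exact: subvv; apply: monoF; rewrite bi /=.
  rewrite -ltnS; apply: leq_trans c _; apply: leq_trans (IH' a bh) _.
  rewrite same /=; last by lia.
  have sub : (Fb <= F (lift ord0 t) bh)%VS by apply: monoF; rewrite bi /=.
  have := dimv_sum_cap (F (lift ord0 t) bh :&: E) Fb.
  have -> : (F (lift ord0 t) bh :&: E :&: Fb = Fb :&: E)%VS.
    by rewrite capvC capvA (capv_idPl sub).
  have : (\dim ((F (lift ord0 t) bh :&: E) + Fb)%VS <= \dim (F (lift ord0 t) bh))%N.
    by apply: dimvS; rewrite subv_add capvSl.
  have -> : \dim Fb = i.+1 by rewrite /Fb dimF.
  rewrite dimF /=; move: (\dim _) (\dim _) (\dim _) => x y z; lia.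
by move=> a b; have := h ord_max ord_max erefl a b; rewrite take_oversize // size_tuple.
Qed.

Definition inversion n (m : 'S_n) (a b : 'I_n) := (b < a)%N && (m^-1%g a < m^-1%g b)%N.

(** If the earlier columns of [perm_mx m^-1 *m M] are already triangular, a
    nonzero entry below the diagonal that is not at an inversion of [m] would
    make the intersection of [F_(b+1)] with a coordinate subspace too small. *)
Lemma upper_column (K : fieldType) n (m : 'S_n) (M : 'M[K]_n) (b : 'I_n) :
  let G := perm_mx m^-1%g *m M in
  M \in unitmx ->
  (forall a b : 'I_n.+1, (cell_dim m a b <= \dim (flag_of M b :&: flag_of 1%:M a))%N) ->
  (forall c a : 'I_n, (c < b)%N -> (c < a)%N -> G a c = 0) ->
  (forall a : 'I_n, inversion m a b -> G a b = 0) ->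
  forall a : 'I_n, (b < a)%N -> G a b = 0.
Proof.
move=> G Mu dimM cols inv a ba.
case: (boolP (inversion m a b)) => [/inv//|]; rewrite /inversion ba /= -leqNgt => wle.
have wlt : (m^-1%g b < m^-1%g a)%N.
  rewrite ltn_neqAle wle andbT val_eqE (inj_eq perm_inj).
  by apply: contraTneq ba => ->; rewrite ltnn.
apply/eqP/negPn/negP => Gab.
pose d : 'I_n.+1 := lift ord0 b; pose A : 'I_n.+1 := widen_ord (leqnSn n) (m^-1%g a).
pose P := [pred c : 'I_n | (c < b)%N && (m^-1%g c < A)%N].
have MG : M = perm_mx m *m G by rewrite mulmxA -perm_mxM mulgV perm_mx1 mul1mx.
have : (\dim (flag_of M d :&: flag_of 1%:M A) <= #|P|)%N.
  apply: (@dim_le_card _ _ _ (perm_mx m)) => v; rewrite memv_cap => /andP[].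
  move=> /flag_ofP[x x0 ev] /flag_of_unitP; rewrite unitmx1 invmx1 mul1mx => /(_ isT) vA.
  exists (G *m x); last by rewrite ev MG mulmxA.
  have yE c : (G *m x) c 0 = v (m^-1%g c) 0 by rewrite ev MG -mulmxA mul_perm_mxE permKV.
  have ysum (c : 'I_n) : (b <= c)%N -> (G *m x) c 0 = G c b * x b 0.
    move=> bc; rewrite mxE (bigD1 b) //= big1 ?addr0 // => k kb.
    case: (ltnP k b) => [lt|le]; first by rewrite cols ?mul0r //; apply: leq_trans bc.
    rewrite x0 ?mulr0 // lift0 ltn_neqAle le andbT.
    by apply: contraNneq kb => /val_inj->.
  have xb : x b 0 = 0.
    have := ysum a (ltnW ba); rewrite yE vA //= => /esym/eqP.
    by rewrite mulf_eq0 (negbTE Gab) => /eqP.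
  move=> c; rewrite /= negb_and -!leqNgt; case/orP => [bc|Ac]; last by rewrite yE vA.
  by rewrite ysum // xb mulr0.
have := dimM A d; rewrite lift0 cell_dimS wlt addn1 /cell_dim.
rewrite [X in (X < _)%N](_ : _ = #|P|); first by move=> /leq_trans h /h; rewrite ltnn.
by apply: eq_card => c; rewrite !inE.
Qed.

Lemma upper_of_inversions (K : fieldType) n (m : 'S_n) (M : 'M[K]_n) :
  M \in unitmx ->
  (forall a b : 'I_n.+1, (cell_dim m a b <= \dim (flag_of M b :&: flag_of 1%:M a))%N) ->
  (forall a b : 'I_n, inversion m a b -> (perm_mx m^-1%g *m M) a b = 0) ->
  upper (perm_mx m^-1%g *m M).
Proof.
move=> Mu dimM inv a b; have [k] := ubnP (b : nat); elim: k a b => // k IH a b bk.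
apply: upper_column => // [c a' cb ca'|a']; last exact: inv.
by apply: IH => //; apply: leq_trans cb _.
Qed.

Lemma perm_mx_inv (K : fieldType) n (m : 'S_n) : invmx (perm_mx m) = perm_mx m^-1%g :> 'M[K]_n.
Proof.
rewrite -[LHS]mulmx1 -(@perm_mx1 _ n) -(mulgV m) perm_mxM mulmxA mulVmx ?mul1mx //.
exact: unitmx_perm.
Qed.

Lemma brickP (K : fieldType) n l (beta : l.-tuple 'I_n.-1) (F : flags_cspace K n l.+1) M :
  (forall j, M j \in unitmx) -> (forall j, F j = flag_of (M j)) ->
  brick K beta F <-> bott_samelson K beta F /\
    upper (perm_mx (demazure beta)^-1%g *m M ord_max).
Proof.
move=> Mu FM; split=> -[BF e]; split=> //.
  by rewrite -perm_mx_inv; apply/flag_of_eq; rewrite ?unitmx_perm // -e FM.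
by rewrite FM; apply/esym/flag_of_eq; rewrite ?unitmx_perm ?perm_mx_inv.
Qed.

(** The equations at the inversions suffice, because the Schubert conditions
    hold on the whole Bott-Samelson variety. *)
Lemma bott_samelson_brick (K : fieldType) n l (beta : l.-tuple 'I_n.-1)
    (F : flags_cspace K n l.+1) M :
  (forall j, M j \in unitmx) -> (forall j, F j = flag_of (M j)) -> bott_samelson K beta F ->
  (forall a b : 'I_n, inversion (demazure beta) a b ->
     (perm_mx (demazure beta)^-1%g *m M ord_max) a b = 0) ->
  brick K beta F.
Proof.
move=> Mu FM BF inv; apply/(brickP beta Mu FM); split=> //.
apply: upper_of_inversions => // a b; rewrite -FM; exact: bott_samelson_cell_dim.
Qed.
(** * Smoothness and normal crossings *)

Definition dir_deriv (K : fieldType) N (u w : 'rV[K]_N) (p : {mpoly K[N]}) : K :=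
  \sum_j peval (mderiv j p) u * w 0 j.

Section DirDeriv.
Variables (K : fieldType) (N : nat) (u w : 'rV[K]_N).
Implicit Types p q : {mpoly K[N]}.

Lemma dir_derivD p q : dir_deriv u w (p + q) = dir_deriv u w p + dir_deriv u w q.
Proof.
by rewrite -big_split; apply: eq_bigr => j _; rewrite mderivD pevalD mulrDl.
Qed.

Lemma dir_derivM p q :
  dir_deriv u w (p * q) = dir_deriv u w p * peval q u + peval p u * dir_deriv u w q.
Proof.
rewrite mulr_suml mulr_sumr -big_split; apply: eq_bigr => j _.
by rewrite mderivM pevalD !pevalM mulrDl mulrAC mulrA.
Qed.

Lemma dir_derivC c : dir_deriv u w c%:MP = 0.
Proof. by apply: big1 => j _; rewrite mderivC /peval meval0 mul0r. Qed.

Lemma dir_derivX i : dir_deriv u w 'X_i = w 0 i.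
Proof.
rewrite /dir_deriv (bigD1 i) //= big1 ?addr0 => [|j ji].
  by rewrite mderivX mnm1E eqxx scale1r /peval mevalX big1 ?mul1r // => k _; rewrite mnmBE subnn.
by rewrite mderivX mnm1E eq_sym (negbTE ji) scale0r /peval meval0 mul0r.
Qed.

Lemma dir_deriv_sum (I : Type) (r : seq I) (F : I -> {mpoly K[N]}) :
  dir_deriv u w (\sum_(i <- r) F i) = \sum_(i <- r) dir_deriv u w (F i).
Proof.
elim: r => [|i r IH]; first by rewrite !big_nil -(mpolyC0 N K) dir_derivC.
by rewrite !big_cons dir_derivD IH.
Qed.

Definition mx_deriv m n (A : 'M[{mpoly K[N]}]_(m, n)) : 'M[K]_(m, n) :=
  map_mx (dir_deriv u w) A.

Definition mx_eval m n (A : 'M[{mpoly K[N]}]_(m, n)) : 'M[K]_(m, n) := map_mx (fun p => peval p u) A.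

Lemma mx_evalM m n r (A : 'M[{mpoly K[N]}]_(m, n)) (B : 'M_(n, r)) :
  mx_eval (A *m B) = mx_eval A *m mx_eval B.
Proof. exact: (map_mxM (meval (fun i => u 0 i))). Qed.

Lemma mx_derivM m n r (A : 'M[{mpoly K[N]}]_(m, n)) (B : 'M_(n, r)) :
  mx_deriv (A *m B) = mx_deriv A *m mx_eval B + mx_eval A *m mx_deriv B.
Proof.
apply/matrixP => i j; rewrite !mxE dir_deriv_sum -big_split; apply: eq_bigr => k _.
by rewrite dir_derivM !mxE.
Qed.

Lemma mx_deriv_perm n (s : 'S_n) : mx_deriv (perm_mx s) = 0.
Proof. by apply/matrixP => i j; rewrite !mxE -mpolyC_nat dir_derivC. Qed.

Lemma mx_eval_perm n (s : 'S_n) : mx_eval (perm_mx s) = perm_mx s.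
Proof. exact: (map_perm_mx (meval (fun i => u 0 i))). Qed.

Lemma mx_deriv1 n : mx_deriv (1%:M : 'M_n) = 0.
Proof. by rewrite -(@perm_mx1 _ n) mx_deriv_perm. Qed.

Lemma mx_eval1 n : mx_eval (1%:M : 'M_n) = 1%:M.
Proof. by rewrite -(@perm_mx1 _ n) mx_eval_perm perm_mx1. Qed.

Lemma mx_eval_step n (i : 'I_n.-1) e k :
  mx_eval (chart_step i e 'X_k) = chart_step i e (u 0 k).
Proof.
rewrite /chart_step mx_evalM; congr (_ *m _).
  by case: e; rewrite ?mx_eval_perm ?mx_eval1.
by apply/matrixP => a b; rewrite !mxE pevalD pevalM pevalX /peval !rmorph_nat.
Qed.

Lemma mx_deriv_step n (i : 'I_n.-1) e k : mx_deriv (chart_step i e 'X_k) =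
  chart_step i e (u 0 k) *m (w 0 k *: delta_mx (strand_hi i) (strand_lo i)).
Proof.
rewrite /chart_step mx_derivM -mulmxA.
have -> : mx_deriv (if e then perm_mx (simple_refl i) else 1%:M) = 0.
  by case: e; rewrite ?mx_deriv_perm ?mx_deriv1.
rewrite mul0mx add0r; congr (_ *m _).
  by case: e; rewrite ?mx_eval_perm ?mx_eval1.
rewrite mulmxDl mul1mx -scalemxAl -scalemxAr mul_delta_mx_0; last first.
  by rewrite eq_sym strand_neq.
rewrite !scaler0 addr0; apply/matrixP => a b; rewrite !mxE dir_derivD dir_derivM dir_derivX.
by rewrite -!mpolyC_nat !dir_derivC mulr0 addr0 add0r pevalC.
Qed.

End DirDeriv.

Section Tangent.
Variables (K : fieldType) (n l : nat) (beta : l.-tuple 'I_n.-1) (eps : 'I_l -> bool).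
Variables (u : 'rV[K]_l) (E : 'M[K]_n).

(** The infinitesimal action of the upper triangular matrix [E] on the matrices
    of a chart moves [chart_mx u j] by [E chart_mx u j] up to an infinitesimal
    change of basis [tangent_frame j] that preserves the flag. *)
Fixpoint tangent_frame (j : nat) : 'M[K]_n :=
  if j is j'.+1 then
    if insub j' is Some t then
      let R := chart_step_inv (tnth beta t) (eps t) (u 0 t) *m tangent_frame j' *m
               chart_step (tnth beta t) (eps t) (u 0 t) in
      R + - R (strand_hi (tnth beta t)) (strand_lo (tnth beta t)) *:
        delta_mx (strand_hi (tnth beta t)) (strand_lo (tnth beta t))
    else 0
  else - E.

Definition tangent_conj (t : 'I_l) : 'M[K]_n :=
  chart_step_inv (tnth beta t) (eps t) (u 0 t) *m tangent_frame t *m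
  chart_step (tnth beta t) (eps t) (u 0 t).

Definition tangent : 'rV[K]_l :=
  \row_t - tangent_conj t (strand_hi (tnth beta t)) (strand_lo (tnth beta t)).

Lemma tangent_frameS (t : 'I_l) : tangent_frame t.+1 =
  tangent_conj t + tangent 0 t *: delta_mx (strand_hi (tnth beta t)) (strand_lo (tnth beta t)).
Proof. by rewrite /= valK [tangent 0 t]mxE. Qed.

Hypothesis uE : upper E.

Lemma tangent_frame_upper : forall j : 'I_l.+1, upper (tangent_frame j).
Proof.
apply: (@position_ind l (fun j => upper (tangent_frame j))) => [a b ba|t IH].
  by rewrite mxE uE ?oppr0.
rewrite tangent_frameS; set i := tnth beta t.
apply: (@parabolic_upper _ _ i); last by rewrite !mxE !eqxx mulr1 subrr.
have pR : in_parabolic i (tangent_conj t).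
  apply: in_parabolicM; last exact: in_parabolic_step.
  by apply: in_parabolicM (upper_parabolic IH); exact: in_parabolic_step_inv.
by move=> a b ba nab; rewrite mxE pR // add0r mxE [delta_mx _ _ _ _]mxE (negbTE nab) mulr0.
Qed.

(** Where the step of the chart is the identity, the frame is already upper
    triangular and needs no correction. *)
Lemma tangent_stationary t : eps t = false -> u 0 t = 0 -> tangent 0 t = 0.
Proof.
move=> et ut; rewrite mxE /tangent_conj /chart_step_inv /chart_step et ut.
rewrite oppr0 !scale0r !addr0 !mul1mx mulmx1.
by rewrite (@tangent_frame_upper (widen_ord (leqnSn l) t)) ?oppr0.
Qed.

Definition poly_chart_mx (j : nat) : 'M[{mpoly K[l]}]_n :=
  path_mx (fun t => chart_step (tnth beta t) (eps t) 'X_t) j.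

Lemma poly_chart_eval j : mx_eval u (poly_chart_mx j) = chart_mx beta eps u j.
Proof.
rewrite /poly_chart_mx /chart_mx; elim: j => [|j IH] /=; first exact: mx_eval1.
rewrite mx_evalM IH; case: insub => [t|]; first by rewrite mx_eval_step.
by rewrite mx_eval1.
Qed.

(** The Leibniz rule for the last factor. The correction of [tangent_frame] at
    the exceptional entry is the derivative of the step. *)
Lemma poly_chart_deriv : forall j : 'I_l.+1, mx_deriv u tangent (poly_chart_mx j) =
  E *m chart_mx beta eps u j + chart_mx beta eps u j *m tangent_frame j.
Proof.
pose P j := mx_deriv u tangent (poly_chart_mx j) =
  E *m chart_mx beta eps u j + chart_mx beta eps u j *m tangent_frame j.
apply: (@position_ind l P) => [|t IH]; rewrite /P.
  by rewrite /= mx_deriv1 /chart_mx /= mulmx1 mul1mx subrr.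
rewrite /poly_chart_mx path_mxS -/(poly_chart_mx t) mx_derivM IH poly_chart_eval.
rewrite mx_eval_step mx_deriv_step chart_mxS tangent_frameS /tangent_conj.
move: (chart_step_inv _ _ _) (chart_step _ _ _) (chart_stepK (tnth beta t) (eps t) (u 0 t)).
move=> Ci C CK; move: (_ *: _) (chart_mx _ _ _ _) (tangent_frame _) => D M T.
rewrite mulmxDl mulmxDr !mulmxA addrA; congr (_ + _ + _).
by rewrite -(mulmxA _ C Ci) (mulmx1C CK) mulmx1.
Qed.

End Tangent.

Section SmoothChart.
Variables (K : fieldType) (n l : nat) (beta : l.-tuple 'I_n.-1) (eps : 'I_l -> bool).

Let delta := demazure beta.

Definition last_mx (u : 'rV[K]_l) := perm_mx delta^-1%g *m chart_mx beta eps u l.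

Definition poly_last_mx : 'M[{mpoly K[l]}]_n :=
  perm_mx delta^-1%g *m poly_chart_mx K beta eps l.

Definition inversions : {set 'I_n * 'I_n} :=
  finset (fun p : 'I_n * 'I_n => inversion delta p.1 p.2).

Definition brick_eq (i : 'I_#|inversions|) : {mpoly K[l]} :=
  poly_last_mx (enum_val i).1 (enum_val i).2.

Lemma brick_eqE i u : peval (brick_eq i) u = last_mx u (enum_val i).1 (enum_val i).2.
Proof.
have <- : mx_eval u poly_last_mx = last_mx u by rewrite mx_evalM mx_eval_perm poly_chart_eval.
by rewrite mxE.
Qed.

Definition brick_locus : set (affine_space K l) :=
  [set v | peval (1 : {mpoly K[l]}) v != 0 /\ forall i, peval (brick_eq i) v = 0].

Lemma chart_brickP u : brick K beta (chart beta eps u) <-> upper (last_mx u).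
Proof.
rewrite (@brickP _ _ _ _ _ (fun j : 'I_l.+1 => chart_mx beta eps u j)) => [|j|j].
- by split=> [[]//|uG]; split=> //; exact: chart_bott_samelson.
- exact: chart_mx_unit.
- exact: chartE.
Qed.

Lemma brick_locusP u : brick_locus u <-> brick K beta (chart beta eps u).
Proof.
split=> [[_ h]|/chart_brickP uG].
  apply: (@bott_samelson_brick _ _ _ _ _ (fun j : 'I_l.+1 => chart_mx beta eps u j)).
  - by move=> j; exact: chart_mx_unit.
  - exact: chartE.
  - exact: chart_bott_samelson.
  - move=> a b ab; have hab : (a, b) \in inversions by rewrite inE.
    by have := h (enum_rank_in hab (a, b)); rewrite brick_eqE enum_rankK_in.
split=> [|i]; first by rewrite peval1 oner_eq0.
rewrite brick_eqE uG //; have := enum_valP i; rewrite inE.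
by case/andP.
Qed.

Lemma last_mx_unit u : last_mx u \in unitmx.
Proof. by rewrite unitmx_mul unitmx_perm chart_mx_unit. Qed.

(** For a fixed first index these derivatives form a triangular system with nonzero
    diagonal, because [last_mx u] is triangular and invertible. *)
Lemma brick_eq_deriv u (a b : 'I_n) : upper (last_mx u) -> inversion delta a b ->
  let E := delta_mx (delta^-1%g a) (delta^-1%g b) in
  upper E /\ forall i, dir_deriv u (tangent beta eps u E) (brick_eq i) =
    ((enum_val i).1 == a)%:R * last_mx u b (enum_val i).2.
Proof.
move=> uG /andP[ba wab] E.
have uE : upper E.
  move=> c d dc; rewrite mxE; case: andP => // -[/eqP ec /eqP ed].
  by move: dc; rewrite ec ed ltnNge ltnW.
split=> // i; set p := enum_val i.
have -> : dir_deriv u (tangent beta eps u E) (brick_eq i) =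
    mx_deriv u (tangent beta eps u E) poly_last_mx p.1 p.2 by rewrite mxE.
rewrite mx_derivM mx_deriv_perm mul0mx add0r mx_eval_perm.
rewrite (poly_chart_deriv beta eps u E ord_max) mulmxDr mxE !mulmxA.
have [p21 _] : (p.2 < p.1)%N /\ (delta^-1%g p.1 < delta^-1%g p.2)%N.
  by have := enum_valP i; rewrite inE => /andP.
rewrite [X in _ + X](upperM uG (tangent_frame_upper _ _ _ uE ord_max)) // addr0.
rewrite -mulmxA mul_perm_mxE mxE (bigD1 (delta^-1%g b)) //= big1 ?addr0 => [|c /negbTE cb].
  by rewrite mxE eqxx andbT (inj_eq perm_inj) mul_perm_mxE.
by rewrite mxE cb andbF mul0r.
Qed.

Lemma jacobian_mul m (f : 'I_m -> {mpoly K[l]}) (u w : 'rV[K]_l) i :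
  (jacobian f u *m w^T) i 0 = dir_deriv u w (f i).
Proof. by rewrite mxE; apply: eq_bigr => j _; rewrite !mxE. Qed.

Lemma brick_eq_independent u (lam : 'rV[K]_#|inversions|) : upper (last_mx u) ->
  (forall a b : 'I_n, inversion delta a b ->
    let E := delta_mx (delta^-1%g a) (delta^-1%g b) in
    lam *m jacobian brick_eq u *m (tangent beta eps u E)^T = 0) -> lam = 0.
Proof.
move=> uG h; apply/rowP => i; rewrite [RHS]mxE.
have [k] := ubnP (n - (enum_val i).2); elim: k i => // k IH i ik.
have inv : inversion delta (enum_val i).1 (enum_val i).2.
  by have := enum_valP i; rewrite inE.
have [_ dE] := brick_eq_deriv uG inv.
have /(congr1 (fun M : 'M_1 => M 0 0)) := h _ _ inv; rewrite [RHS]mxE -mulmxA mxE.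
rewrite (bigD1 i) //= big1 => [|j ji]; rewrite jacobian_mul dE.
  rewrite eqxx mul1r addr0 => /eqP; rewrite mulf_eq0 => /orP[/eqP//|].
  by rewrite (negbTE (upper_diag_neq0 uG (last_mx_unit u) _)).
case: eqP => [e1|]; last by rewrite mul0r mulr0.
rewrite mul1r; case: (ltngtP (enum_val j).2 (enum_val i).2) => [lt|gt|/val_inj e2].
- by rewrite uG ?mulr0.
- by rewrite IH ?mul0r //; have := ltn_ord (enum_val j).2; lia.
- case/eqP: ji; apply: enum_val_inj.
  by rewrite [LHS]surjective_pairing e1 e2 -surjective_pairing.
Qed.

Lemma jacobian_row_free u : upper (last_mx u) -> row_free (jacobian brick_eq u).
Proof.
move=> uG; apply: inj_row_free => lam lam0; apply: (brick_eq_independent uG) => a b _ /=.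
by rewrite lam0 mul0mx.
Qed.

Definition still : {set 'I_l} := finset (fun t => ~~ eps t).

Definition wall_eq (i : 'I_#|still|) : {mpoly K[l]} := 'X_(enum_val i).

(** The tangent vectors of the elementary matrices have no component along the
    coordinates of the walls, so they detect the equations of the brick variety
    modulo the equations of the walls, which are distinct coordinates. *)
Lemma jacobian_wall_row_free u : upper (last_mx u) ->
  (forall t, eps t = false -> u 0 t = 0) ->
  row_free (col_mx (jacobian brick_eq u) (jacobian wall_eq u)).
Proof.
move=> uG u0; apply: inj_row_free => lam; rewrite -[lam]hsubmxK mul_row_col.
set lam1 := lsubmx lam; set lam2 := rsubmx lam => lam0.
have tE (i : 'I_#|still|) : eps (enum_val i) = false.
  by have := enum_valP i; rewrite inE => /negbTE.
have l1 : lam1 = 0.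
  apply: (brick_eq_independent uG) => a b inv E.
  have [uE _] := brick_eq_deriv uG inv.
  have := congr1 (mulmxr (tangent beta eps u E)^T) lam0.
  rewrite /= mul0mx mulmxDl -[X in _ + X]mulmxA [jacobian wall_eq u *m _](_ : _ = 0).
    by rewrite mulmx0 addr0.
  apply/colP => i; rewrite jacobian_mul dir_derivX [RHS]mxE.
  by rewrite tangent_stationary // u0.
have -> : lam2 = 0; last by rewrite l1 row_mx0.
apply/rowP => i; rewrite [RHS]mxE.
have := congr1 (fun M : 'rV_l => M 0 (enum_val i)) lam0.
rewrite l1 mul0mx add0r [RHS]mxE mxE (bigD1 i) //= big1 ?addr0 => [|j ji].
  rewrite [jacobian _ _ _ _]mxE mderivX mnm1E eqxx scale1r /peval mevalX big1 ?mulr1 // => k _.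
  by rewrite mnmBE subnn.
rewrite [jacobian _ _ _ _]mxE mderivX mnm1E (inj_eq enum_val_inj) (negbTE ji) scale0r /peval meval0.
by rewrite mulr0.
Qed.

End SmoothChart.
Section ChartRat.
Variables (K : fieldType) (n l : nat) (beta : l.-tuple 'I_n.-1) (eps : 'I_l -> bool).

Lemma rat_chart_step N (S : set 'rV[K]_N) v0 (i : 'I_n.-1) e (f : 'rV[K]_N -> K) :
  rat_at S v0 f -> rat_mx S v0 (fun v => chart_step i e (f v)).
Proof.
move=> rf; apply: rat_mxM; first exact: rat_mx_cst.
by apply: rat_mxD; [exact: rat_mx_cst|apply: rat_mxZ rf (rat_mx_cst _ _ _)].
Qed.

Lemma rat_chart_mx N (S : set 'rV[K]_N) v0 (g : 'rV[K]_N -> 'rV[K]_l) j :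
  rat_mx S v0 g -> rat_mx S v0 (fun v => chart_mx beta eps (g v) j).
Proof.
move=> rg; elim: j => [|j IH]; first exact: rat_mx_cst.
apply: rat_mxM IH _; case: insub => [t|]; last exact: rat_mx_cst.
by apply: rat_chart_step; exact: rg.
Qed.

(** Each chart coordinate is a quotient by a pivot of entries that depend
    rationally on the earlier coordinates. *)
Lemma rat_chart_coord N (S : set 'rV[K]_N) v0 (M : 'rV[K]_N -> 'I_l.+1 -> 'M[K]_n) :
  S v0 -> (forall j, rat_mx S v0 (fun v => M v j)) ->
  (forall t, chart_pivot beta eps (M v0) t != 0) ->
  forall t, rat_at S v0 (fun v => chart_pivot beta eps (M v) t) /\
            rat_at S v0 (fun v => chart_coord beta eps (M v) t).
Proof.
move=> S0 rM piv.
have step (t : 'I_l) : rat_mx S v0 (fun v => chart_rec beta eps (M v) t) ->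
    rat_at S v0 (fun v => chart_pivot beta eps (M v) t) /\
    rat_at S v0 (fun v => chart_coord beta eps (M v) t).
  move=> rC.
  have rR : rat_mx S v0 (fun v => chart_rel beta eps (M v) t).
    by apply: rat_mxM (rM _); apply: rat_mxV => //; exact: chart_rec_unit.
  have rP : rat_at S v0 (fun v => chart_pivot beta eps (M v) t).
    by rewrite /chart_pivot /pivot; case: (eps t); exact: rR.
  split=> //; rewrite /chart_coord /slope.
  by apply: rat_atM (rat_atV S0 rP (piv t)); case: (eps t); exact: rR.
have rec : forall j : 'I_l.+1, rat_mx S v0 (fun v => chart_rec beta eps (M v) j).
  apply: (@position_ind l (fun j => rat_mx S v0 (fun v => chart_rec beta eps (M v) j))).
    exact: rat_mx_cst.
  move=> t rC; apply: (@rat_mx_ext _ _ _ _ _ _ (fun v => chart_rec beta eps (M v) t *m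
      chart_step (tnth beta t) (eps t) (chart_coord beta eps (M v) t))).
    by move=> v; rewrite chart_recS.
  by apply: rat_mxM rC (rat_chart_step _ _ (step t rC).2).
by move=> t; apply: step; exact: (rec (widen_ord (leqnSn l) t)).
Qed.

Lemma chart_inj : injective (chart (K := K) beta eps).
Proof.
move=> u u' e; apply/rowP => t.
have Mu (v : 'rV[K]_l) (j : 'I_l.+1) : chart_mx beta eps v j \in unitmx.
  exact: chart_mx_unit.
have [_ <-] := chart_coordK (Mu u) (chartE beta eps u).
have FM j : chart beta eps u' j = flag_of (chart_mx beta eps u j) by rewrite -e chartE.
by have [_ <-] := chart_coordK (Mu u) FM.
Qed.

Definition chart_dom : set (flags_cspace K n l.+1) :=
  [set F | brick K beta F /\ exists u, F = chart beta eps u].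

Definition chart_inv (F : flags_cspace K n l.+1) : affine_space K l :=
  xget (0 : 'rV[K]_l) [set u | F = chart beta eps u].

Lemma chartK (u : 'rV[K]_l) : chart_inv (chart beta eps u) = u.
Proof.
by apply/esym/chart_inj/(@xgetPex _ 0 [set v | chart beta eps u = chart beta eps v]); exists u.
Qed.

Lemma chart_rat_map (X : set (affine_space K l)) :
  rat_map X (chart beta eps : affine_space K l -> flags_cspace K n l.+1).
Proof.
apply: rat_map_movable => [|u v Xu ->]; first exact: flags_movable.
exists (fun v => of_mats (fun j : 'I_l.+1 => chart_mx beta eps v j)).
  by apply: rat_of_mats => j; apply: rat_chart_mx; exact: rat_id.
apply: znearT => w _ z _ ->; apply: coord_of_mats => j; first exact: chart_mx_unit.
exact: chartE.
Qed.

(** The chart is the open locus where all pivots are nonzero. *)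
Lemma chart_near (Y : set (flags_cspace K n l.+1)) u v :
  Y `<=` bott_samelson K beta -> Y (chart beta eps u) ->
  coord (chart beta eps u : flags_cspace K n l.+1) v ->
  (forall t, rat_at (coord_set Y) v (fun w => chart_coord beta eps (mats w) t)) /\
  znear (coord_set Y) v (fun w => forall F : flags_cspace K n l.+1, Y F -> coord F w ->
    F = chart beta eps (\row_t chart_coord beta eps (mats w) t)).
Proof.
move=> YB Yu uv; have /flags_coordP[Mu FM] := uv.
have Sv : coord_set Y v by exists (chart beta eps u).
have [piv _] := chart_coordK Mu FM.
have rM j : rat_mx (coord_set Y) v (fun w => mats w j : 'M[K]_n) by apply: rat_mats; exact: rat_id.
have rC := rat_chart_coord Sv rM piv; split=> [t|]; first by case: (rC t).
have np t : znear (coord_set Y) v (fun w => chart_pivot beta eps (mats w) t != 0).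
  by apply: rat_at_neq0 => //; case: (rC t).
apply: znear_imp (znear_all np) => w _ hw F YF /flags_coordP[Fu FF].
by apply: chart_of_pivots => //; exact: YB.
Qed.

Lemma brick_bott_samelson : brick K beta `<=` bott_samelson K beta.
Proof. by move=> F []. Qed.

Lemma bott_samelson_flags : bott_samelson K beta `<=` flags K n l.+1.
Proof. by move=> F []. Qed.

Lemma brick_flags : brick K beta `<=` flags K n l.+1.
Proof. by move=> F /brick_bott_samelson/bott_samelson_flags. Qed.

Lemma chart_dom_open : zopen (brick K beta) chart_dom.
Proof.
apply: zopen_near => [F []//|F v [BF [u Fu]] Fv].
rewrite Fu in BF Fv; have [_ near] := chart_near brick_bott_samelson BF Fv.
apply: znear_imp near => w _ h z Bz zw; split=> //.
by exists (\row_t chart_coord beta eps (mats w) t); exact: h.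
Qed.

(** The inverse is given by the recursion for the chart coordinates. *)
Lemma chart_dom_iso : isomorphism chart_dom (brick_locus beta eps) chart_inv.
Proof.
apply: (@rat_map_iso _ _ _ _ _ _ (chart beta eps : affine_space K l -> flags_cspace K n l.+1)).
- by apply: flags_has_coord => F [/brick_flags].
- exact: affine_has_coord.
- by move=> F [BF [u Fu]]; rewrite Fu chartK; apply/brick_locusP; rewrite -Fu.
- by move=> u /brick_locusP Bu; split=> //; exists u.
- by move=> F [_ [u ->]]; rewrite chartK.
- by move=> u _; exact: chartK.
- apply: rat_map_movable => [|F v [BF [u Fu]] Fv]; first exact: affine_movable.
  rewrite Fu in BF Fv.
  have YB : chart_dom `<=` bott_samelson K beta by move=> G [[]].
  have Yu : chart_dom (chart beta eps u) by split=> //; exists u.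
  have [rC near] := chart_near YB Yu Fv.
  exists (fun w => \row_t chart_coord beta eps (mats w) t).
    by move=> a b; apply: rat_at_ext (rC b) => w; rewrite mxE.
  by apply: znear_imp near => w _ h z Bz /(h z Bz) ->; rewrite chartK.
- exact: chart_rat_map.
Qed.

Lemma brick_smooth_chart F : chart_dom F ->
  smooth_chart (brick K beta) F (@brick_eq K n l beta eps) 1 chart_dom chart_inv.
Proof.
move=> dF; split=> //; [exact: chart_dom_open|exact: chart_dom_iso|].
by move=> u /brick_locusP/chart_brickP; exact: jacobian_row_free.
Qed.

Lemma chart_stationary (u : 'rV[K]_l) t :
  flag_before (chart beta eps u : flags_cspace K n l.+1) t = flag_after (chart beta eps u) t <->
  eps t = false /\ u 0 t = 0.
Proof.
rewrite (@flag_stationaryP _ _ _ beta _ (fun j : 'I_l.+1 => chart_mx beta eps u j)) => [||j|].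
- rewrite chart_rel_mx; set i := tnth beta t.
  have [_] := @mul_stepE _ _ i (eps t) (u 0 t) 1%:M (@upper1 K n (strand_hi i) (strand_lo i) (ltnSn _)).
  rewrite mulmx1 => ->; rewrite mxE eqxx mulr1.
  by case: (eps t); split=> [/eqP|[]//]; rewrite ?oner_eq0 // => /eqP.
- by move=> j; exact: chart_mx_unit.
- exact: chartE.
- by rewrite chart_rel_mx; exact: in_parabolic_step.
Qed.

End ChartRat.

Section BrickSmooth.
Variables (K : fieldType) (n l : nat) (beta : l.-tuple 'I_n.-1).

Definition moves (F : flags_cspace K n l.+1) (t : 'I_l) : bool :=
  `[< flag_before F t <> flag_after F t >].

Lemma moves_chart F : bott_samelson K beta F -> exists u,
  F = chart beta (moves F) u /\ forall t, moves F t = false -> u 0 t = 0.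
Proof.
move=> BF; have [v Fv] := flags_has_coord (@bott_samelson_flags K n l beta) BF.
have /flags_coordP[Mu FM] := Fv.
have [piv c0] := moving_chart Mu FM BF (fun t => iff_sym (rwP (asboolP _))).
exists (\row_t chart_coord beta (moves F) (mats v) t); split.
  exact: chart_of_pivots.
by move=> t mt; rewrite mxE c0.
Qed.

Lemma brick_smooth : smooth (brick K beta).
Proof.
move=> F BF; have [u [Fu _]] := moves_chart BF.1.
exists l, #|inversions beta|, (@brick_eq K n l beta (moves F)), 1, (chart_dom beta (moves F)),
  (chart_inv beta (moves F)).
by apply: brick_smooth_chart; split=> //; exists u.
Qed.

Definition boundary : set (flags_cspace K n l.+1) :=
  [set F | brick K beta F /\ exists t : 'I_l, flag_before F t = flag_after F t].

(** In the chart adapted to [F] the walls through [F] are coordinate hyperplanes, and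
    no other wall meets the chart. *)
Lemma walls_normal_crossing : zclosed (brick K beta) boundary ->
  normal_crossing_divisor (brick K beta) boundary.
Proof.
move=> cl; split=> // F BF; have [u [Fu u0]] := moves_chart BF.1.
have dF : chart_dom beta (moves F) F by split=> //; exists u.
exists l, #|inversions beta|, (@brick_eq K n l beta (moves F)), 1, (chart_dom beta (moves F)),
  (chart_inv beta (moves F)); split; first exact: brick_smooth_chart.
have Fi : chart_inv beta (moves F) F = u by rewrite {2}Fu chartK.
exists #|still (moves F)|, (@wall_eq K l (moves F)); rewrite Fi; split.
- by move=> i; rewrite pevalX u0 //; have := enum_valP i; rewrite inE => /negbTE.
- apply: jacobian_wall_row_free => //; apply/chart_brickP; rewrite -Fu; exact: BF.
- move=> G [BG [w Gw]]; split=> [[_ [t]]|[j]]; rewrite ?Gw.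
    move=> /chart_stationary[et wt]; have ts : t \in still (moves F) by rewrite inE et.
    by exists (enum_rank_in ts t); rewrite pevalX chartK enum_rankK_in.
  rewrite pevalX chartK => wi; split; first by rewrite -Gw.
  exists (enum_val j); apply/chart_stationary; split=> //.
  by have := enum_valP j; rewrite inE => /negbTE.
Qed.

End BrickSmooth.
(** * Density of the open brick variety and irreducibility *)

Section Clearing.
Variables (K : fieldType) (n : nat) (m : 'S_n).
Implicit Types (G M : 'M[K]_n).

(** Left multiplication by this matrix clears column [c] of [G] at the inversions of
    [m], and only there, so that its conjugate by [m] is upper triangular. *)
Definition clear_column G (c : 'I_n) : 'M[K]_n :=
  \matrix_(a, b) ((a == b)%:R - (if (b == c) && inversion m a c then G a c / G c c else 0)).

Lemma clear_columnE G c (A : 'M[K]_n) a b : (clear_column G c *m A) a b =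
  A a b - (if inversion m a c then G a c / G c c else 0) * A c b.
Proof.
transitivity (\sum_k ((a == k)%:R * A k b -
    (if (k == c) && inversion m a c then G a c / G c c else 0) * A k b)).
  by rewrite mxE; apply: eq_bigr => k _; rewrite mxE mulrBl.
rewrite sumrB; congr (_ - _).
  rewrite (bigD1 a) //= eqxx mul1r big1 ?addr0 // => k ka.
  by rewrite eq_sym (negbTE ka) mul0r.
rewrite (bigD1 c) //= eqxx big1 ?addr0 // => k kc.
by rewrite (negbTE kc) mul0r.
Qed.

Definition clear_conj G c := perm_mx m *m clear_column G c *m perm_mx m^-1%g.

Lemma clear_conjE G c a b : clear_conj G c a b = clear_column G c (m a) (m b).
Proof. by rewrite /clear_conj -col_permE mxE mul_perm_mxE. Qed.

Lemma clear_conj_upper G c : upper (clear_conj G c) /\ clear_conj G c \in unitmx.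
Proof.
have u : upper (clear_conj G c).
  move=> a b ba; rewrite clear_conjE mxE (inj_eq perm_inj).
  have -> : (a == b) = false by apply/negbTE; apply: contraTneq ba => ->; rewrite ltnn.
  rewrite sub0r; case: andP => [[/eqP <- /andP[_]]|]; last by rewrite oppr0.
  by rewrite !permK ltnNge ltnW.
split=> //; apply: upper_unit => // a; rewrite clear_conjE mxE eqxx.
case: andP => [[/eqP <- /andP[]]|]; first by rewrite ltnn.
by rewrite subr0 oner_eq0.
Qed.

(** The product of the first [j] clearing operations that turn
    [perm_mx m^-1 *m M] into an upper triangular matrix. *)
Fixpoint clear_mx M (j : nat) : 'M[K]_n :=
  if j is j'.+1 then
    (if insub j' is Some c then clear_conj (perm_mx m^-1%g *m (clear_mx M j' *m M)) c
     else 1%:M) *m clear_mx M j'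
  else 1%:M.

Definition cleared M j := perm_mx m^-1%g *m (clear_mx M j *m M).

Lemma clear_mxS M (c : 'I_n) : clear_mx M c.+1 = clear_conj (cleared M c) c *m clear_mx M c.
Proof. by rewrite /= valK. Qed.

Lemma clearedS M (c : 'I_n) : cleared M c.+1 = clear_column (cleared M c) c *m cleared M c.
Proof.
rewrite {1}/cleared clear_mxS /clear_conj.
move: (clear_column _ _) => A; by rewrite /cleared !mulmxA -perm_mxM mulVg perm_mx1 mul1mx.
Qed.

Lemma clear_mx_upper M j : upper (clear_mx M j) /\ clear_mx M j \in unitmx.
Proof.
elim: j => [|j [uj Uj]] /=; first by split; [exact: upper1|exact: unitmx1].
case: insub => [c|]; last by rewrite mul1mx.
have [uc Uc] := clear_conj_upper (perm_mx m^-1%g *m (clear_mx M j *m M)) c.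
by split; [exact: upperM|rewrite unitmx_mul Uc].
Qed.

(** Columns are cleared from left to right. Row operations can only reach the
    inversions; the remaining entries below the diagonal vanish because the
    Schubert conditions are invariant under upper triangular matrices. *)
Lemma cleared_upper M : M \in unitmx ->
  (forall Q, upper Q -> Q \in unitmx -> forall a b : 'I_n.+1,
     (cell_dim m a b <= \dim (flag_of (Q *m M) b :&: flag_of 1%:M a))%N) ->
  (forall c : 'I_n, cleared M c c c != 0) -> upper (cleared M n).
Proof.
move=> Mu dimM piv.
suff h : forall j : 'I_n.+1, forall c a : 'I_n, (c < j)%N -> (c < a)%N -> cleared M j a c = 0.
  by move=> a b; exact: (h ord_max).
pose P j := forall c a : 'I_n, (c < j)%N -> (c < a)%N -> cleared M j a c = 0.
apply: (@position_ind n P) => // c IH.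
have old : forall b a : 'I_n, (b < c)%N -> (b < a)%N -> cleared M c.+1 a b = 0.
  by move=> b a bc ba; rewrite clearedS clear_columnE (IH b a) // (IH b c) // mulr0 subr0.
move=> b a; rewrite ltnS leq_eqVlt => /orP[/eqP/val_inj->|]; last exact: old.
have [uQ UQ] := clear_mx_upper M c.+1.
move: a; apply: (upper_column (M := clear_mx M c.+1 *m M)) => //.
- by rewrite unitmx_mul UQ.
- exact: dimM.
- move=> a inv; rewrite -/(cleared M c.+1) clearedS clear_columnE inv divfK ?subrr //.
Qed.

(** Nothing is left to clear, so the retraction is the identity on the brick
    variety. *)
Lemma cleared_id M : upper (perm_mx m^-1%g *m M) -> forall j, clear_mx M j = 1%:M.
Proof.
move=> uM; elim=> //= j ->; rewrite mulmx1 mul1mx; case: insub => // c.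
apply/matrixP => a b; rewrite clear_conjE mxE [RHS]mxE (inj_eq perm_inj).
case: andP => [[_ inv]|_]; last by rewrite subr0.
by have /andP[ca _] := inv; rewrite uM // mul0r subr0.
Qed.

Lemma rat_cleared N (S : set 'rV[K]_N) v0 (M : 'rV[K]_N -> 'M[K]_n) :
  S v0 -> rat_mx S v0 M -> M v0 \in unitmx -> upper (perm_mx m^-1%g *m M v0) ->
  (forall j, rat_mx S v0 (fun v => clear_mx (M v) j)) /\
  znear S v0 (fun v => forall c : 'I_n, cleared (M v) c c c != 0).
Proof.
move=> S0 rM Mu uM.
have rG j : rat_mx S v0 (fun v => clear_mx (M v) j) -> rat_mx S v0 (fun v => cleared (M v) j).
  by move=> rj; apply: rat_mxM (rat_mxM rj rM); exact: rat_mx_cst.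
have piv j (c : 'I_n) : cleared (M v0) j c c != 0.
  rewrite /cleared cleared_id // mul1mx; apply: upper_diag_neq0 => //.
  by rewrite unitmx_mul unitmx_perm.
have rC j : rat_mx S v0 (fun v => clear_mx (M v) j).
  elim: j => [|j IH]; first exact: rat_mx_cst.
  apply: rat_mxM; last exact: IH.
  case: insub => [c|]; last exact: rat_mx_cst.
  apply: rat_mxM; last exact: rat_mx_cst.
  apply: rat_mxM; first exact: rat_mx_cst.
  have rj := rG j IH.
  move=> a b; apply: (@rat_at_ext _ _ _ _ (fun v => (a == b)%:R -
      (if (b == c) && inversion m a c then cleared (M v) j a c / cleared (M v) j c c else 0))).
    by move=> v; rewrite [RHS]mxE.
  apply: rat_atB; first exact: rat_at_cst.
  case: ((b == c) && inversion m a c); last exact: rat_at_cst.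
  by apply: rat_atM (rj _ _) (rat_atV S0 (rj _ _) (piv _ _)).
split=> //; apply: znear_all => c; apply: rat_at_neq0 => //.
by apply: rG; exact: rC.
Qed.

End Clearing.

Section Retraction.
Variables (K : fieldType) (n l : nat) (beta : l.-tuple 'I_n.-1) (eps : 'I_l -> bool).

Let delta := demazure beta.

Definition retract_mx (u : 'rV[K]_l) (j : nat) : 'M[K]_n :=
  clear_mx delta (chart_mx beta eps u l) n *m chart_mx beta eps u j.

(** A rational retraction of a chart onto the brick variety: a Bott-Samelson
    path that ends in the Bruhat cell of [delta] is translated by an upper
    triangular matrix that brings its end to the coordinate flag of [delta].
    The translation does not change which flags of the path coincide. *)
Definition retract (u : 'rV[K]_l) : flags_cspace K n l.+1 :=
  [ffun j : 'I_l.+1 => flag_of (retract_mx u j)].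

Definition retractable (u : 'rV[K]_l) :=
  forall c : 'I_n, cleared delta (chart_mx beta eps u l) c c c != 0.

Lemma translate_bott_samelson (Q : 'M[K]_n) u : upper Q -> Q \in unitmx ->
  let M (j : 'I_l.+1) := Q *m chart_mx beta eps u j in
  [/\ forall j, M j \in unitmx,
      forall t, rel_mx M t = chart_step (tnth beta t) (eps t) (u 0 t)
    & bott_samelson K beta ([ffun j => flag_of (M j)] : flags_cspace K n l.+1)].
Proof.
move=> uQ Qu M.
have Mu j : M j \in unitmx by rewrite unitmx_mul Qu chart_mx_unit.
have rM t : rel_mx M t = chart_step (tnth beta t) (eps t) (u 0 t).
  by rewrite /rel_mx invmxM ?chart_mx_unit // -mulmxA mulKmx // -chart_rel_mx.
split=> //; apply/(bott_samelsonP beta Mu) => [j|]; first by rewrite ffunE.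
split=> [|t]; first by rewrite /M mulmx1.
by rewrite rM; exact: in_parabolic_step.
Qed.

Lemma retract_mx_unit u j : retract_mx u j \in unitmx.
Proof. by rewrite unitmx_mul chart_mx_unit andbT; case: (clear_mx_upper delta (chart_mx beta eps u l) n). Qed.

Lemma retractE u j : retract u j = flag_of (retract_mx u j).
Proof. by rewrite ffunE. Qed.

Lemma retract_brick u : retractable u -> brick K beta (retract u).
Proof.
move=> piv; have [uQ Qu] := clear_mx_upper delta (chart_mx beta eps u l) n.
have [Mu _ BS] := translate_bott_samelson u uQ Qu.
apply/(brickP beta Mu) => [j|]; first exact: retractE.
split=> //; apply: cleared_upper => // [|Q' uQ' Q'u a b]; first exact: chart_mx_unit.
have [_ _ BS'] := translate_bott_samelson u uQ' Q'u.
by have := bott_samelson_cell_dim BS' a b; rewrite ffunE.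
Qed.

Lemma retract_stationary u t :
  flag_before (retract u) t = flag_after (retract u) t <-> eps t = false /\ u 0 t = 0.
Proof.
have [uQ Qu] := clear_mx_upper delta (chart_mx beta eps u l) n.
have [Mu rM _] := translate_bott_samelson u uQ Qu.
rewrite -(chart_stationary beta).
rewrite (@flag_stationaryP _ _ _ beta _ _ _ Mu) ?rM; [|exact: retractE|exact: in_parabolic_step].
rewrite (@flag_stationaryP _ _ _ beta _ (fun j : 'I_l.+1 => chart_mx beta eps u j)) ?chart_rel_mx //.
- by move=> j; exact: chart_mx_unit.
- exact: chartE.
- exact: in_parabolic_step.
Qed.

(** As the retraction fixes the points of the brick variety, it maps all points
    near a point outside of [Z] to points outside of [Z]. *)
Lemma retract_avoid Z u0 : zclosed (brick K beta) Z -> brick K beta (chart beta eps u0) ->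
  ~ Z (chart beta eps u0) ->
  exists2 q : {mpoly K[l]}, peval q u0 != 0 &
    forall u, peval q u != 0 -> brick K beta (retract u) /\ ~ Z (retract u).
Proof.
move=> /zclosedP[sZ cZ] B0 nZ.
pose g (u : 'rV[K]_l) := of_mats (fun j : 'I_l.+1 => retract_mx u j).
have uG : upper (perm_mx delta^-1%g *m chart_mx beta eps u0 l) by apply/chart_brickP.
have [rC np] := rat_cleared (S := setT) I (rat_chart_mx beta eps l (rat_id _ _))
  (chart_mx_unit beta eps u0 l) uG.
have rg : rat_mx setT u0 g.
  apply: rat_of_mats => j; apply: rat_mxM; first exact: rC.
  by apply: rat_chart_mx; exact: rat_id.
have g0 : coord (chart beta eps u0 : flags_cspace K n l.+1) (g u0).
  apply: coord_of_mats => j; first exact: retract_mx_unit.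
  by rewrite chartE /retract_mx cleared_id // mul1mx.
have [p pn pZ] := cZ _ _ B0 nZ g0.
have [q qn qP] := znear_and np (rat_at_neq0 I (rat_at_comp p rg) pn).
exists q => // u /(qP u I)[piv pu]; split; first exact: retract_brick.
move=> Zu; apply: pZ pu; exists (retract u) => //.
by apply: coord_of_mats => j; [exact: retract_mx_unit|exact: retractE].
Qed.

End Retraction.

Section Irreducible.
Variables (K : fieldType) (n l : nat) (beta : l.-tuple 'I_n.-1).
Hypothesis charK : [pchar K] =i pred0.

Lemma moving_open_brick (F : flags_cspace K n l.+1) : brick K beta F ->
  (forall t : 'I_l, flag_before F t <> flag_after F t) -> open_brick K beta F.
Proof. by move=> BF mv; split=> //; split=> //; case: BF. Qed.

(** If [Z] misses a point of the brick variety, then retraction of a nearby point of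
    the chart all of whose wall coordinates are nonzero gives a point of the
    open brick variety outside of [Z]. *)
Lemma open_brick_dense : zdense (brick K beta) (open_brick K beta).
Proof.
move=> Z cZ oZ; have [sZ _] := cZ.
apply/seteqP; split=> // F BF; apply: contrapT => nZ.
have [u0 [Fu _]] := moves_chart BF.1.
set eps := moves F in Fu; rewrite Fu in BF nZ.
have [q qn qP] := retract_avoid cZ BF nZ.
pose w : {mpoly K[l]} := \prod_(t | ~~ eps t) 'X_t.
have wE u : peval w u = \prod_(t | ~~ eps t) u 0 t.
  by rewrite /peval rmorph_prod; apply: eq_bigr => t _; exact: pevalX.
have w1 : peval w (const_mx 1) != 0.
  by rewrite wE big1 ?oner_eq0 // => t _; rewrite mxE.
have [u [qu wu]] := peval_mul_neq0 charK qn w1.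
have [Bu nZu] := qP u qu; apply: nZu; apply: oZ; apply: moving_open_brick => // t.
move=> /retract_stationary[et ut]; move: wu; rewrite wE (bigD1 t) ?et //= ut mul0r.
by rewrite eqxx.
Qed.

(** A reduced subword for the Demazure product gives a path of coordinate flags that
    moves exactly at the letters of the subword. *)
Lemma brick_nonempty : brick K beta !=set0.
Proof.
have [b sz /andP[/eqP e _]] := demazure_fold_reduced beta.
pose eps (t : 'I_l) := nth false b t.
exists (chart beta eps 0); apply/chart_brickP.
have szl : size b = l by rewrite sz size_tuple.
have chE : forall j : 'I_l.+1, chart_mx beta eps (0 : 'rV[K]_l) j =
    perm_mx (word_perm (mask (take j b) (take j beta))).
  apply: (@position_ind l (fun j => chart_mx beta eps (0 : 'rV[K]_l) j =
    perm_mx (word_perm (mask (take j b) (take j beta))))) => [|t IH].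
    by rewrite !take0 /word_perm big_nil perm_mx1.
  rewrite chart_mxS IH (take_nth false) ?szl // (take_nth (tnth beta t)) ?size_tuple //.
  rewrite -tnth_nth mask_rcons ?size_take ?szl ?size_tuple // word_perm_cat perm_mxM.
  rewrite mxE /chart_step scale0r addr0 mulmx1 -/(eps t); congr (_ *m _).
  by case: (eps t); rewrite /= ?word_perm1 // /word_perm big_nil perm_mx1.
have := chE ord_max; rewrite /= !take_oversize ?szl ?size_tuple // e -demazureE => eq.
by rewrite /last_mx eq -perm_mxM mulVg perm_mx1; exact: upper1.
Qed.

Lemma open_brick_nonempty : open_brick K beta !=set0.
Proof.
apply: contrapT => /set0P/negP; rewrite negbK => /eqP o0.
have [F BF] := brick_nonempty.
have := open_brick_dense (zclosed0 _); rewrite o0 => /(_ (@subset_refl _ _)) e.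
by move: BF; rewrite -e.
Qed.

Lemma open_brick_chart (F : flags_cspace K n l.+1) :
  open_brick K beta F -> exists u, F = chart beta (fun=> true) u.
Proof.
move=> [BF [_ mv]]; have [u [Fu _]] := moves_chart BF.1; exists u.
by rewrite {1}Fu; congr (chart _ _ _); apply: boolp.funext => t; apply/asboolP; exact: mv.
Qed.

(** By density it is enough to separate points of the open brick variety, which lie in
    a common chart; then a single retraction avoids both closed sets. *)
Lemma brick_irreducible : irreducible_set (brick K beta).
Proof.
split; first exact: brick_nonempty.
move=> Z1 Z2 c1 c2 cov; apply: contrapT => /not_orP[n1 n2].
have avoid Z : zclosed (brick K beta) Z -> ~ brick K beta `<=` Z ->
    exists2 q : {mpoly K[l]}, (exists u0, peval q u0 != 0) & forall u, peval q u != 0 ->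
      brick K beta (retract beta (fun=> true) u) /\ ~ Z (retract beta (fun=> true) u).
  move=> cZ nsub.
  have [F /not_implyP[oF nF]] : exists F, ~ (open_brick K beta F -> Z F).
    apply/existsNP => sub; apply: nsub => F BF.
    by rewrite (open_brick_dense cZ sub).
  have [u0 Fu] := open_brick_chart oF; rewrite Fu in nF oF.
  have [q qn qP] := retract_avoid cZ oF.1 nF.
  by exists q => //; exists u0.
have [q1 [u1 qn1] q1P] := avoid _ c1 n1.
have [q2 [u2 qn2] q2P] := avoid _ c2 n2.
have [u [/q1P[Bu nu1] /q2P[_ nu2]]] := peval_mul_neq0 charK qn1 qn2.
by case: (cov _ Bu).
Qed.

End Irreducible.
(** * Walls of the brick variety *)

(** The intersection is spanned by coordinate vectors. *)
Lemma cell_dim_perm (K : fieldType) n (m : 'S_n) (a b : 'I_n.+1) :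
  (\dim (flag_of (perm_mx m : 'M[K]_n) b :&: flag_of 1%:M a) <= cell_dim m a b)%N.
Proof.
rewrite /cell_dim cardsE; apply: (@dim_le_card _ _ _ (perm_mx m)) => v.
rewrite memv_cap => /andP[/flag_ofP[x x0 ev] /flag_of_unitP].
rewrite unitmx1 invmx1 mul1mx => /(_ isT) va; exists x => // c.
rewrite negb_and -!leqNgt => /orP[/x0//|ac].
by have := va _ ac; rewrite ev mul_perm_mxE permKV.
Qed.

Lemma cell_dim_inj n (m m' : 'S_n) :
  (forall a b : 'I_n.+1, cell_dim m a b = cell_dim m' a b) -> m = m'.
Proof.
move=> h; apply: invg_inj; apply/permP => c.
have e (a : 'I_n.+1) : (m^-1%g c < a)%N = (m'^-1%g c < a)%N.
  have := h a (lift ord0 c); rewrite !lift0 !cell_dimS.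
  rewrite (h a (widen_ord (leqnSn n) c)) => /addnI.
  by do 2!case: (_ < _)%N.
have := e (lift ord0 (m^-1%g c)); have := e (lift ord0 (m'^-1%g c)).
by rewrite !lift0 !ltnS !leqnn => l1 l2; apply: val_inj; apply/eqP; rewrite eqn_leq l1 -l2.
Qed.

Section Walls.
Variables (K : fieldType) (n l : nat) (beta : l.-tuple 'I_n.-1).

Definition wall (t : 'I_l) : set (flags_cspace K n l.+1) :=
  [set F | brick K beta F /\ flag_before F t = flag_after F t].

Lemma wall_closed t : zclosed (brick K beta) (wall t).
Proof.
apply: zclosed_rat => [F []//|F v BF nW Fv].
set i := tnth beta t.
exists (fun w => rel_mx (mats w : 'I_l.+1 -> 'M[K]_n) t (strand_hi i) (strand_lo i)).
have st (G : flags_cspace K n l.+1) w : brick K beta G -> coord G w ->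
    flag_before G t = flag_after G t <->
    rel_mx (mats w : 'I_l.+1 -> 'M[K]_n) t (strand_hi i) (strand_lo i) = 0.
  move=> BG /flags_coordP[Gu GM]; apply: flag_stationaryP => //.
  by have [_] := (bott_samelsonP beta Gu GM).1 BG.1; exact.
split=> [||w [G [BG sG] Gw]]; last exact/(st G w BG Gw).
  have rM j : rat_mx (coord_set (brick K beta)) v (fun w => mats w j : 'M[K]_n).
    by apply: rat_mats; exact: rat_id.
  suff rR : rat_mx (coord_set (brick K beta)) v
      (fun w => rel_mx (mats w : 'I_l.+1 -> 'M[K]_n) t) by exact: rR.
  apply: rat_mxM (rM _); apply: rat_mxV (rM _) _; first by exists F.
  by have /flags_coordP[Mu _] := Fv.
by apply/eqP => /(st F v BF Fv) e; apply: nW.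
Qed.

Lemma walls_closed (s : seq 'I_l) :
  zclosed (brick K beta) [set F | exists2 t, t \in s & wall t F].
Proof.
elim: s => [|t s IH].
  suff -> : [set F | exists2 t, t \in [::] & wall t F] = set0 by exact: zclosed0.
  by apply/seteqP; split=> F // [].
suff -> : [set F | exists2 t', t' \in t :: s & wall t' F] =
    wall t `|` [set F | exists2 t', t' \in s & wall t' F].
  by apply: zclosedU; [exact: wall_closed|exact: IH].
apply/seteqP; split=> F => [[t']|[Wt|[t' ts Wt]]].
- by rewrite inE => /orP[/eqP->|ts] Wt; [left|right; exists t'].
- by exists t; rewrite ?mem_head.
- by exists t'; rewrite // inE ts orbT.
Qed.

Lemma boundary_walls : boundary beta = [set F | exists2 t, t \in enum 'I_l & wall t F].
Proof.
apply/seteqP; split=> F => [[BF [t st]]|[t _ [BF st]]]; last by split=> //; exists t.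
by exists t; rewrite ?mem_enum.
Qed.

Lemma boundary_closed : zclosed (brick K beta) (boundary beta).
Proof. by rewrite boundary_walls; exact: walls_closed. Qed.

(** The boundary is a finite union of closed walls. *)
Lemma irreducible_in_wall (Z : set (flags_cspace K n l.+1)) :
  irreducible_set Z -> Z `<=` boundary beta -> exists t, Z `<=` wall t.
Proof.
rewrite boundary_walls => -[[F0 Z0] irr]; have: Z `<=` boundary beta -> Z `<=` brick K beta.
  by move=> h F /h[].
rewrite boundary_walls => sub; move: (enum _) sub => s sub cov.
have {}sub := sub cov.
elim: s cov => [|t s IH] cov; first by have [t] := cov _ Z0.
case: (irr _ _ (zclosed_sub sub (wall_closed t)) (zclosed_sub sub (walls_closed s))) => [F ZF|h|h].
- have [t'] := cov _ ZF; rewrite inE => /orP[/eqP->|ts] Wt; first by left.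
  by right; split=> //; exists t'.
- by exists t => F /h[].
- by apply: IH => F /h[].
Qed.

End Walls.

(** Paths for [beta] that are constant at the letter [k] correspond to paths for the
    word without this letter: of the two equal flags, with indices [k] and
    [k + 1], the second is dropped. *)
Section Removal.
Variables (K : fieldType) (n l : nat) (beta : l.+1.-tuple 'I_n.-1) (gamma : l.-tuple 'I_n.-1).
Variable k : 'I_l.+1.
Hypothesis gammaE : forall t, tnth gamma t = tnth beta (lift k t).
Implicit Types (F : flags_cspace K n l.+2) (H : flags_cspace K n l.+1).

Definition drop_flag F : flags_cspace K n l.+1 :=
  [ffun j : 'I_l.+1 => F (lift (lift ord0 k) j)].

Definition merge_index (j : 'I_l.+2) : 'I_l.+1 := inord (unbump k j).

Definition repeat_flag H : flags_cspace K n l.+2 := [ffun j : 'I_l.+2 => H (merge_index j)].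

Lemma merge_indexE (j : 'I_l.+2) : merge_index j = unbump k j :> nat.
Proof.
rewrite /merge_index inordK // /unbump; have := ltn_ord j; have := ltn_ord k.
by case: ltnP => /=; lia.
Qed.

Lemma flag_before_drop F t : flag_before F k = flag_after F k ->
  flag_before (drop_flag F) t = flag_before F (lift k t).
Proof.
move=> st; rewrite /flag_before ffunE.
case: (eqVneq (t : nat) k) => [tk|nk]; last first.
  by congr (F _); apply: val_inj; rewrite /= /bump; lia.
have -> : lift (lift ord0 k) (widen_ord (leqnSn l) t) = widen_ord (leqnSn l.+1) k.
  by apply: val_inj; rewrite /= /bump; lia.
have -> : widen_ord (leqnSn l.+1) (lift k t) = lift ord0 k.
  by apply: val_inj; rewrite /= /bump; lia.
exact: st.
Qed.

Lemma flag_after_drop F t : flag_after (drop_flag F) t = flag_after F (lift k t).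
Proof.
rewrite /flag_after ffunE; congr (F _); apply: val_inj; rewrite /= /bump; lia.
Qed.

Lemma flag_before_repeat H t : flag_before (repeat_flag H) (lift k t) = flag_before H t.
Proof.
rewrite /flag_before ffunE; congr (H _); apply: val_inj.
by rewrite /= merge_indexE /= /unbump /bump; lia.
Qed.

Lemma flag_after_repeat H t : flag_after (repeat_flag H) (lift k t) = flag_after H t.
Proof.
rewrite /flag_after ffunE; congr (H _); apply: val_inj.
by rewrite /= merge_indexE /= /unbump /bump; lia.
Qed.

Lemma repeat_stationary H : flag_before (repeat_flag H) k = flag_after (repeat_flag H) k.
Proof.
rewrite /flag_before /flag_after !ffunE; congr (H _); apply: val_inj.
by rewrite /= !merge_indexE /= /unbump /bump; lia.
Qed.

Lemma repeat_first H : repeat_flag H ord0 = H ord0.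
Proof. by rewrite ffunE; congr (H _); apply: val_inj; rewrite /= merge_indexE /= /unbump; lia. Qed.

Lemma repeat_last H : repeat_flag H ord_max = H ord_max.
Proof.
rewrite ffunE; congr (H _); apply: val_inj; rewrite /= merge_indexE /= /unbump.
have := ltn_ord k; lia.
Qed.

Lemma drop_first F : drop_flag F ord0 = F ord0.
Proof. by rewrite ffunE; congr (F _); apply: val_inj; rewrite /= /bump; lia. Qed.

Lemma drop_last F : flag_before F k = flag_after F k -> drop_flag F ord_max = F ord_max.
Proof.
move=> st; rewrite ffunE; case: (eqVneq (k : nat) l) => [kl|nk]; last first.
  by congr (F _); apply: val_inj; rewrite /= /bump; have := ltn_ord k; lia.
have -> : lift (lift ord0 k) ord_max = widen_ord (leqnSn l.+1) k.
  by apply: val_inj; rewrite /= /bump; lia.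
have -> : ord_max = lift ord0 k by apply: val_inj; rewrite /= /bump; lia.
exact: st.
Qed.

Lemma repeat_drop F : flag_before F k = flag_after F k -> repeat_flag (drop_flag F) = F.
Proof.
move=> st; apply/ffunP => j; rewrite !ffunE.
case: (eqVneq (j : nat) k.+1) => [jk|nk]; last first.
  congr (F _); apply: val_inj; rewrite /= merge_indexE /unbump /bump; lia.
have -> : j = lift ord0 k by apply: val_inj; rewrite /= jk.
have -> : lift (lift ord0 k) (merge_index (lift ord0 k)) = widen_ord (leqnSn l.+1) k.
  by apply: val_inj; rewrite /= merge_indexE /= /unbump /bump; lia.
exact: st.
Qed.

Lemma drop_bott_samelson F : bott_samelson K beta F -> flag_before F k = flag_after F k ->
  bott_samelson K gamma (drop_flag F).
Proof.
move=> [fF std step] st; split=> [j||t]; first by rewrite ffunE; exact: fF.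
  by rewrite drop_first.
by rewrite flag_before_drop // flag_after_drop gammaE; exact: step.
Qed.

Lemma repeat_bott_samelson H : bott_samelson K gamma H -> bott_samelson K beta (repeat_flag H).
Proof.
move=> [fH std step]; split=> [j||t]; first by rewrite ffunE; exact: fH.
  by rewrite repeat_first.
case: (unliftP k t) => [t'|] ->; last by left; exact: repeat_stationary.
by rewrite flag_before_repeat flag_after_repeat -gammaE; exact: step.
Qed.

(** A point of the brick variety on the wall [k] gives a path for the shorter
    word with the same end; the two Schubert conditions on the ends then force
    the Demazure products to agree. *)
Lemma stationary_demazure F : brick K beta F -> flag_before F k = flag_after F k ->
  demazure gamma = demazure beta.
Proof.
move=> [BF eF] st; have [H [BH eH]] := brick_nonempty K gamma.
apply: cell_dim_inj => a b; apply/eqP; rewrite eqn_leq; apply/andP; split.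
  apply: leq_trans (cell_dim_perm K _ _ _).
  by rewrite -eF -(drop_last st); exact: bott_samelson_cell_dim (drop_bott_samelson BF st) _ _.
apply: leq_trans (cell_dim_perm K _ _ _).
by rewrite -eH -repeat_last; exact: bott_samelson_cell_dim (repeat_bott_samelson BH) _ _.
Qed.

Hypothesis removable : demazure gamma = demazure beta.

Lemma repeat_wall H : brick K gamma H -> wall beta k (repeat_flag H).
Proof.
move=> [BH eH]; split; last exact: repeat_stationary.
by split; [exact: repeat_bott_samelson|rewrite repeat_last eH removable].
Qed.

Lemma drop_brick F : wall beta k F -> brick K gamma (drop_flag F).
Proof.
move=> [[BF eF] st]; split; first exact: drop_bott_samelson.
by rewrite drop_last // eF removable.
Qed.

Lemma repeat_rat_map (X : set (flags_cspace K n l.+1)) : rat_map X repeat_flag.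
Proof.
apply: rat_map_movable => [|H v XH Hv]; first exact: flags_movable.
exists (fun w => of_mats (fun j => mats w (merge_index j))).
  by apply: rat_of_mats => j; apply: rat_mats; exact: rat_id.
apply: znearT => w _ z _ /flags_coordP[zu zM]; apply: coord_of_mats => j; first exact: zu.
by rewrite ffunE zM.
Qed.

Hypothesis charK : [pchar K] =i pred0.

Lemma removable_wall_irreducible : irreducible_set (wall (K := K) beta k).
Proof.
apply: (irreducible_image (brick_irreducible gamma charK) (phi := repeat_flag)) => [|F WF].
  apply: rat_map_regular.
  - by apply: flags_has_coord; exact: brick_flags.
  - by apply: flags_has_coord => F [/brick_flags].
  - exact: repeat_wall.
  - exact: repeat_rat_map.
exists (drop_flag F); first exact: drop_brick.
by apply: repeat_drop; case: WF.
Qed.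

(** The repetition of a flag in a point of the open brick variety of the shorter
    word. *)
Lemma removable_wall_generic : exists2 F, wall (K := K) beta k F &
  forall t, t != k -> flag_before F t <> flag_after F t.
Proof.
have [H [BH [_ mv]]] := open_brick_nonempty gamma charK.
exists (repeat_flag H); first exact: repeat_wall.
move=> t; case: (unliftP k t) => [t'|] ->; last by rewrite eqxx.
by rewrite flag_before_repeat flag_after_repeat => _; exact: mv.
Qed.

End Removal.

Lemma remove_letter_tuple n l (beta : l.+1.-tuple 'I_n.-1) (k : 'I_l.+1) :
  exists gamma : l.-tuple 'I_n.-1,
    gamma = remove_letter k beta :> seq _ /\ forall t, tnth gamma t = tnth beta (lift k t).
Proof.
exists [tuple tnth beta (lift k t) | t < l]; split=> [|t]; last by rewrite tnth_mktuple.
have sk : (k < size beta)%N by rewrite size_tuple.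
have sz : size (remove_letter k beta) = l.
  by rewrite size_cat size_take size_drop sk size_tuple; have := ltn_ord k; lia.
case: l beta k sk sz => [|l] beta k sk sz.
  by rewrite (size0nil sz); apply: size0nil; rewrite size_tuple.
pose x0 := tnth beta k.
apply: (@eq_from_nth _ x0); first by rewrite size_tuple sz.
move=> j; rewrite size_tuple => jl; rewrite (_ : nth _ _ _ = tnth beta (lift k (Ordinal jl))).
  rewrite (tnth_nth x0) nth_cat size_take sk /= /bump nth_drop.
  case: ltnP => kj; first by rewrite nth_take.
  by congr (nth _ _ _); lia.
by rewrite -(tnth_nth x0 _ (Ordinal jl)) tnth_mktuple.
Qed.

Section Components.
Variables (K : fieldType) (n l : nat) (beta : l.-tuple 'I_n.-1).
Hypothesis charK : [pchar K] =i pred0.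

Definition removable_letter (t : 'I_l) := demazure (remove_letter t beta) = demazure beta.

Lemma wall_removable t F : wall (K := K) beta t F -> removable_letter t.
Proof.
rewrite /removable_letter; case: l beta t F => [|l'] b t F; first by case: t.
move=> [BF st]; have [g [<- gE]] := remove_letter_tuple b t.
exact: (stationary_demazure gE BF st).
Qed.

Lemma wall_irreducible t : removable_letter t -> irreducible_set (wall (K := K) beta t).
Proof.
rewrite /removable_letter; case: l beta t => [|l'] b t; first by case: t.
have [g [<- gE]] := remove_letter_tuple b t => rm.
exact: removable_wall_irreducible gE rm charK.
Qed.

Lemma wall_generic t : removable_letter t -> exists2 F, wall (K := K) beta t F &
  forall s, s != t -> flag_before F s <> flag_after F s.
Proof.
rewrite /removable_letter; case: l beta t => [|l'] b t; first by case: t.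
have [g [<- gE]] := remove_letter_tuple b t => rm.
exact: removable_wall_generic gE rm charK.
Qed.

Lemma wall_subset_eq t s : removable_letter t ->
  wall (K := K) beta t `<=` wall beta s -> s = t.
Proof.
move=> /wall_generic[F WF gen] sub; apply/eqP/negPn/negP => /gen; apply.
by case: (sub _ WF).
Qed.

(** An irreducible subset of the boundary lies in a nonempty wall; nonempty walls
    are irreducible, and none contains another one. *)
Lemma boundary_components (Z : set (flags_cspace K n l.+1)) :
  irreducible_component (boundary beta) Z <->
  exists2 t, removable_letter t & Z = wall beta t.
Proof.
have wb t : wall (K := K) beta t `<=` boundary beta.
  by move=> F [BF st]; split=> //; exists t.
have in_wall Z' : irreducible_set Z' -> Z' `<=` boundary beta ->
    exists2 t, removable_letter t & Z' `<=` wall (K := K) beta t.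
  move=> irr sub; have [t tZ] := irreducible_in_wall irr sub.
  by exists t => //; case: irr => -[F /tZ/wall_removable].
split=> [[sub irr max]|[t rt ->]].
  have [t rt tZ] := in_wall _ irr sub.
  by exists t => //; apply/esym/max => //; exact: wall_irreducible.
split=> [||Z' sub irr tZ']; [exact: wb|exact: wall_irreducible|].
have [s rs sZ] := in_wall _ irr sub.
have e : s = t by apply: wall_subset_eq rt _ => F /tZ' /sZ.
by apply/seteqP; split=> //; rewrite -e.
Qed.

End Components.
(** * Projectivity: a Pluecker-Segre embedding of tuples of flags *)

Section Minors.
Variables (K : fieldType) (n : nat).
Implicit Types (A B : 'M[K]_n) (d e : 'I_n.+1) (S : {ffun 'I_n -> 'I_n}).

Definition ord_in d (a : 'I_d) : 'I_n := widen_ord (leq_ord d) a.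

Definition first_cols A d : 'M[K]_(n, d) := \matrix_(r, b) A r (ord_in b).

(** Choices of rows are functions on all of ['I_n], so that their type does not
    depend on [d]; repetitions are allowed. *)
Definition select d m (X : 'M[K]_(n, m)) S : 'M[K]_(d, m) := \matrix_(a, b) X (S (ord_in a)) b.

Definition leading_block A d : 'M[K]_d := \matrix_(a, b) A (ord_in a) (ord_in b).

Definition replace S (c r : 'I_n) : {ffun 'I_n -> 'I_n} := [ffun y => if y == c then r else S y].

Lemma ord_in_inj d : injective (@ord_in d).
Proof. by move=> a b /(congr1 val) /= /val_inj. Qed.

Lemma select_mul d m k (X : 'M[K]_(n, m)) (Y : 'M[K]_(m, k)) S :
  select d (X *m Y) S = select d X S *m Y.
Proof. by apply/matrixP => a b; rewrite !mxE; apply: eq_bigr => c _; rewrite mxE. Qed.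

(** Cramer's rule for a rectangular matrix normalized on the rows [S]. *)
Lemma normalized_entry d (X : 'M[K]_(n, d)) S r (a : 'I_d) :
  select d X S \in unitmx ->
  (X *m invmx (select d X S)) r a =
  \det (select d X (replace S (ord_in a) r)) / \det (select d X S).
Proof.
move=> Qu; set Q := select d X S in Qu *; set Q' := select d X _.
rewrite /invmx Qu -scalemxAr mxE mulrC; congr (_ / _).
rewrite (expand_det_row Q' a) mxE; apply: eq_bigr => c _.
rewrite [Q' _ _]mxE ffunE eqxx; congr (_ * _); rewrite mxE; congr (_ * \det _).
apply/matrixP => i j; rewrite !mxE ffunE (inj_eq (@ord_in_inj d)).
by rewrite eq_sym (negbTE (neq_lift _ _)).
Qed.

Lemma first_cols_mul A B d : upper B -> first_cols (A *m B) d = first_cols A d *m leading_block B d.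
Proof.
move=> uB; apply/matrixP => r b; rewrite !mxE.
rewrite (bigID (fun c : 'I_n => (c < d)%N)) /= [X in _ + X]big1 ?addr0; last first.
  by move=> c; rewrite -leqNgt => dc; rewrite uB ?mulr0 //=; apply: leq_trans (ltn_ord b) dc.
rewrite (eq_bigr (fun c : 'I_d => A r (ord_in c) * B (ord_in c) (ord_in b))); last first.
  by move=> c _; rewrite !mxE.
rewrite (big_ord_narrow (leq_ord d)) /=.
by apply: eq_bigr => c _; congr (A _ _ * B _ _); apply: val_inj.
Qed.

Lemma leading_block_mul A B d : upper A^T -> leading_block (A *m B) d =
  leading_block A d *m leading_block B d.
Proof.
move=> uA; apply/matrixP => r b; rewrite !mxE.
rewrite (bigID (fun c : 'I_n => (c < d)%N)) /= [X in _ + X]big1 ?addr0; last first.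
  move=> c; rewrite -leqNgt => dc; have := uA c (ord_in r); rewrite mxE => ->.
    by rewrite mul0r.
  by apply: leq_trans (ltn_ord r) dc.
rewrite (eq_bigr (fun c : 'I_d => A (ord_in r) (ord_in c) * B (ord_in c) (ord_in b))); last first.
  by move=> c _; rewrite !mxE.
rewrite (big_ord_narrow (leq_ord d)) /=.
by apply: eq_bigr => c _; congr (A _ _ * B _ _); apply: val_inj.
Qed.

Lemma leading_block_upper_unit B d : upper B -> B \in unitmx -> leading_block B d \in unitmx.
Proof.
move=> uB Bu; rewrite -unitmx_tr unitmxE unitfE det_trig; last first.
  by apply/is_trig_mxP => a b ab; rewrite !mxE uB.
rewrite prodf_seq_neq0; apply/allP => a _ /=.
by rewrite !mxE upper_diag_neq0.
Qed.

Lemma leading_block_tr A d : leading_block A^T d = (leading_block A d)^T.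
Proof. by apply/matrixP => a b; rewrite !mxE. Qed.

Lemma first_cols_sub A d e (de : (d <= e)%N) :
  first_cols A d = first_cols A e *m \matrix_(a, b) ((a : nat) == b)%:R.
Proof.
apply/matrixP => r b; rewrite !mxE (bigD1 (widen_ord de b)) //= big1 ?addr0 => [|c cb].
  by rewrite !mxE eqxx mulr1; congr (A _ _); apply: val_inj.
by rewrite !mxE (_ : (c : nat) == b = false) ?mulr0 //; apply/negbTE; rewrite -val_eqE in cb.
Qed.

(** The row permutation of an LUP decomposition; the leading blocks of [L U] are
    products of triangular ones. *)
Lemma leading_minors_neq0 A : A \in unitmx -> exists s : 'S_n,
  forall d, select d (first_cols A d) (finfun s) \in unitmx.
Proof.
move=> Au; have [s sP] : exists s : 'S_n, exists LU : 'M[K]_n * 'M[K]_n,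
    [/\ upper LU.1^T, upper LU.2 & perm_mx s *m A = LU.1 *m LU.2].
  case: n A Au => [|n'] A Au.
    by exists 1%g, (1%:M, 1%:M); split=> [[]|[]|] //; apply/matrixP => -[].
  have := cormen_lup_correct A; have := @cormen_lup_lower _ _ A; have := @cormen_lup_upper _ _ A.
  have /is_perm_mxP[s] := cormen_lup_perm A.
  case: (cormen_lup A) => -[P L] U /= -> uU lL eA; exists s, (L, U); split=> //.
  by move=> a b ba; rewrite mxE lL ?(ltnW ba) //; case: eqP => // e; move: ba; rewrite e ltnn.
have [[L U] /= [uL uU e]] := sP; exists s => d.
have LUu : L *m U \in unitmx by rewrite -e unitmx_mul unitmx_perm.
have /andP[Lu Uu] : (L \in unitmx) && (U \in unitmx) by rewrite -unitmx_mul.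
have -> : select d (first_cols A d) (finfun s) = leading_block (L *m U) d.
  by apply/matrixP => a b; rewrite -e [RHS]mxE mul_perm_mxE !mxE ffunE.
rewrite leading_block_mul // unitmx_mul; apply/andP; split; last exact: leading_block_upper_unit.
by rewrite -unitmx_tr -leading_block_tr leading_block_upper_unit ?unitmx_tr.
Qed.

End Minors.

Section Pluecker.
Variables (K : fieldType) (n m : nat).

(** The index set of the Segre product, over all subspaces of all flags of the tuple,
    of the Pluecker coordinates. *)
Definition row_choice := {ffun 'I_m * 'I_n.+1 -> {ffun 'I_n -> 'I_n}}.

Definition pl_dim := #|{: row_choice}|.-1.

Implicit Types (tau : row_choice) (M : 'I_m -> 'M[K]_n) (p : 'rV[K]_pl_dim.+1)
  (x : 'I_m * 'I_n.+1).

Lemma card_row_choice : #|{: row_choice}| = pl_dim.+1.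
Proof. by rewrite prednK //; apply/card_gt0P; exists [ffun=> [ffun y => y]]. Qed.

Definition pl_index tau : 'I_pl_dim.+1 := cast_ord card_row_choice (enum_rank tau).

Definition pl_choice (i : 'I_pl_dim.+1) : row_choice :=
  enum_val (cast_ord (esym card_row_choice) i).

Lemma pl_indexK tau : pl_choice (pl_index tau) = tau.
Proof. by rewrite /pl_choice /pl_index cast_ordK enum_rankK. Qed.

Lemma pl_choiceK i : pl_index (pl_choice i) = i.
Proof. by rewrite /pl_choice /pl_index enum_valK cast_ordKV. Qed.

Definition pl_minor M x (S : {ffun 'I_n -> 'I_n}) : K :=
  \det (select x.2 (first_cols (M x.1) x.2) S).

Definition pl_vec M : 'rV[K]_pl_dim.+1 := \row_i \prod_x pl_minor M x (pl_choice i x).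

Lemma pl_vecE M tau : pl_vec M 0 (pl_index tau) = \prod_x pl_minor M x (tau x).
Proof. by rewrite mxE pl_indexK. Qed.

(** The minors of the subspace of dimension [d] are multiplied by the leading minor of
    size [d] of the upper triangular factor, whichever rows are chosen. *)
Lemma pl_vec_mul M T : (forall j, upper (T j)) -> (forall j, T j \in unitmx) ->
  exists2 c : K, c != 0 & pl_vec (fun j => M j *m T j) = c *: pl_vec M.
Proof.
move=> uT Tu; exists (\prod_(x : 'I_m * 'I_n.+1) \det (leading_block (T x.1) x.2)).
  rewrite prodf_seq_neq0; apply/allP => x _ /=.
  by rewrite -unitfE -unitmxE leading_block_upper_unit.
apply/rowP => i; rewrite !mxE -big_split; apply: eq_bigr => x _ /=.
by rewrite /pl_minor first_cols_mul // select_mul det_mulmx mulrC.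
Qed.

Definition nested_choice (s : 'I_m -> 'S_n) : row_choice := [ffun x => finfun (s x.1)].

Lemma nested_choice_neq0 M : (forall j, M j \in unitmx) ->
  exists s, pl_vec M 0 (pl_index (nested_choice s)) != 0.
Proof.
move=> Mu; have /choice[s sP] := fun j => leading_minors_neq0 (Mu j).
exists s; rewrite pl_vecE prodf_seq_neq0; apply/allP => x _ /=.
by rewrite /pl_minor ffunE -unitfE -unitmxE.
Qed.

Definition change tau x (c r : 'I_n) : row_choice :=
  [ffun y => if y == x then replace (tau x) c r else tau y].

Definition ratio p tau x (c r : 'I_n) : K := p 0 (pl_index (change tau x c r)) / p 0 (pl_index tau).

(** The matrix whose columns span the subspace at [x], normalized to be the
    identity on the rows [tau x], read off from Pluecker coordinates. *)
Definition frame p tau x : 'M[K]_(n, x.2) := \matrix_(r, a) ratio p tau x (ord_in a) r.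

(** In the ratio of two products of minors that differ at [x] only, the other
    factors cancel, and Cramer's rule identifies the ratio that remains. *)
Lemma frame_pl_vec s M tau x : s != 0 -> pl_vec M 0 (pl_index tau) != 0 ->
  let X := first_cols (M x.1) x.2 in
  select x.2 X (tau x) \in unitmx /\
  frame (s *: pl_vec M) tau x = X *m invmx (select x.2 X (tau x)).
Proof.
move=> s0; rewrite pl_vecE prodf_seq_neq0 => /allP h X.
have hx y : pl_minor M y (tau y) != 0 by apply: h; rewrite mem_index_enum.
have Qu : select x.2 X (tau x) \in unitmx by rewrite unitmxE unitfE; exact: hx.
split=> //; apply/matrixP => r a; rewrite normalized_entry // mxE /ratio.
rewrite mxE [X in _ / X]mxE !pl_vecE (bigD1 x) //= [in X in _ / X](bigD1 x) //=.
rewrite (eq_bigr (fun y => pl_minor M y (tau y))); last first.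
  by move=> y /negbTE yx; rewrite ffunE yx.
rewrite ffunE eqxx; set P := \prod_(y | _) _.
have P0 : P != 0.
  by rewrite prodf_seq_neq0; apply/allP => y _; rewrite hx implybT.
have := hx x; rewrite /pl_minor -/X => dx.
by rewrite -mulf_div divff // mul1r -mulf_div divff // mulr1.
Qed.

Definition eq_minors p tau tau' :=
  p 0 (pl_index tau') - p 0 (pl_index tau) * \prod_x \det (select x.2 (frame p tau x) (tau' x)).

Definition eq_incidence p tau (j : 'I_m) (d e : 'I_n.+1) : 'M[K]_(n, d) :=
  frame p tau (j, d) - frame p tau (j, e) *m select e (frame p tau (j, d)) (tau (j, e)).

Lemma pl_vec_equations s M tau : s != 0 -> pl_vec M 0 (pl_index tau) != 0 ->
  (forall tau', eq_minors (s *: pl_vec M) tau tau' = 0) /\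
  (forall j (d e : 'I_n.+1), (d <= e)%N -> eq_incidence (s *: pl_vec M) tau j d e = 0).
Proof.
move=> s0 M0; split=> [tau'|j d e de].
  rewrite /eq_minors mxE [X in _ - X * _]mxE !pl_vecE.
  rewrite -mulrA -big_split /= -mulrBr; apply/eqP; rewrite mulf_eq0 subr_eq0; apply/orP; right.
  apply/eqP/eq_bigr => x _; have [Qu ->] := frame_pl_vec x s0 M0.
  rewrite select_mul det_mulmx det_inv mulrCA /pl_minor mulfV ?mulr1 //.
  by rewrite -unitfE -unitmxE.
rewrite /eq_incidence; have [Qd ->] := frame_pl_vec (j, d) s0 M0.
have [Qe ->] := frame_pl_vec (j, e) s0 M0.
apply/eqP; rewrite subr_eq0; apply/eqP; move: Qd Qe => /=.
rewrite (first_cols_sub (M j) de) !select_mul => _ Qe.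
by rewrite -[RHS]mulmxA (mulmxA (invmx _)) mulKmx // mulmxA.
Qed.

(** The first equation, at [tau] itself, makes the selected blocks of the frames
    invertible, so the frames have full rank; the second nests their spans
    into flags; and the first says that the minors of the frames are the
    given coordinates. *)
Lemma equations_pl_vec p tau : p 0 (pl_index tau) != 0 ->
  (forall tau', eq_minors p tau tau' = 0) ->
  (forall j (d e : 'I_n.+1), (d <= e)%N -> eq_incidence p tau j d e = 0) ->
  exists M, exists2 s : K, s != 0 & (forall j, M j \in unitmx) /\ p = s *: pl_vec M.
Proof.
move=> p0 eqm eqi.
pose N x := frame p tau x.
have eqm' tau' : p 0 (pl_index tau') =
    p 0 (pl_index tau) * \prod_x \det (select x.2 (N x) (tau' x)).
  by apply/eqP; rewrite -subr_eq0; apply/eqP; exact: eqm.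
have Qu x : select x.2 (N x) (tau x) \in unitmx.
  have /eqP := eqm' tau; rewrite -{1}[p 0 _]mulr1 (inj_eq (mulfI p0)) eq_sym => /eqP e1.
  have : \prod_y \det (select y.2 (N y) (tau y)) != 0 by rewrite e1 oner_eq0.
  by rewrite prodf_seq_neq0 unitmxE unitfE => /allP; apply; rewrite mem_index_enum.
pose F j : subspaces K n :=
  [ffun d : 'I_n.+1 => <<[seq col k (N (j, d)) | k <- enum 'I_d & predT k]>>%VS].
have FP j (d : 'I_n.+1) v : v \in F j d <-> exists z : 'cV[K]_d, v = N (j, d) *m z.
  by rewrite ffunE span_colsP; split=> [[z _ ->]|[z ->]]; exists z.
have flagF j : is_flag (F j).
  split=> [d|d e de].
    apply/eqP; rewrite eqn_leq; apply/andP; split.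
      by rewrite ffunE; apply: leq_trans (dim_span_cols _ _) _; rewrite card_ord.
    pose P : 'M[K]_(d, n) := \matrix_(a, r) (r == tau (j, d) (ord_in a))%:R.
    have PN (v : 'cV[K]_n) : P *m v = select d v (tau (j, d)).
      apply/matrixP => a b; rewrite !mxE (bigD1 (tau (j, d) (ord_in a))) //= big1 ?addr0.
        by rewrite mxE eqxx mul1r.
      by move=> r /negbTE ra; rewrite mxE ra mul0r.
    pose f : 'Hom('cV[K]_n, 'cV[K]_d) := linfun (mulmx P).
    have : (fullv <= f @: F j d)%VS.
      apply/subvP => w _; apply/memv_imgP.
      exists (N (j, d) *m (invmx (select d (N (j, d)) (tau (j, d))) *m w)).
        by apply/FP; eexists; reflexivity.
      by rewrite lfunE /= PN select_mul mulKVmx // (Qu (j, d)).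
    move=> /dimvS; rewrite dimvf /dim /= muln1 => h; apply: leq_trans h _.
    by rewrite -(limg_ker_dim f (F j d)) leq_addl.
  apply/subvP => v /FP[z ->]; apply/FP.
  exists (select e (N (j, d)) (tau (j, e)) *m z); rewrite mulmxA; congr (_ *m _).
  by apply/eqP; rewrite -subr_eq0; apply/eqP; exact: eqi.
have /choice[M MP] : forall j, exists A, A \in unitmx /\ F j = flag_of A.
  by move=> j; have [A Au FA] := flag_matrix (flagF j); exists A.
have /choice[g gP] : forall x : 'I_m * 'I_n.+1, exists g : 'M[K]_n,
    first_cols (M x.1) x.2 = N x *m leading_block g x.2 /\ leading_block g x.2 \in unitmx.
  case=> j d /=; have [Mu FM] := MP j.
  have /choice[y yP] : forall b : 'I_d, exists y : 'cV_d, col (ord_in b) (M j) = N (j, d) *m y.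
    move=> b; apply/FP; rewrite FM ffunE; apply: memv_span; apply/mapP.
    by exists (ord_in b); rewrite // mem_filter mem_enum /= ltn_ord.
  pose g0 : 'M[K]_d := \matrix_(a, b) y b a 0.
  (* The block [g0] padded by zeros, so that the type of [g] does not depend on [d]. *)
  exists (\matrix_(a, b) if insub (a : nat) is Some a' then
    if insub (b : nat) is Some b' then g0 a' b' else 0 else 0).
  have -> : leading_block (\matrix_(a, b) if insub (a : nat) is Some a' then
    if insub (b : nat) is Some b' then g0 a' b' else 0 else 0) d = g0.
    by apply/matrixP => a b; rewrite 2!mxE /= !valK.
  have e : first_cols (M j) d = N (j, d) *m g0.
    apply/matrixP => r b; rewrite mxE; have /(congr1 (fun v : 'cV_n => v r 0)) := yP b.
    by rewrite !mxE => ->; apply: eq_bigr => a _; rewrite [g0 _ _]mxE.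
  split=> //; pose Y : 'M[K]_(d, n) := \matrix_(a, r) invmx (M j) (ord_in a) r.
  have : (Y *m N (j, d)) *m g0 = 1%:M.
    rewrite -mulmxA -e; apply/matrixP => a b.
    have := congr1 (fun A : 'M_n => A (ord_in a) (ord_in b)) (mulVmx Mu).
    rewrite !mxE (inj_eq (@ord_in_inj n d)) => <-.
    by apply: eq_bigr => r _; rewrite !mxE.
  by move=> /mulmx1_unit[].
pose c := \prod_(x : 'I_m * 'I_n.+1) \det (leading_block (g x) x.2).
have c0 : c != 0.
  rewrite prodf_seq_neq0; apply/allP => x _ /=; rewrite -unitfE -unitmxE.
  by case: (gP x).
exists M, (p 0 (pl_index tau) / c); first by rewrite mulf_neq0 ?invr_eq0.
split=> [j|]; first by case: (MP j).
apply/rowP => i; rewrite -(pl_choiceK i) [RHS]mxE pl_vecE eqm' -mulrA; congr (_ * _).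
apply: (mulfI c0); rewrite mulVKf // -big_split; apply: eq_bigr => x _ /=.
by rewrite /pl_minor; have [-> _] := gP x; rewrite select_mul det_mulmx mulrC.
Qed.

(** The matrices with [1] at the pivots [s j b] and [0] above them in the order
    of [s j], read off from Pluecker coordinates. *)
Definition pl_section p (s : 'I_m -> 'S_n) (j : 'I_m) : 'M[K]_n :=
  \matrix_(r, b) ratio p (nested_choice s) (j, lift ord0 b) b r.

Lemma pl_sectionP c M s j : c != 0 -> M j \in unitmx ->
  pl_vec M 0 (pl_index (nested_choice s)) != 0 ->
  let A := pl_section (c *: pl_vec M) s j in
  A \in unitmx /\ flag_of A = flag_of (M j).
Proof.
move=> c0 Mu M0 A.
pose last (b : 'I_n) : 'I_(lift ord0 b : 'I_n.+1) := Ordinal (ltnSn b).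
have lastE b : ord_in (last b) = b by apply: val_inj.
have AE r b : A r b = frame (c *: pl_vec M) (nested_choice s) (j, lift ord0 b) r (last b).
  by rewrite !mxE lastE.
have Fr (b : 'I_n) := frame_pl_vec (j, lift ord0 b) c0 M0.
have piv (a b : 'I_n) : (a <= b)%N -> A (s j a) b = (a == b)%:R.
  move=> ab; have [Qu fE] := Fr b.
  have hab : (a < (lift ord0 b : 'I_n.+1))%N by rewrite lift0.
  pose a' : 'I_(lift ord0 b : 'I_n.+1) := Ordinal hab.
  have -> : A (s j a) b = select (lift ord0 b) (frame (c *: pl_vec M) (nested_choice s) (j, lift ord0 b))
      (nested_choice s (j, lift ord0 b)) a' (last b).
    by rewrite AE [RHS]mxE !ffunE; congr (frame _ _ _ (s j _) _); apply: val_inj.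
  by rewrite fE select_mul mulmxV // mxE.
have Au : A \in unitmx.
  have : perm_mx (s j) *m A \in unitmx.
    rewrite unitmxE unitfE det_trig; last first.
      apply/is_trig_mxP => a b ab; rewrite mul_perm_mxE piv ?(ltnW ab) //.
      by case: eqP => // e; move: ab; rewrite e ltnn.
    rewrite prodf_seq_neq0; apply/allP => a _ /=.
    by rewrite mul_perm_mxE piv // eqxx oner_eq0.
  by rewrite unitmx_mul unitmx_perm.
split=> //; apply/esym/flag_of_eq => // a b ba.
have [Qu fE] := Fr b.
have : col b A \in flag_of (M j) (lift ord0 b).
  apply/flag_ofP; pose z := col (last b) (invmx (select (lift ord0 b)
    (first_cols (M j) (lift ord0 b)) (nested_choice s (j, lift ord0 b)))).
  exists (\col_k if insub (k : nat) is Some k' then z k' 0 else 0).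
    by move=> k bk; rewrite mxE insubF // ltnNge bk.
  apply/colP => r; rewrite mxE AE fE !mxE.
  rewrite [RHS](bigID (fun k : 'I_n => (k < (lift ord0 b : 'I_n.+1))%N)) /= [X in _ + X]big1 ?addr0.
    rewrite (big_ord_narrow (leq_ord (lift ord0 b : 'I_n.+1))) /=.
    by apply: eq_bigr => k _; rewrite !mxE /= valK mxE.
  by move=> k nk; rewrite mxE insubF ?mulr0 //; apply/negbTE.
move=> /flag_of_unitP-/(_ Mu a); rewrite lift0 ba => /(_ isT); rewrite !mxE => z; rewrite -[RHS]z.
by apply: eq_bigr => k _; rewrite !mxE.
Qed.

End Pluecker.
Section Embedding.
Variables (K : fieldType) (n m : nat).

Let N := pl_dim n m.

Lemma proj_movable r : movable (proj_cspace K r).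
Proof.
move=> L w w' [w0 Lw] [w'0 Lw'].
have /vlineP[c cw] : w' \in <[w]>%VS by rewrite -Lw Lw' memv_line.
have c0 : c != 0 by apply: contraNneq w'0 => c0; rewrite cw c0 scale0r.
exists (fun u => c *: u); split=> //.
  move=> z u [u0 zu]; split; first by rewrite scaler_eq0 (negbTE c0).
  rewrite zu; apply/eqP; rewrite eqEsubv -!memvE memvZ ?memv_line // andbT.
  by apply/vlineP; exists c^-1; rewrite scalerA mulVf // scale1r.
by move=> i; exists (c%:MP * 'X_i) => u; rewrite mxE pevalM pevalC pevalX.
Qed.

Lemma proj_has_coord r (Y : set (proj_cspace K r)) : Y `<=` proj_space K r -> has_coord Y.
Proof.
move=> sub L /sub L1; exists (vpick L); split.
  by rewrite vpick0 -dimv_eq0 (L1 : \dim L = 1%N).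
apply/eqP; rewrite eq_sym eqEdim -memvE memv_pick dim_vline (L1 : \dim L = 1%N).
by rewrite vpick0 -dimv_eq0 (L1 : \dim L = 1%N).
Qed.

Definition pl_map (F : flags_cspace K n m) : proj_cspace K N :=
  <[pl_vec (mats (xget (0%R : 'rV[K]_(ncoord (flags_cspace K n m))) [set v | coord F v]))]>%VS.

Lemma pl_vec_neq0 (M : 'I_m -> 'M[K]_n) : (forall j, M j \in unitmx) -> pl_vec M != 0.
Proof.
move=> Mu; have [s] := nested_choice_neq0 Mu; apply: contraNneq => ->.
by rewrite mxE.
Qed.

Lemma pl_map_coord (F : flags_cspace K n m) v : coord F v -> coord (pl_map F) (pl_vec (mats v)).
Proof.
move=> Fv; have Fv' : coord F (xget (0%R : 'rV[K]_(ncoord (flags_cspace K n m))) [set v | coord F v]).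
  by apply: (@xgetPex _ _ [set v | coord F v]); exists v.
rewrite /pl_map; set v' := xget _ _ in Fv' *.
have /flags_coordP[Mu FM] := Fv; have /flags_coordP[Mu' FM'] := Fv'.
pose T j := invmx (mats v j) *m mats v' j.
have Tu j : T j \in unitmx by rewrite unitmx_mul unitmx_inv Mu Mu'.
have uT j : upper (T j) by apply/flag_of_eq => //; rewrite -FM -FM'.
have [c c0 e] := pl_vec_mul (mats v) uT Tu.
have e' : pl_vec (mats v') = c *: pl_vec (mats v).
  by rewrite -e; congr pl_vec; apply: boolp.funext => j; rewrite /T mulKVmx.
split; first exact: pl_vec_neq0.
rewrite e'; apply/eqP; rewrite eqEsubv -!memvE memvZ ?memv_line //=.
by apply/vlineP; exists c^-1; rewrite scalerA mulVf // scale1r.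
Qed.

Lemma coord_pl_map (F : flags_cspace K n m) v p : coord F v -> coord (pl_map F) p ->
  exists2 c : K, c != 0 & p = c *: pl_vec (mats v).
Proof.
move=> /pl_map_coord[_ Fv] [p0 Fp].
have /vlineP[c cp] : p \in <[pl_vec (mats v)]>%VS by rewrite -Fv Fp memv_line.
by exists c => //; apply: contraNneq p0 => c0; rewrite cp c0 scale0r.
Qed.

Definition pl_image : set (proj_cspace K N) := pl_map @` flags K n m.

Lemma pl_image_proj : pl_image `<=` proj_space K N.
Proof.
move=> L [F fF <-]; have [v Fv] := flags_has_coord (@subset_refl _ _) fF.
have [p0 ->] := pl_map_coord Fv.
by rewrite /proj_space /= dim_vline p0.
Qed.

Lemma pl_map_section (F : flags_cspace K n m) p s :
  flags K n m F -> coord (pl_map F) p -> p 0 (pl_index (nested_choice s)) != 0 ->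
  coord F (of_mats (pl_section p s)).
Proof.
move=> fF Fp ps; have [v Fv] := flags_has_coord (@subset_refl _ _) fF.
have [c c0 ep] := coord_pl_map Fv Fp; have /flags_coordP[Mu FM] := Fv.
have M0 : pl_vec (mats v) 0 (pl_index (nested_choice s)) != 0.
  by apply: contraNneq ps => z; rewrite ep mxE z mulr0.
by apply: coord_of_mats => j; rewrite ep; have [h1 h2] := pl_sectionP c0 (Mu j) M0; rewrite ?FM ?h2.
Qed.

(** A flag is recovered from its Pluecker coordinates by the section at a nested
    choice of rows. *)
Lemma pl_map_inj (F F' : flags_cspace K n m) :
  flags K n m F -> flags K n m F' -> pl_map F = pl_map F' -> F = F'.
Proof.
move=> fF fF' e; have [v Fv] := flags_has_coord (@subset_refl _ _) fF.
have /flags_coordP[Mu _] := Fv; have [s sn] := nested_choice_neq0 Mu.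
have Fp := pl_map_coord Fv; have Fp' := Fp; rewrite e in Fp'.
have /flags_coordP[_ h] := pl_map_section fF Fp sn.
have /flags_coordP[_ h'] := pl_map_section fF' Fp' sn.
by apply/ffunP => j; rewrite h h'.
Qed.

Lemma rat_ratio (S : set 'rV[K]_N.+1) v tau x c r : S v -> v 0 (pl_index tau) != 0 ->
  rat_at S v (fun p => ratio p tau x c r).
Proof. by move=> Sv v0; apply: rat_atM (rat_atV Sv _ v0); exact: rat_at_coord. Qed.

Lemma rat_frame (S : set 'rV[K]_N.+1) v tau x : S v -> v 0 (pl_index tau) != 0 ->
  rat_mx S v (fun p => frame p tau x).
Proof.
move=> Sv v0 r a; apply: rat_at_ext (rat_ratio x (ord_in a) r Sv v0) => p.
by rewrite [RHS]mxE.
Qed.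

Lemma rat_select M' (S : set 'rV[K]_M') v d k (X : 'rV[K]_M' -> 'M[K]_(n, k)) f :
  rat_mx S v X -> rat_mx S v (fun p => select d (X p) f).
Proof. by move=> rX a b; apply: rat_at_ext (rX (f (ord_in a)) b) => p; rewrite [RHS]mxE. Qed.

(** A point outside of the image violates one of the equations at some nonzero
    coordinate [tau]. The factor [u 0 (pl_index tau)] makes the violated
    equation valid at all points of the image, also at those whose coordinate
    [tau] is zero. *)
Lemma pl_image_closed : zclosed (proj_space K N) pl_image.
Proof.
apply: zclosed_rat => [|L v PL nL Lv]; first exact: pl_image_proj.
have [v0 eL] := Lv.
have [tau vt] : exists tau, v 0 (pl_index tau) != 0.
  have /rV0Pn[i vi] := v0; by exists (pl_choice i); rewrite pl_choiceK.
have Sv : coord_set (proj_space K N) v by exists L.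
have imageE u : coord_set pl_image u -> u 0 (pl_index tau) != 0 ->
    (forall tau', eq_minors u tau tau' = 0) /\
    (forall j (d e : 'I_n.+1), (d <= e)%N -> eq_incidence u tau j d e = 0).
  move=> [z [F fF <-] Fu] ut; have [w Fw] := flags_has_coord (@subset_refl _ _) fF.
  have [c c0 eu] := coord_pl_map Fw Fu; rewrite eu; apply: pl_vec_equations => //.
  by apply: contraNneq ut => z0; rewrite eu mxE z0 mulr0.
have rt : rat_at (coord_set (proj_space K N)) v (fun u => u 0 (pl_index tau)).
  exact: rat_at_coord.
have rF x := @rat_frame _ _ _ x Sv vt.
case: (pselect (forall tau', eq_minors v tau tau' = 0)) => [h1|/existsNP[tau' /eqP ne]]; last first.
  exists (fun u : 'rV[K]_N.+1 => u 0 (pl_index tau) * eq_minors u tau tau'); split.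
  - apply: (rat_atM rt); apply: rat_atB; first exact: rat_at_coord.
    apply: (rat_atM rt); apply: rat_at_prod => x; apply: rat_at_det.
    exact: rat_select.
  - by rewrite mulf_neq0.
  - move=> u Zu; case: (eqVneq (u 0 (pl_index tau)) 0) => [->|ut]; first by rewrite mul0r.
    by have [-> _] := imageE u Zu ut; rewrite mulr0.
case: (pselect (forall j (d e : 'I_n.+1), (d <= e)%N -> eq_incidence v tau j d e = 0)).
  move=> h2; have [M [c c0 [Mu ev]]] := equations_pl_vec vt h1 h2.
  case: nL; pose F : flags_cspace K n m := [ffun j => flag_of (M j)].
  have Fc : coord F (of_mats M) by apply: coord_of_mats => // j; rewrite ffunE.
  exists F; first exact: coord_flags Fc.
  have [_ ->] := pl_map_coord Fc; rewrite eL ev.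
  have -> : mats (of_mats M) = M by apply: boolp.funext => j; rewrite of_matsK.
  apply/eqP; rewrite eqEsubv -!memvE memvZ ?memv_line // andbT.
  by apply/vlineP; exists c^-1; rewrite scalerA mulVf // scale1r.
move=> /existsNP[j /existsNP[d /existsNP[e /not_implyP[de /eqP ne]]]].
have [r [a ra]] : exists r a, eq_incidence v tau j d e r a != 0.
  apply: contrapT => /forallNP h; move/eqP: ne; apply; apply/matrixP => r a.
  by rewrite [RHS]mxE; have /forallNP/(_ a)/negP/negPn/eqP := h r.
exists (fun u : 'rV[K]_N.+1 => u 0 (pl_index tau) * eq_incidence u tau j d e r a); split.
- apply: (rat_atM rt).
  have rS : rat_mx (coord_set (proj_space K N)) v (fun u => frame u tau (j, e) *m
      select e (frame u tau (j, d)) (tau (j, e))).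
    by apply: rat_mxM; [exact: rF|apply: rat_select; exact: rF].
  by apply: rat_at_ext (rat_atB (rF (j, d) r a) (rS r a)) => u; rewrite [RHS]mxE [X in _ = _ + X]mxE.
- by rewrite mulf_neq0.
- move=> u Zu; case: (eqVneq (u 0 (pl_index tau)) 0) => [->|ut]; first by rewrite mul0r.
  by have [_ ->] := imageE u Zu ut; rewrite // mxE mulr0.
Qed.

Definition pl_inv (L : proj_cspace K N) : flags_cspace K n m :=
  xget ([ffun=> [ffun=> 0%VS]] : {ffun 'I_m -> subspaces K n})
    [set F : {ffun 'I_m -> subspaces K n} | flags K n m F /\ pl_map F = L].

Lemma pl_mapK F : flags K n m F -> pl_inv (pl_map F) = F.
Proof.
move=> fF; have [] : flags K n m (pl_inv (pl_map F)) /\ pl_map (pl_inv (pl_map F)) = pl_map F.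
  apply: (@xgetPex _ _ [set F' : {ffun 'I_m -> subspaces K n} |
    flags K n m F' /\ pl_map F' = pl_map F]).
  by exists F.
by move=> fG /pl_map_inj; apply.
Qed.

Lemma pl_map_rat (Y : set (flags_cspace K n m)) : rat_map Y pl_map.
Proof.
apply: rat_map_movable => [|F v YF Fv]; first exact: proj_movable.
exists (fun u => pl_vec (mats u)).
  move=> z i; apply: (@rat_at_ext _ _ _ _ (fun u => \prod_x pl_minor (mats u) x (pl_choice i x))).
    by move=> u; rewrite (ord1 z) [RHS]mxE.
  apply: rat_at_prod => x; apply: rat_at_det; apply: rat_select => r b.
  have rM := rat_mats x.1 (rat_id (coord_set Y) v).
  by apply: rat_at_ext (rM r (ord_in b)) => u; rewrite [RHS]mxE.
by apply: znearT => u _ z _; exact: pl_map_coord.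
Qed.

Lemma pl_inv_rat : rat_map pl_image pl_inv.
Proof.
apply: rat_map_movable => [|L p ZL Lp]; first exact: flags_movable.
have [F fF eF] := ZL; rewrite -eF in Lp.
have [v Fv] := flags_has_coord (@subset_refl _ _) fF; have /flags_coordP[Mu _] := Fv.
have [s sn] := nested_choice_neq0 Mu.
have [c c0 ep] := coord_pl_map Fv Lp.
have ps : p 0 (pl_index (nested_choice s)) != 0 by rewrite ep mxE mulf_neq0.
have Sp : coord_set pl_image p by exists L; rewrite // -eF.
exists (fun u : 'rV[K]_N.+1 => of_mats (pl_section u s)).
  apply: rat_of_mats => j r b.
  by apply: rat_at_ext (rat_ratio (j, lift ord0 b) b r Sp ps) => u; rewrite [RHS]mxE.
apply: znear_imp (rat_at_neq0 Sp (rat_at_coord _ _ _) ps) => u Su us z [G fG <-] Gu.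
by rewrite pl_mapK //; exact: pl_map_section.
Qed.

(** The image of [Y] is the preimage of [Y] under the inverse of the embedding, hence
    closed in the closed image of all tuples of flags. *)
Lemma flags_closed_projective (Y : set (flags_cspace K n m)) :
  zclosed (flags K n m) Y -> projective Y.
Proof.
move=> cY; have [sY _] := cY.
exists N, (pl_map @` Y), pl_map; split.
  apply: (zclosed_trans pl_image_closed).
  have [_ cl _] : regular_map pl_image (flags K n m) pl_inv.
    apply: rat_map_regular => [|||]; last exact: pl_inv_rat.
    - by apply: proj_has_coord; exact: pl_image_proj.
    - exact: flags_has_coord.
    - by move=> L [F fF <-]; rewrite pl_mapK.
  suff -> : pl_map @` Y = pl_image `&` pl_inv @^-1` Y by exact: cl.
  apply/seteqP; split=> L => [[F YF <-]|[[F fF <-]]].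
    by split; [exists F => //; exact: sY|rewrite /preimage /= pl_mapK //; exact: sY].
  by rewrite /preimage /= pl_mapK // => YF; exists F.
apply: (@rat_map_iso _ _ _ _ _ _ pl_inv).
- exact: flags_has_coord.
- by apply: proj_has_coord => L [F YF <-]; apply: pl_image_proj; exists F => //; exact: sY.
- by move=> F YF; exists F.
- by move=> L [F YF <-]; rewrite pl_mapK //; exact: sY.
- by move=> F YF; rewrite pl_mapK //; exact: sY.
- by move=> L [F YF <-]; rewrite pl_mapK //; exact: sY.
- exact: pl_map_rat.
- apply: rat_map_subset pl_inv_rat => L [F YF <-]; exists F => //; exact: sY.
Qed.

End Embedding.
(** * The parametrization by the braid variety *)

Section Parametrization.
Variables (K : fieldType) (n l : nat) (beta : l.-tuple 'I_n.-1).

(** Relative positions are entries of products of coordinate matrices and their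
    inverses. *)
Lemma brick_closed : zclosed (flags K n l.+1) (brick K beta).
Proof.
apply: zclosed_rat => [|F v fF nB Fv]; first exact: brick_flags.
have Sv : coord_set (flags K n l.+1) v by exists F.
have rM j : rat_mx (coord_set (flags K n l.+1)) v (fun w => mats w j : 'M[K]_n).
  by apply: rat_mats; exact: rat_id.
have /flags_coordP[Mu FM] := Fv.
have closedP u : coord_set (brick K beta) u ->
    [/\ upper (mats u ord0 : 'M[K]_n),
        forall t, in_parabolic (tnth beta t) (rel_mx (mats u : 'I_l.+1 -> 'M[K]_n) t)
      & upper (perm_mx (demazure beta)^-1%g *m mats u ord_max : 'M[K]_n)].
  move=> [G BG /flags_coordP[Gu GM]]; have [BSG uG] := (brickP beta Gu GM).1 BG.
  by have [u0 pG] := (bott_samelsonP beta Gu GM).1 BSG.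
case: (pselect (upper (mats v ord0 : 'M[K]_n))) => [h1|]; last first.
  move=> /existsNP[a /existsNP[b /not_implyP[ba /eqP ne]]].
  exists (fun u => (mats u ord0 : 'M[K]_n) a b); split=> //; first exact: rM.
  by move=> u /closedP[h _ _]; exact: h.
case: (pselect (forall t, in_parabolic (tnth beta t) (rel_mx (mats v : 'I_l.+1 -> 'M[K]_n) t))).
  move=> h2.
  case: (pselect (upper (perm_mx (demazure beta)^-1%g *m mats v ord_max : 'M[K]_n))) => [h3|].
    by case: nB; apply/(brickP beta Mu FM); split=> //; apply/(bott_samelsonP beta Mu FM).
  move=> /existsNP[a /existsNP[b /not_implyP[ba /eqP ne]]].
  exists (fun u => (perm_mx (demazure beta)^-1%g *m mats u ord_max : 'M[K]_n) a b); split=> //.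
    have r : rat_mx (coord_set (flags K n l.+1)) v
        (fun u => perm_mx (demazure beta)^-1%g *m mats u ord_max : 'M[K]_n).
      by apply: rat_mxM (rM _); exact: rat_mx_cst.
    exact: r.
  by move=> u /closedP[_ _ h]; exact: h.
move=> /existsNP[t /existsNP[a /existsNP[b /not_implyP[ba /not_implyP[nab /eqP ne]]]]].
exists (fun u => rel_mx (mats u : 'I_l.+1 -> 'M[K]_n) t a b); split=> //.
  have r : rat_mx (coord_set (flags K n l.+1)) v
      (fun u => rel_mx (mats u : 'I_l.+1 -> 'M[K]_n) t).
    by apply: rat_mxM (rM _); apply: rat_mxV.
  exact: r.
by move=> u /closedP[_ h _]; exact: h.
Qed.

(** The sign and the reversal that compare the coordinates of the braid variety
    with those of the chart in which every flag moves. *)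
Definition braid_coord (z : 'rV[K]_l) : 'rV[K]_l := \row_t - z 0 (rev_ord t).

Lemma braid_coordK : involutive braid_coord.
Proof. by move=> z; apply/rowP => t; rewrite !mxE rev_ordK opprK. Qed.

Lemma braid_genE (i : 'I_n.-1) (x : K) : braid_gen i x = chart_step_inv i true (- x).
Proof.
rewrite /chart_step_inv opprK mulmxDl mul1mx -scalemxAl; congr (_ + _ *: _).
apply/matrixP => a b; rewrite [RHS]mxE (bigD1 (strand_lo i)) //= big1 ?addr0.
  rewrite !mxE eqxx andbT /simple_refl tpermL (eq_sym b).
  by case: (a == _); case: (_ == b); rewrite ?mulr0 ?mul0r ?mulr1.
by move=> c /negbTE cl; rewrite mxE cl andbF mul0r.
Qed.

Lemma braid_mx_chart (z : affine_space K l) : forall j : 'I_l.+1,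
  braid_mx (rev (take j beta)) (drop (l - j) (coords z)) =
  invmx (chart_mx beta (fun=> true) (braid_coord z) j).
Proof.
pose P j := braid_mx (rev (take j beta)) (drop (l - j) (coords z)) =
  invmx (chart_mx beta (fun=> true) (braid_coord z) j).
have szc : size (coords z) = l by rewrite size_map size_enum_ord.
apply: (@position_ind l P) => [|t IH]; rewrite /P.
  by rewrite take0 subn0 drop_oversize ?szc // /braid_mx big_nil invmx1.
have tl : (t < size beta)%N by rewrite size_tuple.
rewrite (take_nth (tnth beta t) tl) -tnth_nth rev_rcons.
have lt : (l - t.+1 < size (coords z))%N by rewrite szc; have := ltn_ord t; lia.
rewrite (drop_nth 0 lt) (_ : (l - t.+1).+1 = (l - t)%N); last by have := ltn_ord t; lia.
have -> : nth 0 (coords z) (l - t.+1) = (z : 'rV[K]_l) 0 (rev_ord t).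
  rewrite (nth_map (rev_ord t)) ?size_enum_ord; last by have := ltn_ord t; lia.
  by rewrite -[(l - t.+1)%N]/(rev_ord t : nat) nth_ord_enum.
rewrite chart_mxS invmxM ?chart_mx_unit ?chart_step_unit // -IH invmx_step mxE -braid_genE.
by rewrite /braid_mx /= big_cons.
Qed.

Lemma ThetaE (z : affine_space K l) : Theta K beta z = chart beta (fun=> true) (braid_coord z).
Proof.
by apply/ffunP => j; rewrite !ffunE braid_mx_chart invmxK.
Qed.

Let X := braid_variety K [tuple of rev beta] (demazure beta).

Lemma braid_varietyP (z : affine_space K l) : X z <-> brick K beta (Theta K beta z).
Proof.
rewrite ThetaE chart_brickP /X /braid_variety /=.
have := braid_mx_chart z ord_max; rewrite /= subnn drop0 take_oversize ?size_tuple // => ->.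
rewrite /last_mx -perm_mx_inv; set C := chart_mx _ _ _ _; set P := perm_mx _.
have Cu : C \in unitmx by exact: chart_mx_unit.
have Pu : P \in unitmx by exact: unitmx_perm.
have uCP : invmx C *m P \in unitmx by rewrite unitmx_mul unitmx_inv Cu.
have e : invmx P *m C = invmx (invmx C *m P) by rewrite invmxM ?unitmx_inv // invmxK.
split=> [/upper_triangularP h|h]; first by rewrite e; exact: upperV.
by apply/upper_triangularP; rewrite -[_ *m _]invmxK -e; apply: upperV; rewrite // e unitmx_inv.
Qed.

(** In the chart of [Theta] no step is stationary. *)
Lemma Theta_open (z : affine_space K l) : X z -> open_brick K beta (Theta K beta z).
Proof.
move=> /braid_varietyP BT; apply: moving_open_brick => // t.
by rewrite ThetaE => /chart_stationary[].
Qed.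

Lemma rat_braid_coord N (S : set 'rV[K]_N) v (g : 'rV[K]_N -> 'rV[K]_l) :
  rat_mx S v g -> rat_mx S v (fun u => braid_coord (g u)).
Proof.
by move=> rg a t; apply: rat_at_ext (rat_atN (rg 0 (rev_ord t))) => u; rewrite [RHS]mxE.
Qed.

Lemma Theta_rat_map (Y : set (affine_space K l)) : rat_map Y (Theta K beta).
Proof.
apply: rat_map_movable => [|z v Yz ->]; first exact: flags_movable.
exists (fun u : 'rV[K]_l =>
  of_mats (fun j : 'I_l.+1 => chart_mx beta (fun=> true) (braid_coord u) j)).
  by apply: rat_of_mats => j; apply: rat_chart_mx; apply: rat_braid_coord; exact: rat_id.
apply: znearT => u _ y _ ->; apply: coord_of_mats => j; first exact: chart_mx_unit.
by rewrite ThetaE chartE.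
Qed.

Lemma Theta_flags (z : affine_space K l) : flags K n l.+1 (Theta K beta z).
Proof. by rewrite ThetaE; apply: bott_samelson_flags; exact: chart_bott_samelson. Qed.

Lemma Theta_regular : regular_map setT (flags K n l.+1) (Theta K beta).
Proof.
apply: rat_map_regular; last exact: Theta_rat_map.
- exact: affine_has_coord.
- exact: flags_has_coord.
- by move=> z _; exact: Theta_flags.
Qed.

Lemma braid_variety_affine : affine_variety X.
Proof.
have [_ cl _] := Theta_regular.
have := cl _ brick_closed; rewrite setTI.
by rewrite (_ : _ @^-1` _ = X) //; apply/seteqP; split=> z /braid_varietyP.
Qed.

Definition Theta_inv (F : flags_cspace K n l.+1) : affine_space K l :=
  braid_coord (chart_inv beta (fun=> true) F).

Lemma ThetaK z : Theta_inv (Theta K beta z) = z.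
Proof. by rewrite ThetaE /Theta_inv chartK braid_coordK. Qed.

Lemma Theta_invK (F : flags_cspace K n l.+1) :
  open_brick K beta F -> Theta K beta (Theta_inv F) = F.
Proof.
by move=> /open_brick_chart[u ->]; rewrite /Theta_inv chartK ThetaE braid_coordK.
Qed.

Lemma Theta_image : Theta K beta @` X = open_brick K beta.
Proof.
apply/seteqP; split=> F; first by move=> [z Xz <-]; exact: Theta_open.
move=> oF; exists (Theta_inv F); last exact: Theta_invK.
by apply/braid_varietyP; rewrite Theta_invK //; case: oF.
Qed.

Lemma Theta_iso : isomorphism X (open_brick K beta) (Theta K beta).
Proof.
apply: (@rat_map_iso _ _ _ _ _ _ Theta_inv).
- exact: affine_has_coord.
- by apply: flags_has_coord => F [/brick_flags].
- exact: Theta_open.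
- by move=> F oF; apply/braid_varietyP; rewrite Theta_invK //; case: oF.
- by move=> z _; exact: ThetaK.
- exact: Theta_invK.
- exact: Theta_rat_map.
- apply: rat_map_movable => [|F v oF Fv]; first exact: affine_movable.
  have [u Fu] := open_brick_chart oF; rewrite Fu in oF Fv.
  have YB : open_brick K beta `<=` bott_samelson K beta by move=> G [[]].
  have [rC near] := chart_near YB oF Fv.
  exists (fun w => braid_coord (\row_t chart_coord beta (fun=> true) (mats w) t)).
    by apply: rat_braid_coord => a b; apply: rat_at_ext (rC b) => w; rewrite mxE.
  by apply: znear_imp near => w _ h z Bz /(h z Bz) ->; rewrite /Theta_inv chartK.
Qed.

Lemma brick_boundary : brick K beta `\` open_brick K beta = boundary beta.
Proof.
apply/seteqP; split=> F [BF].
  move=> noF; split=> //; apply: contrapT => /forallNP mv; apply: noF.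
  exact: moving_open_brick.
by move=> [t st]; split=> // -[_ [_ mv]]; exact: mv st.
Qed.

Lemma removable_letter_rev (k : 'I_l) :
  demazure (remove_letter k (rev beta)) = demazure (rev beta) <->
  removable_letter beta (rev_ord k).
Proof.
have -> : remove_letter k (rev beta) = rev (remove_letter (rev_ord k) beta).
  rewrite /remove_letter take_rev drop_rev rev_cat size_tuple /=; congr (rev _ ++ _).
  by congr (drop _ _); have := ltn_ord k; lia.
rewrite !demazure_rev; split=> [/invg_inj//|e].
by rewrite e.
Qed.

End Parametrization.

Local Open Scope complex_scope.

Theorem theorem1p4 (R : realType) (n l : nat) (beta : l.-tuple 'I_n.-1) :
  let X := braid_variety R[i] [tuple of rev beta] (demazure beta) in
  let D := brick R[i] beta `\` Theta R[i] beta @` X in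
  let removable (k : 'I_l) :=
    demazure (remove_letter k (rev beta)) = demazure (rev beta) in
  [/\ regular_map setT (flags R[i] n l.+1) (Theta R[i] beta)
        /\ isomorphism X (open_brick R[i] beta) (Theta R[i] beta),
      [/\ normal_crossing_divisor (brick R[i] beta) D,
          forall Z, irreducible_component D Z <->
            exists2 k : 'I_l, removable k & Z = brick_wall R[i] beta k
        & forall k k' : 'I_l, removable k -> removable k' ->
            brick_wall R[i] beta k = brick_wall R[i] beta k' -> k = k']
    & [/\ affine_variety X, smooth (brick R[i] beta)
        & good_compactification X (brick R[i] beta) (Theta R[i] beta)]].
Proof.
move=> X D removable.
have charK : [pchar R[i]] =i pred0 by exact: Num.Theory.pchar_num.
have DE : D = boundary beta by rewrite /D Theta_image brick_boundary.
have ncd : normal_crossing_divisor (brick R[i] beta) D.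
  by rewrite DE; apply: walls_normal_crossing; exact: boundary_closed.
split.
- by split; [exact: Theta_regular|exact: Theta_iso].
- split=> // [Z|k k' rk rk' e].
    rewrite DE boundary_components //; split=> [[t rt ->]|[k rk ->]].
      exists (rev_ord t); first by apply/removable_letter_rev; rewrite rev_ordK.
      by rewrite /brick_wall rev_ordK.
    by exists (rev_ord k) => //; exact/removable_letter_rev.
  have rt := (removable_letter_rev beta k').1 rk'.
  apply: rev_ord_inj; apply: (wall_subset_eq charK rt) => F.
  by rewrite -[wall _ _]/(brick_wall R[i] beta k') -e.
- split; [exact: braid_variety_affine|exact: brick_smooth|].
  rewrite /good_compactification -/D; split=> //.
  + exact: flags_closed_projective (brick_closed _ _).
  + by rewrite Theta_image; split; [move=> F []|rewrite brick_boundary; exact: boundary_closed].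
  + by rewrite Theta_image; exact: Theta_iso.
  + by rewrite Theta_image; exact: open_brick_dense.
Qed.
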